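(* Let $(X_n)$ be generated by the $\lambda$-SAGA algorithm (defined in the context) with a fixed $\lambda\in[0,1]$ and step $\gamma_n=1/n$. Assume that each $\nabla f_k$ is continuous, that $f$ is twice differentiable with a unique point $x^*\in\mathbb R^d$ such that $\nabla f(x^* )=0$, and that the smallest eigenvalue $\rho$ of the Hessian $H=\nabla^2f(x^* )$ satisfies $\rho>1/2$. Assume moreover that $\lim_{n\to\infty}X_n=x^*$ almost surely. Then $$\sqrt n\,(X_n-x^* )\xrightarrow[n\to\infty]{\mathcal L}\mathcal N_d(0,\Sigma),\qquad \Sigma=(1-\lambda)^2\int_0^\infty\big(e^{-(H-I_d/2)u}\big)^T\,\Gamma\,e^{-(H-I_d/2)u}\,du,$$ where $\Gamma=\frac1N\sum_{k=1}^N\nabla f_k(x^* )\big(\nabla f_k(x^* )\big)^T$. (In particular, for $\lambda=1$ the limit is the Dirac mass at $0$.)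
   Context: Let $N,d\ge1$ be integers, $f_1,\dots,f_N:\mathbb R^d\to\mathbb R$ differentiable, and $f=\frac1N\sum_{k=1}^N f_k$. The $\lambda$-SAGA algorithm with parameter $\lambda\in[0,1]$ and positive deterministic steps $(\gamma_n)_{n\ge1}$: let $X_0,X_1$ be square-integrable random vectors in $\mathbb R^d$ and $(U_n)_{n\ge2}$ i.i.d. uniform on $\{1,\dots,N\}$, independent of $(X_0,X_1)$. Set $g_{1,k}=\nabla f_k(X_0)$ for $k=1,\dots,N$ and for $n\ge1$: $X_{n+1}=X_n-\gamma_n\Big(\nabla f_{U_{n+1}}(X_n)-\lambda\big(g_{n,U_{n+1}}-\frac1N\sum_{k=1}^N g_{n,k}\big)\Big)$, and $g_{n+1,k}=\nabla f_k(X_n)$ if $U_{n+1}=k$, $g_{n+1,k}=g_{n,k}$ otherwise. $I_d$ is the $d\times d$ identity matrix. *)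

(* Defs.v *)
From HB Require Import structures.
From mathcomp Require Import all_boot all_order all_algebra.
From mathcomp Require Import all_classical all_reals all_analysis.
Set Implicit Arguments. Unset Strict Implicit. Unset Printing Implicit Defensive.
Import Order.TTheory GRing.Theory Num.Theory.
Import numFieldNormedType.Exports.
Local Open Scope classical_set_scope.
Local Open Scope ring_scope.

Definition grad {R : realType} {d : nat} (f : 'rV[R]_d -> R) (x : 'rV[R]_d)
  : 'rV[R]_d := \row_i derive f x (delta_mx 0 i).

Definition hessian {R : realType} {d : nat} (f : 'rV[R]_d -> R) (x : 'rV[R]_d)
  : 'M[R]_d := \matrix_(i, j) derive (fun y => grad f y ord0 i) x (delta_mx 0 j).

Definition expmx {R : realType} {d : nat} (M : 'M[R]_d) : 'M[R]_d :=
  \matrix_(i, j) limn (fun n : nat => \sum_(k < n) (M ^+ k) i j / (k`!)%:R).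

Definition favg {R : realType} {d N : nat} (F : 'I_N -> 'rV[R]_d -> R)
  (x : 'rV[R]_d) : R := N%:R^-1 * \sum_(k < N) F k x.

(* lambda-SAGA.  State at time m.+1 : (X_{m+1}, (g_{m+1,k})_k).
   Indices k of f_k range over 'I_N = {0,..,N-1} (i.e. {1,..,N} shifted). *)
Fixpoint saga_state {R : realType} {d N : nat} {T : Type}
  (F : 'I_N -> 'rV[R]_d -> R) (lam : R) (gamma : nat -> R)
  (X0 X1 : T -> 'rV[R]_d) (U : nat -> T -> 'I_N) (m : nat) (w : T)
  : 'rV[R]_d * ('I_N -> 'rV[R]_d) :=
  match m with
  | 0 => (X1 w, fun k => grad (F k) (X0 w))
  | m'.+1 =>
      let s := saga_state F lam gamma X0 X1 U m' w in
      let x := s.1 in let g := s.2 in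
      let n := m'.+1 in
      let u := U n.+1 w in
      (x - gamma n *: (grad (F u) x
                       - lam *: (g u - N%:R^-1 *: \sum_(k < N) g k)),
       fun k => if u == k then grad (F k) x else g k)
  end.

Definition saga_X {R : realType} {d N : nat} {T : Type}
  (F : 'I_N -> 'rV[R]_d -> R) (lam : R) (gamma : nat -> R)
  (X0 X1 : T -> 'rV[R]_d) (U : nat -> T -> 'I_N) (n : nat) (w : T)
  : 'rV[R]_d :=
  match n with
  | 0 => X0 w
  | n'.+1 => (saga_state F lam gamma X0 X1 U n' w).1
  end.

Definition sq_integrable_rv {R : realType} {dT : measure_display}
  {T : measurableType dT} {d : nat} (P : probability T R)
  (X : T -> 'rV[R]_d) : Prop :=
  forall i : 'I_d, measurable_fun setT (fun w => X w ord0 i) /\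
    P.-integrable setT (fun w => ((X w ord0 i) ^+ 2)%:E).

Definition sigma_pair {R : realType} {T : Type} {d : nat}
  (X0 X1 : T -> 'rV[R]_d) : set (set T) :=
  <<s [set A | exists (i : 'I_d) (B : set R), measurable B /\
          (A = (fun w => X0 w ord0 i) @^-1` B \/
           A = (fun w => X1 w ord0 i) @^-1` B)] >>.

(* (U_n)_{n>=2} i.i.d. uniform on 'I_N and independent of (X0, X1):
   for every E in sigma(X0,X1), every n and every values u_2..u_n,
   P(E /\ U_2 = u_2 /\ ... /\ U_n = u_n) = P(E) * (1/N)^(n-1). *)
Definition saga_noise {R : realType} {dT : measure_display}
  {T : measurableType dT} {d N : nat} (P : probability T R)
  (X0 X1 : T -> 'rV[R]_d) (U : nat -> T -> 'I_N) : Prop :=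
  (forall n (u : 'I_N), (2 <= n)%N -> measurable (U n @^-1` [set u])) /\
  forall (E : set T), sigma_pair X0 X1 E ->
  forall (n : nat) (u : nat -> 'I_N),
    P (E `&` [set w | forall k, (2 <= k <= n)%N -> U k w = u k])
    = (P E * ((N%:R^-1 : R) ^+ n.-1)%:E)%E.

(* Z is a centered Gaussian vector N_d(0, S) (defined through its
   characteristic function E[exp(i <t,Z>)] = exp(-t S t^T / 2)). *)
Definition gaussian_vec {R : realType} {dZ : measure_display}
  {TZ : measurableType dZ} {d : nat} (Q : probability TZ R)
  (Z : TZ -> 'rV[R]_d) (S : 'M[R]_d) : Prop :=
  (forall i : 'I_d, measurable_fun setT (fun w => Z w ord0 i)) /\
  forall t : 'rV[R]_d,
    Rintegral Q setT (fun w => cos ((Z w *m t^T) ord0 ord0))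
      = expR (- ((t *m S *m t^T) ord0 ord0) / 2) /\
    Rintegral Q setT (fun w => sin ((Z w *m t^T) ord0 ord0)) = 0.

Definition cvg_law {R : realType} {dT dZ : measure_display}
  {T : measurableType dT} {TZ : measurableType dZ} {d : nat}
  (P : probability T R) (Y : nat -> T -> 'rV[R]_d)
  (Q : probability TZ R) (Z : TZ -> 'rV[R]_d) : Prop :=
  forall g : 'rV[R]_d -> R, continuous g ->
    (exists M : R, forall x, `|g x| <= M) ->
    (fun n => Rintegral P setT (fun w => g (Y n w))) @ \oo
      --> Rintegral Q setT (fun w => g (Z w)).

(* Gamma = (1/N) sum_k grad f_k(xs) grad f_k(xs)^T  (column-vector convention) *)
Definition Gamma_mx {R : realType} {d N : nat} (F : 'I_N -> 'rV[R]_d -> R)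
  (xs : 'rV[R]_d) : 'M[R]_d :=
  N%:R^-1 *: \sum_(k < N) ((grad (F k) xs)^T *m grad (F k) xs).

Definition Sigma_mx {R : realType} {d : nat} (lam : R) (H G : 'M[R]_d)
  : 'M[R]_d :=
  (1 - lam) ^+ 2 *: \matrix_(i, j)
    Rintegral (@lebesgue_measure R) `[0%R, +oo[
      (fun u : R => (((expmx (- (u *: (H - (2%:R^-1)%:M))))^T *m G
                       *m expmx (- (u *: (H - (2%:R^-1)%:M)))) i j)).

(* Main.v *)
(* Schwarz's theorem makes the Hessian H symmetric, so H = Q^-1 diag(h) Q with all
   h_i > 1/2, and y_n = (X_n - xs) Q^-1 satisfies
     y_{n+1,i} = (1 - h_i/n) y_{n,i} - (q_{n,i} + e_{n,U_{n+1},i} + z_{U_{n+1},i}) / n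
   where q is the linearisation error of grad f, z_u = (1 - lam) grad f_u(xs) Q^-1 and
   e -> 0 almost surely, because every index is drawn infinitely often; z and e are
   centred in the index.  The linear process L obtained with q = e = 0 is Gaussian in
   the limit: integrating out one draw at a time, its characteristic function at
   sqrt n t differs from the Gaussian one by at most n^(3/2) B_n |t|^3, which tends to
   0 because B_{n+1} = (1 - rho/n)^3 B_n + O(n^-3) with rho = min h_i > 1/2; and
   n E[L_i L_j] converges to cov(z_i, z_j) / (h_i + h_j - 1), the (i, j) entry in these
   coordinates of the integral defining Sigma.  On the event that y and e stay
   small after a time m, v_n = n E|y_n - L_n|^2 satisfies v_{n+1} <= (1 - k/n) v_n + k b/n with b
   arbitrarily small, hence sqrt n (y_n - L_n) -> 0 in probability.  Weak convergence
   follows from the convergence of E cos(<t, V_n> + a) and tightness, by uniform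
   approximation with trigonometric polynomials on compact sets. *)
Require Import Defs.
From HB Require Import structures.
From mathcomp Require Import all_boot all_order all_algebra.
From mathcomp Require Import all_classical all_reals all_analysis.
From mathcomp Require Import measurable_realfun ring lra.
From mathcomp Require mxpoly mxred spectral sesquilinear complex.
Set Implicit Arguments.
Unset Strict Implicit.
Unset Printing Implicit Defensive.
Import Order.TTheory GRing.Theory Num.Theory.
Import numFieldNormedType.Exports.
Local Open Scope classical_set_scope.
Local Open Scope ring_scope.

(** * Bounded measurable functions and expectations *)

(** Almost sure convergence gives no moment bound on X_n, so a second-moment recursion for y cannot
    be written directly. Two devices get around this. L is driven by the same draws as y, so that
    the noise z_u, the only noise surviving in the limit, cancels in y - L; and y - L is multiplied
    by the indicator of having stayed near the limit since time m, which makes every integrated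
    function bounded. This indicator depends on the past alone, so the fresh index can still be
    averaged out. No conditional expectation is formed: as the index takes N values, the expectation
    of a function of the past and of U_{n+1} is the mean of N expectations ([Ex_next]), a
    consequence of the product rule on cylinders. Since grad f is only known to be differentiable, q
    is o(|y|) without a rate. The gap 2 rho - 1 > 0 in the contraction of n E|y - L|^2 pays for it:
    a fixed fraction of the gap is spent on q. The law N(0, Sigma) has to be constructed, which
    requires Sigma to be positive semidefinite; this is read off the limit of the expectations of
    cosines, which cannot exceed 1. *)

Definition bmeas {d} {T : measurableType d} {R : realType} (f : T -> R) :=
  measurable_fun setT f /\ exists M : R, forall w, `|f w| <= M.

Local Notation "'Ex' P f" := (Rintegral P setT f) (at level 10, P, f at level 9).

Lemma bmeas_cst d (T : measurableType d) (R : realType) (c : R) :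
  bmeas (fun _ : T => c).
Proof. by split; [exact: measurable_cst | exists `|c|]. Qed.

Lemma bmeasD d (T : measurableType d) (R : realType) (f g : T -> R) :
  bmeas f -> bmeas g -> bmeas (fun w => f w + g w).
Proof.
move=> [mf [M fM]] [mg [K gK]]; split; first exact: measurable_funD.
by exists (M + K) => w; rewrite (le_trans (ler_normD _ _))// lerD.
Qed.

Lemma bmeasM d (T : measurableType d) (R : realType) (f g : T -> R) :
  bmeas f -> bmeas g -> bmeas (fun w => f w * g w).
Proof.
move=> [mf [M fM]] [mg [K gK]]; split; first exact: measurable_funM.
by exists (M * K) => w; rewrite normrM ler_pM.
Qed.

Lemma bmeasZ d (T : measurableType d) (R : realType) (c : R) (f : T -> R) :
  bmeas f -> bmeas (fun w => c * f w).
Proof. exact/bmeasM/bmeas_cst. Qed.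

Lemma bmeasB d (T : measurableType d) (R : realType) (f g : T -> R) :
  bmeas f -> bmeas g -> bmeas (fun w => f w - g w).
Proof.
move=> bf /(bmeasZ (-1)) bg; have := bmeasD bf bg.
by under eq_fun do rewrite mulN1r.
Qed.

Lemma bmeas_sum d (T : measurableType d) (R : realType) (I : Type) (s : seq I)
    (f : I -> T -> R) :
  (forall i, bmeas (f i)) -> bmeas (fun w => \sum_(i <- s) f i w).
Proof.
move=> bf; elim: s => [|i s IH].
  by under eq_fun do rewrite big_nil; exact: bmeas_cst.
by under eq_fun do rewrite big_cons; exact: bmeasD.
Qed.

Lemma bmeas_indic d (T : measurableType d) (R : realType) (A : set T) :
  measurable A -> bmeas (\1_A : T -> R).
Proof.
move=> mA; split; first exact: measurable_indic.
by exists 1 => w; rewrite indicE; case: (_ \in _); rewrite ?normr1 ?normr0.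
Qed.

Lemma bmeas_cos d (T : measurableType d) (R : realType) (f : T -> R) :
  measurable_fun setT f -> bmeas (fun w => cos (f w)).
Proof.
move=> mf; split; last by exists 1 => w; rewrite ler_norml cos_geN1 cos_le1.
exact: (measurableT_comp (continuous_measurable_fun (@continuous_cos R)) mf).
Qed.

Lemma bmeas_integrable d (T : measurableType d) (R : realType)
    (P : probability T R) (f : T -> R) :
  bmeas f -> P.-integrable setT (EFin \o f).
Proof.
move=> [mf [M fM]]; apply: measurable_bounded_integrable => //.
  by apply: (le_lt_trans (probability_le1 P measurableT)); rewrite ltry.
by exists M; split; rewrite ?num_real// => x Mx y _; apply: le_trans (ltW Mx).
Qed.

Section expectation.
Context d (T : measurableType d) (R : realType) (P : probability T R).
Implicit Types f g : T -> R.

Lemma ExD f g : bmeas f -> bmeas g ->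
  Ex P (fun w => f w + g w) = Ex P f + Ex P g.
Proof. by move=> bf bg; rewrite RintegralD//; exact: bmeas_integrable. Qed.

Lemma ExB f g : bmeas f -> bmeas g ->
  Ex P (fun w => f w - g w) = Ex P f - Ex P g.
Proof. by move=> bf bg; rewrite RintegralB//; exact: bmeas_integrable. Qed.

Lemma ExZ c f : bmeas f -> Ex P (fun w => c * f w) = c * Ex P f.
Proof. by move=> bf; rewrite RintegralZl//; exact: bmeas_integrable. Qed.

Lemma Ex_cst c : Ex P (fun=> c) = c.
Proof.
rewrite Rintegral_cst// -[RHS]mulr1; congr (_ * _).
exact: (congr1 fine (probability_setT P)).
Qed.

Lemma Ex_le f g : bmeas f -> bmeas g -> (forall w, f w <= g w) ->
  Ex P f <= Ex P g.
Proof.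
by move=> bf bg fg; apply: le_Rintegral => //; exact: bmeas_integrable.
Qed.

Lemma Ex_norm f : bmeas f -> `|Ex P f| <= Ex P (fun w => `|f w|).
Proof. by move=> bf; apply: le_normr_Rintegral => //; exact: bmeas_integrable. Qed.

Lemma bmeas_norm f : bmeas f -> bmeas (fun w => `|f w|).
Proof.
move=> [mf [M fM]]; split; first exact: measurableT_comp.
by exists M => w; rewrite normr_id.
Qed.

Lemma Ex_sum (I : Type) (s : seq I) (f : I -> T -> R) :
  (forall i, bmeas (f i)) ->
  Ex P (fun w => \sum_(i <- s) f i w) = \sum_(i <- s) Ex P (f i).
Proof.
move=> bf; elim: s => [|i s IH].
  by rewrite big_nil; under eq_Rintegral do rewrite big_nil; exact: Ex_cst.
rewrite big_cons -IH -ExD//; last exact: bmeas_sum.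
by apply: eq_Rintegral => w _; rewrite big_cons.
Qed.

Lemma Ex_ge0 f : (forall w, 0 <= f w) -> 0 <= Ex P f.
Proof. by move=> f0; apply: Rintegral_ge0. Qed.

Lemma Ex_indic (A : set T) : measurable A -> Ex P (\1_A) = fine (P A).
Proof. by move=> mA; rewrite /Rintegral integral_indic// setIT. Qed.

End expectation.

Lemma cvgr_sum (R : realType) (V : normedModType R) (T : Type) (F : set_system T)
    {FF : Filter F} (I : Type) (s : seq I) (f : I -> T -> V) (l : I -> V) :
  (forall i, f i x @[x --> F] --> l i) ->
  \sum_(i <- s) f i x @[x --> F] --> \sum_(i <- s) l i.
Proof.
move=> fl; elim: s => [|i s IH].
  by under eq_fun do rewrite big_nil; rewrite big_nil; exact: cvg_cst.
by under eq_fun do rewrite big_cons; rewrite big_cons; exact: cvgD.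
Qed.

Lemma cvg_mulmx_coord (R : realType) (T : Type) (F : set_system T) {FF : Filter F}
    m n (f : T -> 'rV[R]_m) (l : 'rV[R]_m) (B : 'M[R]_(m, n)) i :
  f x @[x --> F] --> l -> (f x *m B) ord0 i @[x --> F] --> (l *m B) ord0 i.
Proof.
move=> fl; under eq_fun do rewrite mxE; rewrite mxE; apply: cvgr_sum => j.
apply: cvgM; last exact: cvg_cst.
by apply: (cvg_comp f (fun v : 'rV[R]_m => v ord0 j) fl); exact: coord_continuous.
Qed.

(** * Gaussian vectors *)

(** The change of variables goes through the Radon-Nikodym derivative, which agrees with the normal
    density almost everywhere. *)
Lemma Rintegral_normal_prob (R : realType) (f : measurableTypeR R -> R) :
  bmeas f ->
  Ex (normal_prob (0 : R) 1) f =
  Rintegral lebesgue_measure setT (fun x => f x * normal_pdf 0 1 x).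
Proof.
move=> bf; congr fine; have mf := bf.1.
have dom := normal_prob_dominates (0 : R) 1.
transitivity (\int[lebesgue_measure]_(x in setT) ((f x)%:E * (normal_pdf 0 1 x)%:E))%E; last first.
  by apply: eq_integral => x _; rewrite EFinM.
rewrite -(Radon_Nikodym_change_of_variables dom)//=; last first.
  exact: (bmeas_integrable (normal_prob (0 : R) 1) bf).
apply: ae_eq_integral => //.
- apply: emeasurable_funM; first exact/measurable_EFinP.
  by apply: (measurable_int lebesgue_measure); exact: Radon_Nikodym_integrable.
- apply: emeasurable_funM; first exact/measurable_EFinP.
  by apply/measurable_EFinP; exact: measurable_normal_pdf.
- apply: ae_eqe_mul2l => /=; rewrite Radon_NikodymE.
  case: cid => /= h [h1 h2 h3].
  apply: integral_ae_eq => //=.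
  + by apply/measurable_EFinP; exact: measurable_normal_pdf.
  + by move=> E E01 mE; rewrite -h3.
Qed.

(** * Characteristic function of the standard normal law *)

Section normal_cos.
Context {R : realType}.
Notation mu := (@lebesgue_measure R).
Let p : R -> R := normal_pdf 0 1.

Let pE x : p x = normal_peak 1 * expR (- x ^+ 2 / 2).
Proof.
by rewrite /p normal_pdfE ?oner_neq0// /normal_fun subr0 expr1n.
Qed.

Let is_derive_p (x : R) : is_derive x 1 p (- x * p x).
Proof.
have -> : p = fun x => normal_peak 1 * expR (- x ^+ 2 / 2).
  by apply/funext => y; rewrite pE.
by apply: is_derive_eq; rewrite /GRing.scale/=; field.
Qed.

Let expR_sqr_ge (x : R) : `|x| <= expR (x ^+ 2 / 4).
Proof.
apply: le_trans (expR_ge1Dx _); rewrite -(real_normK (num_real x)).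
have : 0 <= (`|x| / 2 - 1) ^+ 2 by rewrite sqr_ge0.
by move: (`|x|) => y; nra.
Qed.

(** Half of the Gaussian exponent absorbs the factor |x|, leaving a multiple of the normal density
    of variance 2. *)
Let integrable_xp : mu.-integrable setT (fun x => (`|x| * p x)%:E).
Proof.
have s2 : Num.sqrt 2 != 0 :> R by rewrite gt_eqF// sqrtr_gt0.
apply: (le_integrable measurableT _ _
  (integrableZl measurableT (normal_peak 1 / normal_peak (Num.sqrt 2))
    (integrable_normal_pdf 0 (Num.sqrt 2)))).
  apply/measurable_EFinP; apply: measurable_funM; last exact: measurable_normal_pdf.
  exact: normr_measurable.
move=> x _; rewrite -EFinM !abse_EFin lee_fin ger0_norm; last first.
  by rewrite mulr_ge0// normal_pdf_ge0.
rewrite pE normal_pdfE// /normal_fun subr0 sqr_sqrtr//.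
apply: le_trans (ler_norm _).
rewrite [leRHS]mulrA divfK; last by rewrite gt_eqF// normal_peak_gt0.
rewrite mulrCA; apply: ler_wpM2l; first exact: normal_peak_ge0.
have -> : - x ^+ 2 / 2 = - x ^+ 2 / (2 *+ 2) + - x ^+ 2 / (2 *+ 2) by field.
rewrite expRD mulrA ger_pMl ?expR_gt0//.
rewrite mulNr expRN -[leRHS](mulfV (x := expR (x ^+ 2 / 4))) ?gt_eqF ?expR_gt0//.
have -> : 2 *+ 2 = 4 :> R by ring.
by rewrite ler_wpM2r ?invr_ge0 ?expR_ge0 ?expR_sqr_ge.
Qed.

Let mcosl (t a : R) : measurable_fun setT (fun x : measurableTypeR R => cos (t * x + a)).
Proof.
apply: measurableT_comp; first exact: (continuous_measurable_fun (@continuous_cos R)).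
by apply: measurable_funD => //; exact: measurable_funM.
Qed.

Let msinl (t a : R) : measurable_fun setT (fun x : measurableTypeR R => sin (t * x + a)).
Proof.
apply: measurableT_comp; first exact: (continuous_measurable_fun (@continuous_sin R)).
by apply: measurable_funD => //; exact: measurable_funM.
Qed.

Let integrable_cosp (t a : R) :
  mu.-integrable setT (fun x => (cos (t * x + a) * p x)%:E).
Proof.
apply: (le_integrable measurableT _ _ (integrable_normal_pdf 0 1)).
  apply/measurable_EFinP; apply: measurable_funM; last exact: measurable_normal_pdf.
  exact: mcosl.
move=> x _; rewrite !abse_EFin lee_fin normrM -[leRHS]mul1r ler_wpM2r//.
by rewrite ler_norml cos_geN1 cos_le1.
Qed.

Let integrable_xsinp (t a : R) :
  mu.-integrable setT (fun x => (- x * sin (t * x + a) * p x)%:E).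
Proof.
apply: (le_integrable measurableT _ _ integrable_xp).
  apply/measurable_EFinP; apply: measurable_funM; last exact: measurable_normal_pdf.
  apply: measurable_funM; last exact: msinl.
  exact: oppr_measurable.
move=> x _; rewrite !abse_EFin lee_fin !normrM normrN normr_id ler_wpM2r//.
by rewrite ler_piMr// ler_norml sin_geN1 sin_le1.
Qed.


Let C (a t : R) : R := Rintegral mu setT (fun x => cos (t * x + a) * p x).

Let is_derive_cosl (a t x : R) :
  is_derive t 1 (fun t => cos (t * x + a) * p x) (- x * sin (t * x + a) * p x).
Proof. by apply: is_derive_eq; rewrite /GRing.scale/=; ring. Qed.

Let is_derive_sinp (a t x : R) :
  is_derive x 1 (fun x => sin (t * x + a) * p x)
    (t * (cos (t * x + a) * p x) + - x * sin (t * x + a) * p x).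
Proof.
have dp := is_derive_p x.
by apply: is_derive_eq; rewrite /GRing.scale/=; ring.
Qed.

Let is_derive_C (a t : R) :
  is_derive t 1 (C a) (Rintegral mu setT (fun x => - x * sin (t * x + a) * p x)).
Proof.
have d1E s y : partial1of2 (fun t x => cos (t * x + a) * p x) s y =
    - y * sin (s * y + a) * p y.
  by rewrite partial1of2E; have [_ ->] := is_derive_cosl a s y.
have tI : `]t - 1, t + 1[%classic t.
  by rewrite /= in_itv/= ltrBlDr ltrDl ltr01.
have dom y : 0 <= `|y| * p y by rewrite mulr_ge0// normal_pdf_ge0.
have bnd x y : `]t - 1, t + 1[%classic x -> setT y ->
    `|partial1of2 (fun t x => cos (t * x + a) * p x) x y| <= `|y| * p y.
  move=> _ _; rewrite d1E !normrM normrN (ger0_norm (normal_pdf_ge0 _ _ _)).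
  apply: ler_wpM2r; first exact: normal_pdf_ge0.
  by rewrite ler_piMr// ler_norml sin_geN1 sin_le1.
have D (x y : R) : `]t - 1, t + 1[%classic x -> setT y ->
    derivable (fun t : R => cos (t * y + a) * p y) x 1.
  by move=> _ _; have [] := is_derive_cosl a x y.
apply: DeriveDef.
  exact: (derivable_under_integral measurableT tI
    (fun x _ => integrable_cosp x a) D dom integrable_xp bnd).
rewrite -derive1E (differentiation_under_integral measurableT tI
    (fun x _ => integrable_cosp x a) D dom integrable_xp bnd).
by apply: eq_Rintegral => y _; rewrite d1E.
Qed.

Let k (a t x : R) := t * (cos (t * x + a) * p x) + - x * sin (t * x + a) * p x.

Let integrable_k (a t : R) : mu.-integrable setT (fun x => (k a t x)%:E).
Proof.
apply: eq_integrable (integrableD measurableT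
  (integrableZl measurableT t (integrable_cosp t a)) (integrable_xsinp t a)) => //.
Qed.

Let continuous_k (a t : R) : continuous (k a t).
Proof.
move=> x; have dp := is_derive_p x; apply/differentiable_continuous/derivable1_diffP.
suff [e [dk _]] : exists e, is_derive x (1 : R) (k a t) e by [].
by eexists; rewrite /k; apply: is_derive_eq.
Qed.

Let p_le (n : nat) : `|p n.+1%:R| <= normal_peak 1 * n.+1%:R^-1 /\
  `|p (- n.+1%:R)| <= normal_peak 1 * n.+1%:R^-1.
Proof.
have pN : p (- n.+1%:R) = p n.+1%:R by rewrite !pE sqrrN.
rewrite pN ger0_norm ?normal_pdf_ge0// pE; suff h :
  normal_peak 1 * expR (- n.+1%:R ^+ 2 / 2) <= normal_peak 1 * n.+1%:R^-1 :> R by [].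
apply: ler_wpM2l; first exact: normal_peak_ge0.
rewrite mulNr expRN lef_pV2 ?posrE ?expR_gt0//.
apply: le_trans (expR_ge1Dx _).
have : 0 <= (n.+1%:R - 1) ^+ 2 :> R by rewrite sqr_ge0.
by move: n.+1%:R => y; nra.
Qed.

(** Integration by parts on the line: [k a t] is the derivative of sin (t x + a) p x, which vanishes
    at both ends. Dominated convergence passes from [-n-1, n+1] to the whole line. *)
Let Rintegral_k (a t : R) : Rintegral mu setT (k a t) = 0.
Proof.
pose I (n : nat) : set R := `[- n.+1%:R, n.+1%:R]%classic.
pose S x := sin (t * x + a) * p x.
have IE n : (\int[mu]_(x in I n) (k a t x)%:E = (S n.+1%:R - S (- n.+1%:R))%:E)%E.
  rewrite EFinB; apply: continuous_FTC2.
  - by rewrite gtrN.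
  - exact/continuous_subspaceT/continuous_k.
  - have dS x : derivable S x 1 by have [] := is_derive_sinp a t x.
    have cS x : {for x, continuous S}.
      exact/differentiable_continuous/derivable1_diffP.
    split => //; first exact/cvg_at_right_filter/cS.
    exact/cvg_at_left_filter/cS.
  - by move=> x _; rewrite derive1E; have [_ ->] := is_derive_sinp a t x.
have I0 : (\int[mu]_(x in I n) (k a t x)%:E @[n --> \oo] --> 0)%E.
  under eq_fun do rewrite IE; apply: cvg_EFin; first exact: nearW.
  apply/norm_cvg0P.
  apply: (@squeeze_cvgr _ _ _ _ (cst 0) (fun n => 2 * normal_peak 1 * n.+1%:R^-1)).
  - near=> n; rewrite /= normr_ge0/= (le_trans (ler_normB _ _))//.
    have [p1 p2] := p_le n.
    have sp x : `|S x| <= `|p x|.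
      by rewrite normrM ler_piMl// ler_norml sin_geN1 sin_le1.
    rewrite -mulrA mulr_natl mulr2n lerD//; exact: le_trans (sp _) _.
  - exact: cvg_cst.
  - rewrite -[X in _ --> X](mulr0 (2 * normal_peak 1)).
    by apply: cvgM; [exact: cvg_cst | exact: cvg_harmonic].
have I1 : (\int[mu]_(x in I n) (k a t x)%:E @[n --> \oo] --> \int[mu]_x (k a t x)%:E)%E.
  under eq_fun do rewrite integral_mkcond.
  apply: (@dominated_cvg _ _ _ mu _ measurableT
    (fun n => (fun x => (k a t x)%:E) \_ (I n)) _ (fun x => `|(k a t x)%:E|%E)).
  - move=> n; have mI : measurable (I n : set (measurableTypeR R)) by exact: measurable_itv.
    apply: (measurable_restrictT _ mI).1; apply: measurable_funTS.
    exact: (measurable_int mu (integrable_k a t)).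
  - move=> x _; apply: cvg_near_cst.
    near=> n; rewrite patchE mem_set// /I /= in_itv/= -ler_norml.
    by apply: (@le_trans _ _ n%:R); [near: n; exact: nbhs_infty_ger|rewrite ler_nat].
  - by [].
  - exact: integrable_abse.
  - move=> n x _; rewrite patchE; case: ifP => _ //.
    by rewrite abse0.
by rewrite /Rintegral (cvg_unique _ I1 I0).
Unshelve. all: end_near. Qed.

(** The integral C satisfies C' = - t C, by differentiation under the integral and [Rintegral_k], so
    C times exp (t^2 / 2) is constant in t. *)
Lemma Rintegral_cos_normal_pdf (a t : R) :
  Rintegral mu setT (fun x => cos (t * x + a) * p x) = cos a * expR (- t ^+ 2 / 2).
Proof.
have CE s : Rintegral mu setT (fun x => - x * sin (s * x + a) * p x) = - s * C a s.
  have := Rintegral_k a s; rewrite RintegralD//=; last 2 first.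
    exact: (integrableZl measurableT s (integrable_cosp s a)).
    exact: integrable_xsinp.
  rewrite RintegralZl//; last exact: integrable_cosp.
  by move/eqP; rewrite addrC addr_eq0 mulNr => /eqP.
pose G s := C a s * expR (s ^+ 2 / 2).
have dG (s : R) : is_derive s 1 G 0.
  have dC := is_derive_C a s.
  by apply: is_derive_eq; rewrite /GRing.scale/= CE; field.
have G0 : G t = G 0 by apply: is_derive_0_is_cst => s; exact: dG.
have -> : Rintegral mu setT (fun x => cos (t * x + a) * p x) =
    G t * expR (- t ^+ 2 / 2).
  by rewrite /G -mulrA -expRD mulNr subrr expR0 mulr1.
rewrite G0 /G expr0n/= mul0r expR0 mulr1; congr (_ * _).
rewrite /C; under eq_Rintegral do rewrite mul0r add0r.
rewrite RintegralZl//; last exact: integrable_normal_pdf.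
by rewrite /Rintegral integral_normal_pdf mulr1.
Qed.

End normal_cos.

(** * Square roots of positive semidefinite matrices and construction of Gaussian vectors *)

Definition psdmx {R : realType} {d} (S : 'M[R]_d) :=
  S^T = S /\ forall t : 'rV[R]_d, 0 <= (t *m S *m t^T) ord0 ord0.

Lemma quadform_block (R : realType) (n : nat) (a : 'M[R]_1) (b : 'rV[R]_n)
    (C : 'M[R]_n) (s : R) (t : 'rV[R]_n) :
  (row_mx s%:M t *m block_mx a b b^T C *m (row_mx s%:M t)^T) ord0 ord0 =
  s ^+ 2 * a ord0 ord0 + 2 * s * (b *m t^T) ord0 ord0 + (t *m C *m t^T) ord0 ord0.
Proof.
rewrite mul_row_block tr_row_mx mul_row_col !mulmxDl tr_scalar_mx !mul_scalar_mx.
rewrite !mul_mx_scalar -!scalemxAl.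
have -> : t *m b^T = (b *m t^T)^T by rewrite trmx_mul trmxK.
move: (t *m C *m t^T) (b *m t^T) => u v.
by rewrite !mxE !ord1; ring.
Qed.

Lemma sum_sqr_ge0 (R : realType) n (b : 'rV[R]_n) :
  0 <= (b *m b^T) ord0 ord0.
Proof. by rewrite mxE sumr_ge0// => i _; rewrite mxE -expr2 sqr_ge0. Qed.

Lemma sum_sqr_eq0 (R : realType) n (b : 'rV[R]_n) :
  (b *m b^T) ord0 ord0 = 0 -> b = 0.
Proof.
rewrite mxE => /eqP; rewrite psumr_eq0; last first.
  by move=> i _; rewrite mxE -expr2 sqr_ge0.
move=> /allP b0; apply/rowP => i; have := b0 i (mem_index_enum _).
by rewrite !mxE -expr2 sqrf_eq0 => /eqP.
Qed.

Lemma quadform_rank1 (R : realType) n (b t : 'rV[R]_n) :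
  (t *m (b^T *m b) *m t^T) ord0 ord0 = (b *m t^T) ord0 ord0 ^+ 2.
Proof.
have -> : t *m (b^T *m b) *m t^T = (b *m t^T)^T *m (b *m t^T).
  by rewrite trmx_mul trmxK !mulmxA.
by move: (b *m t^T) => u; rewrite mxE big_ord1 mxE expr2.
Qed.

(** Cholesky factorisation by induction on the size: the Schur complement of a positive pivot a is
    again positive semidefinite, and a zero pivot forces its row b to vanish. *)
Lemma psdmx_sqrt (R : realType) n (S : 'M[R]_n) :
  psdmx S -> exists B : 'M[R]_n, S = B^T *m B.
Proof.
elim: n S => [S _|n IH S [symS posS]]; first by exists 0; rewrite [S]flatmx0 [RHS]flatmx0.
pose a := ulsubmx (S : 'M[R]_(1 + n)); pose b := ursubmx (S : 'M[R]_(1 + n)).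
pose C := drsubmx (S : 'M[R]_(1 + n)).
have SE : (S : 'M[R]_(1 + n)) = block_mx a b b^T C.
  by rewrite -[LHS](@submxK R 1 n 1 n S); congr block_mx; rewrite trmx_ursub symS.
have symC : C^T = C by rewrite trmx_drsub symS.
have pos s (t : 'rV_n) : 0 <= s ^+ 2 * a ord0 ord0
    + 2 * s * (b *m t^T) ord0 ord0 + (t *m C *m t^T) ord0 ord0.
  rewrite -quadform_block -SE; exact: posS.
have a0 : 0 <= a ord0 ord0.
  by have := pos 1 0; rewrite trmx0 !mulmx0 !mxE expr1n mul1r mulr0 !addr0.
have [az|an0] := eqVneq (a ord0 ord0) 0.
  have b0 : b = 0.
    apply: sum_sqr_eq0; apply/eqP; rewrite eq_le; apply/andP; split; last first.
      exact: sum_sqr_ge0.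
    rewrite leNgt; apply/negP => bb.
    set c := (b *m C *m b^T) ord0 ord0.
    (* With a = 0 the form is affine in s along t = b, and this s gives it the value -1. *)
    have := pos (- (c + 1) / (2 * (b *m b^T) ord0 ord0)) b; rewrite az mulr0 add0r -/c.
    suff -> : 2 * (- (c + 1) / (2 * (b *m b^T) ord0 ord0)) * (b *m b^T) ord0 ord0 =
      - (c + 1) by lra.
    by field; rewrite gt_eqF.
  have [|B CB] := IH C.
    by split => // t; have := pos 0 t; rewrite az !mulr0 mul0r !add0r.
  exists (block_mx 0 0 0 B : 'M[R]_(1 + n)); rewrite SE b0.
  rewrite -[RHS]/((block_mx 0 0 0 B : 'M[R]_(1 + n))^T *m (block_mx 0 0 0 B : 'M[R]_(1 + n))).
  rewrite (tr_block_mx (0 : 'M[R]_1)) mulmx_block.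
  rewrite !trmx0 !mul0mx !mulmx0 !addr0 !add0r -CB.
  by have -> : a = 0 by apply/matrixP => i j; rewrite !ord1 az mxE.
have {an0}a_gt0 : 0 < a ord0 ord0 by rewrite lt_neqAle eq_sym an0.
pose r := Num.sqrt (a ord0 ord0).
have r0 : r != 0 by rewrite gt_eqF// sqrtr_gt0.
have rr : r * r = a ord0 ord0 by rewrite -expr2 sqr_sqrtr.
have [|B CB] := IH (C - (r^-1 *: b)^T *m (r^-1 *: b)).
  split; first by rewrite linearB/= trmx_mul trmxK symC.
  (* The s that minimises the form for a given t; the minimum is the Schur complement at t. *)
  move=> t; have := pos (- (b *m t^T) ord0 ord0 / a ord0 ord0) t.
  rewrite mulmxBr mulmxBl.
  have -> (A B : 'M[R]_1) : (A - B) ord0 ord0 = A ord0 ord0 - B ord0 ord0 :> R by rewrite !mxE.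
  rewrite quadform_rank1 -scalemxAl.
  have -> (A : 'M[R]_1) : (r^-1 *: A) ord0 ord0 = r^-1 * A ord0 ord0 :> R by rewrite !mxE.
  set x := (b *m t^T) _ _; set y := (t *m C *m t^T) _ _.
  suff -> : (- x / a ord0 ord0) ^+ 2 * a ord0 ord0 + 2 * (- x / a ord0 ord0) * x + y =
    y - (r^-1 * x) ^+ 2 by [].
  by rewrite -rr; field.
exists (block_mx r%:M (r^-1 *: b) 0 B : 'M[R]_(1 + n)).
rewrite SE -[RHS]/((block_mx r%:M (r^-1 *: b) 0 B : 'M[R]_(1 + n))^T *m
  (block_mx r%:M (r^-1 *: b) 0 B : 'M[R]_(1 + n))).
rewrite (tr_block_mx (r%:M : 'M[R]_1)) mulmx_block tr_scalar_mx !trmx0 !mul0mx !mulmx0 !addr0.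
have -> : r%:M *m (r^-1 *: b) = b by rewrite mul_scalar_mx scalerA divff// scale1r.
have -> : (r^-1 *: b)^T *m r%:M = b^T.
  by rewrite mul_mx_scalar linearZ/= scalerA divff// scale1r.
rewrite -CB addrCA subrr addr0 mul_scalar_mx scale_scalar_mx rr.
by congr (block_mx _ b b^T C); exact: mx11_scalar.
Qed.

(* The arbitrary phase [a] replaces the complex exponential: [a = 0] and
   [a = - pi / 2] give the real and imaginary parts. *)
Definition gauss_cos {R : realType} {dZ} {TZ : measurableType dZ} {d}
    (Q : probability TZ R) (Z : TZ -> 'rV[R]_d) (S : 'M[R]_d) :=
  (forall i, measurable_fun setT (fun w => Z w ord0 i)) /\
  forall (t : 'rV[R]_d) (a : R),
    Ex Q (fun w => cos ((Z w *m t^T) ord0 ord0 + a)) =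
    cos a * expR (- (t *m S *m t^T) ord0 ord0 / 2).

Lemma gauss_cos_gaussian_vec (R : realType) dZ (TZ : measurableType dZ) d
    (Q : probability TZ R) (Z : TZ -> 'rV[R]_d) (S : 'M[R]_d) :
  gauss_cos Q Z S -> gaussian_vec Q Z S.
Proof.
move=> [mZ cZ]; split => // t; split.
  have := cZ t 0; rewrite cos0 mul1r => <-.
  by apply: eq_Rintegral => w _; rewrite addr0.
have := cZ t (- (pi / 2)); rewrite cosN cos_pihalf mul0r => <-.
by apply: eq_Rintegral => w _; rewrite cosBpihalf.
Qed.

Lemma measurable_mulmx_coord (R : realType) dZ (TZ : measurableType dZ) m n
    (Z : TZ -> 'rV[R]_m) (B : 'M[R]_(m, n)) :
  (forall i, measurable_fun setT (fun w => Z w ord0 i)) ->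
  forall i, measurable_fun setT (fun w => (Z w *m B) ord0 i).
Proof.
move=> mZ i; under eq_fun do rewrite mxE; apply: measurable_sum => j.
by apply: measurable_funM.
Qed.

Lemma gauss_cos_mulmx (R : realType) dZ (TZ : measurableType dZ) d
    (Q : probability TZ R) (Z : TZ -> 'rV[R]_d) (S B : 'M[R]_d) :
  gauss_cos Q Z S -> gauss_cos Q (fun w => Z w *m B) (B^T *m S *m B).
Proof.
move=> [mZ cZ]; split; first exact: measurable_mulmx_coord.
move=> t a; have := cZ (t *m B^T) a.
rewrite !trmx_mul !trmxK !mulmxA => <-.
by apply: eq_Rintegral => w _; rewrite mulmxA.
Qed.

Lemma Ex_prod (R : realType) d1 d2 (T1 : measurableType d1)
    (T2 : measurableType d2) (P : probability T1 R) (Q : probability T2 R)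
    (f : T1 * T2 -> R) : bmeas f ->
  Ex (P \x Q)%E f = Ex P (fun x => Ex Q (fun y => f (x, y))).
Proof.
move=> bf; rewrite {1}/Rintegral -integral12_prod_meas1; last first.
  exact: (bmeas_integrable (P \x Q)%E bf).
congr fine; apply: eq_integral => x _; rewrite /fubini_F fineK//.
apply: integrable_fin_num => //; apply: (bmeas_integrable Q (f := fun y => f (x, y))).
by split; [exact: measurableT_comp bf.1 _ | have [M fM] := bf.2; exists M].
Qed.

(** Induction on d by adjoining an independent normal coordinate. Integrating it first, with the
    other coordinates absorbed in the phase, leaves exp (- s^2 / 2) times their own cosine. *)
Lemma gauss_cos_std (R : realType) (d : nat) :
  exists (dZ : measure_display) (TZ : measurableType dZ)
    (Q : probability TZ R) (Z : TZ -> 'rV[R]_d), gauss_cos Q Z 1%:M.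
Proof.
elim: d => [|d [dZ [TZ [Q [Z [mZ cZ]]]]]].
  exists _, (measurableTypeR R), (normal_prob 0 1), (fun=> 0); split => [[]//|t a].
  have -> : (t *m 1%:M *m t^T) ord0 ord0 = 0 by rewrite mxE big_ord0.
  rewrite oppr0 mul0r expR0 mulr1.
  under eq_Rintegral do rewrite mul0mx mxE add0r.
  exact: Ex_cst.
pose Z' (z : TZ * measurableTypeR R) : 'rV[R]_(1 + d) :=
  row_mx (const_mx z.2) (Z z.1).
have mZ' i : measurable_fun setT (fun w => Z' w ord0 i).
  rewrite /Z'; case: (split_ordP i) => j ->.
    by under eq_fun do rewrite row_mxEl mxE; exact: measurable_snd.
  under eq_fun do rewrite row_mxEr.
  exact: (measurableT_comp (mZ j) measurable_fst).
exists _, (TZ * measurableTypeR R)%type, (Q \x normal_prob 0 1)%E, Z'; split => //.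
move=> t a; pose s := (lsubmx (t : 'rV[R]_(1 + d))) ord0 ord0.
pose u := rsubmx (t : 'rV[R]_(1 + d)).
have tE : t = row_mx (lsubmx (t : 'rV[R]_(1 + d))) u by rewrite hsubmxK.
have tT : t^T = col_mx (lsubmx (t : 'rV[R]_(1 + d)))^T u^T.
  by rewrite -tr_row_mx hsubmxK.
have ZE w : (Z' w *m t^T) ord0 ord0 = s * w.2 + (Z w.1 *m u^T) ord0 ord0.
  rewrite /Z' tT mul_row_col mxE.
  by congr (_ + _); rewrite mxE big_ord1 [const_mx _ _ _]mxE [_^T _ _]mxE mulrC.
rewrite Ex_prod; last first.
  apply: bmeas_cos; apply: measurable_funD => //.
  exact: (measurable_mulmx_coord t^T mZ').
under eq_Rintegral => z _.
  under eq_Rintegral => x _ do rewrite ZE /= -addrA.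
  rewrite Rintegral_normal_prob; last first.
    apply: bmeas_cos; apply: measurable_funD => //; exact: measurable_funM.
  rewrite Rintegral_cos_normal_pdf.
  over.
rewrite RintegralZr//; last first.
  apply: (bmeas_integrable Q); apply: bmeas_cos; apply: measurable_funD => //.
  exact: (measurable_mulmx_coord u^T mZ).
rewrite cZ -mulrA -expRD; congr (_ * expR _).
have -> : (t *m 1%:M *m t^T) ord0 ord0 = s * s + (u *m 1%:M *m u^T) ord0 ord0.
  rewrite !mulmx1; transitivity ((row_mx (lsubmx (t : 'rV[R]_(1 + d))) u *m
    col_mx (lsubmx (t : 'rV[R]_(1 + d)))^T u^T) ord0 ord0); first by rewrite -tT -tE.
  rewrite mul_row_col mxE.
  by congr (_ + _); rewrite mxE big_ord1 [_^T _ _]mxE.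
by field.
Qed.

Lemma gauss_cos_exists (R : realType) (d : nat) (S : 'M[R]_d) : psdmx S ->
  exists (dZ : measure_display) (TZ : measurableType dZ)
    (Q : probability TZ R) (Z : TZ -> 'rV[R]_d), gauss_cos Q Z S.
Proof.
move=> /psdmx_sqrt[B ->]; have [dZ [TZ [Q [Z gZ]]]] := gauss_cos_std R d.
by exists dZ, TZ, Q, (fun w => Z w *m B); have := gauss_cos_mulmx B gZ; rewrite mulmx1.
Qed.

(** * Continuity theorem *)

(** Trigonometric polynomials, as an inductive predicate so that convergence, boundedness and
    measurability follow by induction on it. *)
Inductive trigfun (R : realType) (d : nat) : ('rV[R]_d -> R) -> Prop :=
| trigfun_cos (t : 'rV[R]_d) (a : R) :
    trigfun (fun x : 'rV[R]_d => cos ((x *m t^T) ord0 ord0 + a))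
| trigfunD f g : trigfun f -> trigfun g -> trigfun (fun x => f x + g x)
| trigfunZ c f : trigfun f -> trigfun (fun x => c * f x).

(** The product-to-sum formula on generators makes the span an algebra. *)
Lemma trigfunM (R : realType) d (f g : 'rV[R]_d -> R) :
  trigfun f -> trigfun g -> trigfun (fun x => f x * g x).
Proof.
move=> tf tg; elim: tf => [t a|f1 f2 _ IH1 _ IH2|c f1 _ IH]; last 2 first.
- by under eq_fun do rewrite mulrDl; exact: trigfunD.
- by under eq_fun do rewrite -mulrA; exact: trigfunZ.
elim: tg => [u b|g1 g2 _ IH1 _ IH2|c g1 _ IH]; last 2 first.
- by under eq_fun do rewrite mulrDr; exact: trigfunD.
- by under eq_fun do rewrite mulrCA; exact: trigfunZ.
rewrite (_ : (fun _ => _) = fun x : 'rV_d =>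
    2^-1 * (cos ((x *m (t + u)^T) ord0 ord0 + (a + b)) +
            cos ((x *m (t - u)^T) ord0 ord0 + (a - b)))).
  by apply: trigfunZ; apply: trigfunD; exact: trigfun_cos.
apply/funext => x.
have -> : (x *m (t + u)^T) ord0 ord0 = (x *m t^T) ord0 ord0 + (x *m u^T) ord0 ord0.
  by rewrite linearD/= mulmxDr mxE.
have -> : (x *m (t - u)^T) ord0 ord0 = (x *m t^T) ord0 ord0 - (x *m u^T) ord0 ord0.
  by rewrite linearB/= mulmxBr !mxE.
rewrite addrACA (addrACA _ (- _)) -opprD.
move: (_ + a) (_ + b) => A B; rewrite !cosD cosN sinN; lra.
Qed.

Lemma trigfun_cst (R : realType) d (c : R) : trigfun (fun _ : 'rV[R]_d => c).
Proof.
rewrite (_ : (fun _ => c) = fun x : 'rV[R]_d => c * cos ((x *m (0 : 'rV[R]_d)^T) ord0 ord0 + 0)).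
  by apply: trigfunZ; exact: trigfun_cos.
by apply/funext => x; rewrite trmx0 mulmx0 mxE addr0 cos0 mulr1.
Qed.

Lemma trigfun_sum (R : realType) d (I : Type) (s : seq I) (F : I -> 'rV[R]_d -> R) :
  (forall i, trigfun (F i)) -> trigfun (fun x => \sum_(i <- s) F i x).
Proof.
move=> tF; elim: s => [|i s IH].
  by under eq_fun do rewrite big_nil; exact: trigfun_cst.
by under eq_fun do rewrite big_cons; exact: trigfunD.
Qed.

Lemma trigfun_prod (R : realType) d (I : Type) (s : seq I) (F : I -> 'rV[R]_d -> R) :
  (forall i, trigfun (F i)) -> trigfun (fun x => \prod_(i <- s) F i x).
Proof.
move=> tF; elim: s => [|i s IH].
  by under eq_fun do rewrite big_nil; exact: trigfun_cst.
by under eq_fun do rewrite big_cons; exact: trigfunM.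
Qed.

Lemma trigfun_sin_coord (R : realType) d (s : R) (i : 'I_d) :
  trigfun (fun x => sin (s * x ord0 i)).
Proof.
have -> : (fun x : 'rV[R]_d => sin (s * x ord0 i)) = fun x : 'rV[R]_d =>
   cos ((x *m (s *: delta_mx 0 i : 'rV[R]_d)^T) ord0 ord0 + (- (pi / 2))); last first.
  exact: trigfun_cos.
apply/funext => x; rewrite cosBpihalf linearZ/= -scalemxAr [in RHS]mxE.
rewrite mxE (bigD1 i)//= !mxE !eqxx mulr1 big1 ?addr0// => j ji.
by rewrite !mxE (negbTE ji) andbF mulr0.
Qed.

(** The binomial weight C(p, k) u^k (1 - u)^(p - k), built one trial at a time so that its moments
    and its membership in [trigfun] go by induction on p. *)
Fixpoint bern {R : realType} (p k : nat) (u : R) : R :=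
  match p, k with
  | 0, 0 => 1
  | 0, _.+1 => 0
  | p'.+1, 0 => (1 - u) * bern p' 0 u
  | p'.+1, k'.+1 => u * bern p' k' u + (1 - u) * bern p' k'.+1 u
  end.

Section bernstein.
Context {R : realType}.
Implicit Types (u : R) (p k : nat).

Lemma bern_ge0 p k u : 0 <= u <= 1 -> 0 <= bern p k u.
Proof.
move=> /andP[u0 u1]; have v0 : 0 <= 1 - u by rewrite subr_ge0.
elim: p k => [|p IH] [|k]//=; first by rewrite mulr_ge0.
by rewrite addr_ge0// mulr_ge0.
Qed.

Lemma bern_gt p k u : (p < k)%N -> bern p k u = 0.
Proof.
elim: p k => [|p IH] [|k]//= pk.
by rewrite !IH ?mulr0 ?addr0//; exact: ltnW.
Qed.

Lemma bern_rec p u (phi : nat -> R) :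
  \sum_(k < p.+2) bern p.+1 k u * phi k =
  u * (\sum_(k < p.+1) bern p k u * phi k.+1) +
  (1 - u) * (\sum_(k < p.+1) bern p k u * phi k).
Proof.
rewrite big_ord_recl/= (eq_bigr (fun k : 'I_p.+1 =>
  u * (bern p k u * phi k.+1) + (1 - u) * (bern p k.+1 u * phi k.+1))); last first.
  by move=> k _; rewrite /bump/= add1n mulrDl !mulrA.
rewrite big_split/= -!mulr_sumr addrCA; congr (_ + _).
rewrite -mulrA -mulrDr; congr (_ * _).
by rewrite [RHS]big_ord_recl/= big_ord_recr/= (bern_gt u (ltnSn p)) mul0r addr0.
Qed.

Lemma bern_sum1 p u : \sum_(k < p.+1) bern p k u = 1.
Proof.
elim: p => [|p IH]; first by rewrite big_ord1.
have := bern_rec p u (fun=> 1).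
under eq_bigr do rewrite mulr1.
under [in X in _ = X -> _]eq_bigr do rewrite mulr1.
by move=> ->; rewrite IH; lra.
Qed.

(** Conditioning on one trial shifts the centre from c to c - 1, so the induction has to range over
    all centres. *)
Lemma bern_var p u c :
  \sum_(k < p.+1) bern p k u * (k%:R - c) ^+ 2 =
  p%:R * u * (1 - u) + (p%:R * u - c) ^+ 2.
Proof.
elim: p c => [|p IH] c; first by rewrite big_ord1/=; ring.
rewrite (bern_rec p u (fun k => (k%:R - c) ^+ 2)) IH.
rewrite (eq_bigr (fun k : 'I_p.+1 => bern p k u * (k%:R - (c - 1)) ^+ 2)); last first.
  by move=> k _; congr (_ * _ ^+ 2); rewrite -natr1; ring.
by rewrite IH -natr1; ring.
Qed.

End bernstein.

(** The point with (1 + sin (s x_i)) / 2 = j_i / p in every coordinate. *)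
Definition berngrid (R : realType) (d p : nat) (s : R) (j : {ffun 'I_d -> 'I_p.+1}) : 'rV[R]_d :=
  \row_i (asin (2 * (j i)%:R / p%:R - 1) / s).

Section berntrig.
Context {R : realType} (d p : nat) (s : R) (g : 'rV[R]_d -> R).

Let u (x : 'rV[R]_d) i := (1 + sin (s * x ord0 i)) / 2.

Let u01 x i : 0 <= u x i <= 1.
Proof.
rewrite /u; have := sin_geN1 (s * x ord0 i); have := sin_le1 (s * x ord0 i).
by move=> h1 h2; apply/andP; split; lra.
Qed.

Let w (x : 'rV[R]_d) (j : {ffun 'I_d -> 'I_p.+1}) := \prod_i bern p (j i) (u x i).

Definition berntrig (x : 'rV[R]_d) := \sum_j w x j * g (berngrid s j).

Lemma trigfun_berntrig : trigfun berntrig.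
Proof.
apply: trigfun_sum => j; under eq_fun do rewrite mulrC; apply: trigfunZ.
apply: trigfun_prod => i.
have tu : trigfun (u^~ i).
  rewrite /u; under eq_fun do rewrite mulrC; apply/trigfunZ/trigfunD.
    exact: trigfun_cst.
  exact: trigfun_sin_coord.
have tu' : trigfun (fun x => 1 - u x i).
  under eq_fun do rewrite -mulN1r; apply/trigfunD/trigfunZ => //.
  exact: trigfun_cst.
move: (nat_of_ord (j i)) => k; elim: p k => [|q IH] [|k]/=.
- exact: trigfun_cst.
- exact: trigfun_cst.
- exact: trigfunM.
- by apply: trigfunD; apply: trigfunM.
Qed.

Let w_ge0 x j : 0 <= w x j.
Proof. by apply: prodr_ge0 => i _; apply: bern_ge0. Qed.

Let w_sum1 x : \sum_j w x j = 1.
Proof.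
rewrite -(bigA_distr_bigA (fun i (k : 'I_p.+1) => bern p k (u x i)))/=.
by apply: big1 => i _; exact: bern_sum1.
Qed.

(** The product weight reduces to its i-th marginal, a rescaled binomial of variance u (1 - u) /
    p. *)
Let w_var x i : (0 < p)%N ->
  \sum_j w x j * ((j i)%:R / p%:R - u x i) ^+ 2 <= p%:R^-1.
Proof.
move=> p0; have pn0 : p%:R != 0 :> R by rewrite pnatr_eq0 -lt0n.
pose c (l : 'I_d) (k : 'I_p.+1) : R :=
  if l == i then (k%:R / p%:R - u x i) ^+ 2 else 1.
rewrite (eq_bigr (fun j : {ffun 'I_d -> 'I_p.+1} =>
    \prod_l (bern p (j l) (u x l) * c l (j l)))); last first.
  move=> j _; rewrite big_split/=; congr (_ * _).
  rewrite (bigD1 i)//= /c eqxx big1 ?mulr1// => l /negbTE ->//.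
rewrite -(bigA_distr_bigA (fun i (k : 'I_p.+1) => bern p k (u x i) * c i k))/=.
rewrite (bigD1 i)//= [X in _ * X]big1 ?mulr1; last first.
  move=> l /negbTE li; under eq_bigr do rewrite /c li mulr1.
  exact: bern_sum1.
rewrite /c eqxx (eq_bigr (fun k : 'I_p.+1 =>
    p%:R ^- 2 * (bern p k (u x i) * (k%:R - p%:R * u x i) ^+ 2))); last first.
  by move=> k _; field.
rewrite -mulr_sumr bern_var subrr expr0n/= addr0.
have /andP[u0 u1] := u01 x i.
have -> : p%:R ^- 2 * (p%:R * u x i * (1 - u x i)) = p%:R^-1 * (u x i * (1 - u x i)).
  by field.
rewrite ler_piMr ?invr_ge0//; nra.
Qed.

Lemma berntrig_bound (M : R) : (forall x, `|g x| <= M) -> forall x, `|berntrig x| <= M.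
Proof.
move=> gM x; rewrite (le_trans (ler_norm_sum _ _ _))//.
rewrite -[leRHS]mul1r -(w_sum1 x) mulr_suml ler_sum// => j _.
by rewrite normrM (ger0_norm (w_ge0 _ _)) ler_wpM2l.
Qed.

Lemma berntrig_approx (e C : R) x : (0 < p)%N -> 0 <= C ->
  (forall j : {ffun 'I_d -> 'I_p.+1}, `|g (berngrid s j) - g x| <=
     e + C * \sum_i ((j i)%:R / p%:R - u x i) ^+ 2) ->
  `|berntrig x - g x| <= e + C * (d%:R / p%:R).
Proof.
move=> p0 C0 H; rewrite /berntrig -[X in _ - X]mul1r -(w_sum1 x) mulr_suml -sumrB.
rewrite (le_trans (ler_norm_sum _ _ _))//.
apply: (@le_trans _ _ (\sum_j w x j *
    (e + C * \sum_i ((j i)%:R / p%:R - u x i) ^+ 2))).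
  apply: ler_sum => j _; rewrite -mulrBr normrM (ger0_norm (w_ge0 _ _)).
  by rewrite ler_wpM2l.
under eq_bigr do rewrite mulrDr.
rewrite big_split/= -mulr_suml w_sum1 mul1r lerD2l.
under eq_bigr do rewrite mulrCA.
rewrite -mulr_sumr ler_wpM2l//.
under eq_bigr do rewrite mulr_sumr.
rewrite exchange_big/= mulr_natl -[X in _ <= _ *+ X]card_ord -sumr_const.
by apply: ler_sum => i _; exact: w_var.
Qed.

End berntrig.

(** With h = (a - b) / 2 >= 0 and m = (a + b) / 2 it suffices that sin h <= cos m, which holds
    because |m| <= pi / 2 - h. The bound recovers the distance of two angles from that of their
    sines. *)
Lemma sin_sub_ge (R : realType) (a b : R) :
  - (pi / 2) <= a <= pi / 2 -> - (pi / 2) <= b <= pi / 2 ->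
  1 - cos (a - b) <= `|sin a - sin b|.
Proof.
wlog ba : a b / b <= a.
  move=> H aI bI; have [ba|/ltW ab] := leP b a; first exact: H.
  by rewrite -cosN opprB distrC; exact: H.
move=> /andP[a1 a2] /andP[b1 b2].
pose h := (a - b) / 2; pose m := (a + b) / 2.
have aE : a = m + h by rewrite /m /h; field.
have bE : b = m - h by rewrite /m /h; field.
apply: le_trans (ler_norm _).
have -> : sin a - sin b = 2 * cos m * sin h.
  by rewrite aE bE sinD sinB; ring.
have -> : 1 - cos (a - b) = 2 * sin h * sin h.
  have -> : a - b = h + h by rewrite /h; field.
  by rewrite cosD -[X in X - _](cos2Dsin2 h); ring.
have h0 : 0 <= h by rewrite /h; lra.
have hp : h <= pi / 2 by rewrite /h; lra.
have p0 := pi_ge0 R.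
have sh : 0 <= sin h by apply: sin_ge0_pi; rewrite h0/=; lra.
apply: ler_wpM2r => //; apply: ler_wpM2l => //.
have -> : sin h = cos (pi / 2 - h) by rewrite -cosN opprB cosBpihalf.
have -> : cos m = cos `|m| by case: (ger0P m) => _; rewrite ?cosN.
have mh : `|m| <= pi / 2 - h by rewrite ler_norml /m /h; apply/andP; split; lra.
by rewrite leNgt ltr_cos ?in_itv/= -?leNgt//; apply/andP; split => //; lra.
Qed.


(** * Uniform trigonometric approximation on a box *)

Section trig_approx.
Context {R : realType} (d : nat) (g : 'rV[R]_d -> R) (K : R).
Hypothesis cg : continuous g.
Hypothesis K0 : 0 < K.
Let box : set 'rV[R]_d := [set x | forall i, `[- K, K]%classic (x ord0 i)].
Let s := pi / (2 * K).
Let s_gt0 : 0 < s. Proof. by rewrite divr_gt0 ?pi_gt0// mulr_gt0. Qed.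
Let u (x : 'rV[R]_d) i := (1 + sin (s * x ord0 i)) / 2.

Let box_compact : compact box.
Proof. exact: (@rV_compact R d (fun=> `[- K, K]%classic) (fun=> @segment_compact _ _ _)). Qed.

Let box_scaled x i : box x -> - (pi / 2) <= s * x ord0 i <= pi / 2.
Proof.
move=> /(_ i); rewrite /= in_itv/= => /andP[x1 x2].
have -> : pi / 2 = s * K by rewrite /s; field; rewrite gt_eqF.
by rewrite -mulrN !ler_pM2l// x1.
Qed.

(** Uniform continuity as a single inequality: e covers pairs that are close, and for the others a
    large C lifts the quadratic term above the oscillation 2 M. *)
Let modulus (M e : R) : (forall x, `|g x| <= M) -> 0 < e ->
  exists2 C, 0 <= C & forall x y, box x -> box y ->
   `|g y - g x| <= e + C * \sum_i (u y i - u x i) ^+ 2.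
Proof.
move=> gM e0.
have : \forall C \near +oo, box `<=` (fun x => box x -> forall y, box y ->
   `|g y - g x| <= e + C * \sum_i (u y i - u x i) ^+ 2).
  apply: ((compact_near_coveringP box).1 box_compact) => x bx.
  have : \forall z \near x, `|g x - g z| < e / 2.
    by move/cvgrPdist_lt : (@cg x); apply; rewrite divr_gt0.
  move=> /nbhs_ballP[dl /= dl0 Hdl].
  (* If some coordinates differ by at least dl / 2, their sines are at least c apart; the minimum
     with pi stays where cos is decreasing. *)
  pose c := 1 - cos (Num.min pi (s * (dl / 2))).
  have pi0 := pi_gt0 R.
  have m0 : 0 < Num.min pi (s * (dl / 2)) by rewrite lt_min pi0/= mulr_gt0// divr_gt0.
  have mpi : Num.min pi (s * (dl / 2)) <= pi by rewrite ge_min lexx.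
  have c0 : 0 < c.
    by rewrite subr_gt0 -[ltRHS](cos0 R) ltr_cos//= in_itv/=; apply/andP; split => //; exact: ltW.
  (* A squared difference of u is at least c^2 / 4 for distant points, and 8 M / c^2 times it is 2
     M. *)
  exists (ball x (dl / 2), [set C | 8 * M / c ^+ 2 <= C]) => /=.
    split; first by apply: nbhsx_ballx; rewrite divr_gt0.
    by apply: nbhs_pinfty_ge; exact: num_real.
  move=> [x' C]/= [bxx' MC] bx' y by_.
  have M0 : 0 <= M by exact: le_trans (gM x).
  have C0 : 0 <= C by apply: le_trans MC; rewrite mulr_ge0// ?mulr_ge0// invr_ge0 sqr_ge0.
  have sum0 : 0 <= \sum_i (u y i - u x' i) ^+ 2 by apply: sumr_ge0 => i _; exact: sqr_ge0.
  have [H|/existsNP[i /negP]] := pselect (forall i, `|x' ord0 i - y ord0 i| < dl / 2).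
    have bx'y : ball x' (dl / 2) y by split=> [|i j]; rewrite ?divr_gt0// ord1; exact: H.
    have h1 : `|g x - g y| < e / 2.
      by apply: Hdl; rewrite (splitr dl); exact: ball_triangle bx'y.
    have h2 : `|g x - g x'| < e / 2.
      by apply: Hdl; apply: le_ball bxx'; rewrite ler_pdivrMr// ler_peMr ?ltW// ltr1n.
    apply: (@le_trans _ _ e).
      rewrite (_ : g y - g x' = (g x - g x') - (g x - g y)); last by ring.
      by rewrite (le_trans (ler_normB _ _))// [leRHS]splitr ltW// ltrD.
    by rewrite lerDl mulr_ge0.
  rewrite -leNgt => dli.
  have hc : c <= `|sin (s * y ord0 i) - sin (s * x' ord0 i)|.
    apply: le_trans (sin_sub_ge (box_scaled i by_) (box_scaled i bx')).
    rewrite lerD2l lerN2.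
    have -> : cos (s * y ord0 i - s * x' ord0 i) = cos (s * `|x' ord0 i - y ord0 i|).
      rewrite -(gtr0_norm s_gt0) -normrM mulrBr (gtr0_norm s_gt0).
      by case: (ger0P (_ - _)) => _; rewrite ?opprB// -cosN opprB.
    have hm : Num.min pi (s * (dl / 2)) <= s * `|x' ord0 i - y ord0 i|.
      by rewrite ge_min ler_pM2l// dli orbT.
    have hp : s * `|x' ord0 i - y ord0 i| <= pi.
      rewrite -(gtr0_norm s_gt0) -normrM mulrBr ler_norml.
      have /andP[y1 y2] := box_scaled i by_; have /andP[x1 x2] := box_scaled i bx'.
      by apply/andP; split; lra.
    have h0 := le_trans (ltW m0) hm.
    by rewrite leNgt ltr_cos ?in_itv/= -?leNgt// ?h0// mpi (ltW m0).
  have hu : c ^+ 2 / 4 <= (u y i - u x' i) ^+ 2.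
    have -> : (u y i - u x' i) ^+ 2 = `|sin (s * y ord0 i) - sin (s * x' ord0 i)| ^+ 2 / 4.
      by rewrite real_normK ?num_real// /u; field.
    by rewrite ler_wpM2r// ler_pXn2r ?nnegrE// ltW.
  have hs : (u y i - u x' i) ^+ 2 <= \sum_i (u y i - u x' i) ^+ 2.
    by rewrite (bigD1 i)//= lerDl sumr_ge0// => j _; exact: sqr_ge0.
  apply: (@le_trans _ _ (M + M)); first by rewrite (le_trans (ler_normB _ _))// lerD.
  apply: (@le_trans _ _ (C * (c ^+ 2 / 4))); last first.
    apply: (@le_trans _ _ (C * \sum_i (u y i - u x' i) ^+ 2)).
      by apply: ler_wpM2l => //; exact: le_trans hs.
    by rewrite lerDr ltW.
  apply: (@le_trans _ _ (8 * M / c ^+ 2 * (c ^+ 2 / 4))); last by rewrite ler_wpM2r// divr_ge0// sqr_ge0.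
  by rewrite le_eqVlt; apply/orP; left; apply/eqP; field; rewrite gt_eqF.
move=> [C0 [_ HC]]; exists (Num.max 0 C0 + 1).
  by rewrite addr_ge0// le_max lexx.
move=> x y bx by_; apply: HC => //; by rewrite ltr_pwDr// le_max lexx orbT.
Qed.

Lemma trig_approx (M e : R) : (forall x, `|g x| <= M) -> 0 < e ->
  exists f : 'rV[R]_d -> R, [/\ trigfun f, forall x, `|f x| <= M &
    forall x : 'rV[R]_d, (forall i, `|x ord0 i| <= K) -> `|f x - g x| <= e].
Proof.
move=> gM e0; have e20 : 0 < e / 2 by rewrite divr_gt0.
have [C C0 HC] := modulus gM e20.
(* Large enough for C d / p <= e / 2. *)
pose p := (Num.truncn (C * d%:R / (e / 2))).+1.
exists (berntrig p s g); split; first exact: trigfun_berntrig.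
  exact: berntrig_bound.
move=> x xK; have bx : box x by move=> i; rewrite /= in_itv/= -ler_norml.
have p0 : (0 < p)%N by [].
have pR : 0 < p%:R :> R by rewrite ltr0n.
apply: (@le_trans _ _ (e / 2 + C * (d%:R / p%:R))).
  apply: berntrig_approx => // j.
  have v01 i : - 1 <= (2 * (j i)%:R / p%:R - 1 : R) <= 1.
    have jp : (j i)%:R / p%:R <= 1 :> R by rewrite ler_pdivrMr// mul1r ler_nat -ltnS.
    have j0 : 0 <= (j i)%:R / p%:R :> R by rewrite divr_ge0.
    by rewrite -mulrA; apply/andP; split; lra.
  have syE i : s * berngrid s j ord0 i = asin (2 * (j i)%:R / p%:R - 1).
    by rewrite mxE mulrCA divff ?mulr1// gt_eqF.
  have by_ : box (berngrid s j).
    move=> i; rewrite /= in_itv/= -[X in X && _](ler_pM2l s_gt0) -[X in _ && X](ler_pM2l s_gt0) syE mulrN.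
    have -> : s * K = pi / 2 by rewrite /s; field; rewrite gt_eqF.
    by rewrite asin_geNpi2// asin_lepi2.
  apply: le_trans (HC _ _ bx by_) _; rewrite lerD2l ler_wpM2l//.
  apply: ler_sum => i _; rewrite le_eqVlt; apply/orP; left; apply/eqP.
  congr ((_ - _) ^+ 2); rewrite /u syE asinK ?in_itv//=; field.
  by rewrite gt_eqF.
rewrite [leRHS]splitr lerD2l mulrA ler_pdivrMr// [leRHS]mulrC -ler_pdivrMr//.
by apply: ltW; exact: truncnS_gt.
Qed.

End trig_approx.

(** * Weak convergence from cosines and tightness *)

Section levy.
Context {R : realType} {dT dZ : measure_display} {T : measurableType dT}
  {TZ : measurableType dZ} {d : nat}.
Variables (P : probability T R) (V : nat -> T -> 'rV[R]_d).
Variables (Q : probability TZ R) (Z : TZ -> 'rV[R]_d).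
Hypothesis mV : forall n (g : 'rV[R]_d -> R), continuous g ->
  measurable_fun setT (fun w => g (V n w)).
Hypothesis mZ : forall g : 'rV[R]_d -> R, continuous g ->
  measurable_fun setT (fun w => g (Z w)).
Hypothesis charVZ : forall (t : 'rV[R]_d) (a : R),
  Ex P (fun w => cos ((V n w *m t^T) ord0 ord0 + a)) @[n --> \oo] -->
  Ex Q (fun w => cos ((Z w *m t^T) ord0 ord0 + a)).

Lemma trigfun_continuous (f : 'rV[R]_d -> R) : trigfun f -> continuous f.
Proof.
elim=> [t a|f1 f2 _ IH1 _ IH2|c f1 _ IH] x.
- apply: continuous_comp; last exact: continuous_cos.
  have h : (fun y : 'rV[R]_d => (y *m t^T) ord0 ord0) @ x --> (x *m t^T) ord0 ord0.
    by apply: (@cvg_mulmx_coord R _ (nbhs x) _ _ _ id); exact: cvg_id.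
  exact: (cvgD h (cvg_cst a)).
- exact: (cvgD (IH1 x) (IH2 x)).
- exact: (cvgM (cvg_cst c) (IH x)).
Qed.

Lemma trigfun_bounded (f : 'rV[R]_d -> R) : trigfun f -> exists M : R, forall x, `|f x| <= M.
Proof.
elim=> [t a|f1 f2 _ [M1 H1] _ [M2 H2]|c f1 _ [M H]].
- by exists 1 => x; rewrite ler_norml cos_geN1 cos_le1.
- by exists (M1 + M2) => x; rewrite (le_trans (ler_normD _ _))// lerD.
- by exists (`|c| * M) => x; rewrite normrM ler_wpM2l.
Qed.

Let bV (f : 'rV[R]_d -> R) n : trigfun f -> bmeas (fun w => f (V n w)).
Proof.
move=> tf; split; first exact/mV/trigfun_continuous.
by have [M fM] := trigfun_bounded tf; exists M.
Qed.

Let bZ (f : 'rV[R]_d -> R) : trigfun f -> bmeas (fun w => f (Z w)).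
Proof.
move=> tf; split; first exact/mZ/trigfun_continuous.
by have [M fM] := trigfun_bounded tf; exists M.
Qed.

Lemma trigfun_cvg (f : 'rV[R]_d -> R) : trigfun f ->
  Ex P (fun w => f (V n w)) @[n --> \oo] --> Ex Q (fun w => f (Z w)).
Proof.
elim=> [t a|f1 f2 t1 IH1 t2 IH2|c f1 t1 IH]; first exact: charVZ.
- rewrite ExD; [|exact: bZ..].
  rewrite (_ : (fun n => _) = fun n => Ex P (fun w => f1 (V n w)) + Ex P (fun w => f2 (V n w))).
    exact: cvgD.
  by apply/funext => n; rewrite ExD//; exact: bV.
- rewrite ExZ; last exact: bZ.
  rewrite (_ : (fun n => _) = fun n => c * Ex P (fun w => f1 (V n w))).
    exact: (cvgM (cvg_cst c) IH).
  by apply/funext => n; rewrite ExZ//; exact: bV.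
Qed.

Let tail (K : R) : set 'rV[R]_d := [set v | exists i, K < `|v ord0 i|].

Let measurable_tail d' (T' : measurableType d') (Y : T' -> 'rV[R]_d) K :
  (forall g : 'rV[R]_d -> R, continuous g -> measurable_fun setT (fun w => g (Y w))) ->
  measurable (Y @^-1` tail K).
Proof.
move=> mY.
rewrite (_ : _ @^-1` _ = \bigcup_(i in [set: 'I_d]) [set w | K < `|Y w ord0 i|]).
  apply: fin_bigcup_measurable; first exact: finite_finset.
  move=> i _; rewrite -[X in measurable X]setTI.
  rewrite (_ : [set w | _] = (fun w => `|Y w ord0 i|) @^-1` `]K, +oo[%classic).
    have mYi : measurable_fun setT (fun w => Y w ord0 i).
      by apply: (mY (fun v => v ord0 i)); exact: coord_continuous.
    have : measurable_fun setT (fun w => `|Y w ord0 i|) by exact: measurableT_comp.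
    exact.
  by apply/seteqP; split => w; rewrite /= in_itv/= andbT.
by apply/seteqP; split => [w [i Ki]|w [i _ Ki]]; exists i.
Qed.

Let Ex_approx d' (T' : measurableType d') (Pr : probability T' R) (Y : T' -> 'rV[R]_d)
    (f g : 'rV[R]_d -> R) (K M e : R) :
  (forall g : 'rV[R]_d -> R, continuous g -> measurable_fun setT (fun w => g (Y w))) ->
  trigfun f -> continuous g -> (forall x, `|g x| <= M) -> (forall x, `|f x| <= M) ->
  (forall x : 'rV[R]_d, (forall i, `|x ord0 i| <= K) -> `|f x - g x| <= e) ->
  0 <= e ->
  `|Ex Pr (fun w => f (Y w)) - Ex Pr (fun w => g (Y w))| <=
    e + 2 * M * fine (Pr (Y @^-1` tail K)).
Proof.
move=> mY tf cg gM fM fg e0.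
have M0 : 0 <= M by exact: le_trans (normr_ge0 _) (gM 0).
have bf : bmeas (fun w => f (Y w)).
  by split; [exact/mY/trigfun_continuous | exists M].
have bg : bmeas (fun w => g (Y w)) by split; [exact: mY | exists M].
have mt := measurable_tail K mY.
rewrite -ExB//; apply: le_trans (Ex_norm _ (bmeasB bf bg)) _.
rewrite -Ex_indic// -(Ex_cst Pr e) -ExZ; last exact: bmeas_indic.
rewrite -ExD; [|exact: bmeas_cst|exact/bmeasZ/bmeas_indic].
apply: Ex_le => [||w].
- exact/bmeas_norm/bmeasB.
- by apply: bmeasD; [exact: bmeas_cst|exact/bmeasZ/bmeas_indic].
rewrite indicE; case: (boolP (w \in _)) => [_|].
  rewrite mulr1 (le_trans (ler_normB _ _))// mulr_natl mulr2n.
  by rewrite (le_trans (lerD (fM _) (gM _)))// lerDr.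
rewrite mulr0 addr0 notin_setE => /forallNP nt; apply: fg => i.
by rewrite leNgt; apply/negP; exact: nt.
Qed.

Hypothesis tightV : forall e : R, 0 < e -> exists K : R,
  \forall n \near \oo, fine (P (V n @^-1` tail K)) <= e.

(** A single law is tight by continuity from above, the tails having empty intersection. *)
Let tightZ (e : R) : 0 < e -> exists K : R, fine (Q (Z @^-1` tail K)) <= e.
Proof.
move=> e0.
have cap0 : \bigcap_n (Z @^-1` tail n%:R) = set0.
  apply/seteqP; split => // w /= H.
  pose K := \sum_i `|Z w ord0 i|.
  have [i] := H (Num.truncn K).+1 I; rewrite ltNge => /negP; apply.
  apply: (@le_trans _ _ K); last exact/ltW/truncnS_gt.
  by rewrite /K (bigD1 i)//= lerDl sumr_ge0.
have : (Q \o (fun n => Z @^-1` tail n%:R)) x @[x --> \oo] --> Q (\bigcap_n (Z @^-1` tail n%:R)).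
  apply: nonincreasing_cvg_mu => //.
  - exact: (le_lt_trans (probability_le1 Q (measurable_tail _ mZ)) (ltry 1)).
  - by move=> n; exact: measurable_tail.
  - by rewrite cap0; exact: measurable0.
  - move=> m n mn; apply/subsetPset => w [i ni]; exists i.
    by apply: le_lt_trans ni; rewrite ler_nat.
rewrite cap0 measure0 => /fine_cvgP[_ /cvgrPdist_le/(_ e e0)[N _ HN]].
exists N%:R; have := HN N (leqnn N); rewrite /= sub0r normrN.
exact: le_trans (ler_norm _).
Qed.

Theorem levy_continuity : cvg_law P V Q Z.
Proof.
move=> g cg [M gM]; apply/cvgrPdist_le => e e0.
have M0 : 0 <= M by exact: le_trans (normr_ge0 _) (gM 0).
(* Error budget: each of the two laws pays e / 8 on the box and at most e / 4 on the tail, and the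
   expectations of f differ by at most e / 4. *)
pose eta := e / 8 / (M + 1).
have M1 : 0 < M + 1 by rewrite ltr_pwDr.
have eta0 : 0 < eta by rewrite !divr_gt0.
have etaM : 2 * M * eta <= e / 4.
  have -> : e / 4 = 2 * (M + 1) * eta by rewrite /eta; field; rewrite gt_eqF.
  by rewrite ler_wpM2r ?(ltW eta0)// ler_wpM2l// lerDl.
have [K1 tK1] := tightV eta0; have [K2 tK2] := tightZ eta0.
pose K := Num.max 1 (Num.max K1 K2).
have K0 : 0 < K by rewrite lt_max ltr01.
have tailS K' : K' <= K -> tail K `<=` tail K'.
  by move=> K'K v [i Ki]; exists i; exact: le_lt_trans Ki.
have e40 : 0 < e / 4 by rewrite divr_gt0.
have e80 : 0 < e / 8 by rewrite divr_gt0.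
have [f [tf fM fg]] := trig_approx cg K0 gM e80.
have PrS d' (T' : measurableType d') (Pr : probability T' R) (Y : T' -> 'rV[R]_d) K' :
    (forall g : 'rV[R]_d -> R, continuous g -> measurable_fun setT (fun w => g (Y w))) ->
    K' <= K -> fine (Pr (Y @^-1` tail K)) <= fine (Pr (Y @^-1` tail K')).
  move=> mY K'K; apply: fine_le; try exact: fin_num_measure (measurable_tail _ mY).
  by apply: le_measure; rewrite ?inE; [exact: measurable_tail..|move=> w; exact: tailS].
have ZE : `|Ex Q (fun w => f (Z w)) - Ex Q (fun w => g (Z w))| <= e / 8 + e / 4.
  apply: le_trans (Ex_approx Q mZ tf cg gM fM fg (ltW e80)) _; rewrite lerD2l.
  apply: le_trans etaM; rewrite ler_wpM2l ?mulr_ge0//; apply: le_trans tK2.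
  by apply: PrS; rewrite // !le_max lexx !orbT.
have /cvgrPdist_le/(_ _ e40) cf := trigfun_cvg tf.
near=> n.
have VE : `|Ex P (fun w => f (V n w)) - Ex P (fun w => g (V n w))| <= e / 8 + e / 4.
  apply: le_trans (Ex_approx P (mV n) tf cg gM fM fg (ltW e80)) _; rewrite lerD2l.
  apply: le_trans etaM; rewrite ler_wpM2l ?mulr_ge0//.
  have tn : fine (P (V n @^-1` tail K1)) <= eta by near: n.
  by apply: le_trans tn; apply: PrS; [exact: mV | rewrite !le_max lexx !orbT].
have : `|Ex Q (fun w => f (Z w)) - Ex P (fun w => f (V n w))| <= e / 4 by near: n.
move: ZE VE; rewrite !ler_norml => /andP[a1 a2] /andP[b1 b2] /andP[c1 c2].
apply/andP; split; lra.
Unshelve. all: end_near. Qed.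

End levy.

(** Measurability of a vector is stated by coordinates. Trigonometric polynomials of it are then
    measurable, and those approximating g on growing boxes converge pointwise to g. *)
Lemma measurable_rV_comp (R : realType) dT (T : measurableType dT) d
    (X : T -> 'rV[R]_d) (g : 'rV[R]_d -> R) :
  (forall i, measurable_fun setT (fun w => X w ord0 i)) -> continuous g ->
  measurable_fun setT (fun w => g (X w)).
Proof.
move=> mX.
have mtrig f : trigfun f -> measurable_fun setT (fun w => f (X w)).
  elim=> [t a|f1 f2 _ m1 _ m2|c f1 _ m1].
  - by have [] := bmeas_cos (measurable_funD
      (measurable_mulmx_coord t^T mX ord0) (measurable_cst a)).
  - exact: measurable_funD.
  - exact: measurable_funM.
(* The truncations of g to [-n, n] are bounded and agree with g at any given point for large n. *)
wlog [M gM] : g / exists M : R, forall x, `|g x| <= M.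
  move=> H cg; apply: (@measurable_fun_cvg _ _ _ _
      (fun n w => Num.max (- n%:R) (Num.min n%:R (g (X w))))).
    move=> n; apply: (H (fun x => Num.max (- n%:R) (Num.min n%:R (g x)))).
      exists n%:R => x; rewrite ler_norml le_max lexx/= ge_max ge_min lexx/=.
      by rewrite (@le_trans _ _ 0)// oppr_le0.
    move=> x; have ccst (c : R) : {for x, continuous (cst c : 'rV[R]_d -> R^o)}.
      exact: cst_continuous.
    exact: (continuous_max (ccst (- n%:R)) (continuous_min (ccst n%:R) (@cg x))).
  move=> w _; apply: cvg_near_cst; near=> n.
  have : `|g (X w)| <= n%:R by near: n; exact: nbhs_infty_ger.
  by rewrite ler_norml => /andP[h1 h2]; rewrite (min_idPr h2) (max_idPr h1).
move=> cg.
have approx (n : nat) : {f : 'rV[R]_d -> R | trigfun f /\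
    forall x : 'rV[R]_d, (forall i, `|x ord0 i| <= n.+1%:R) -> `|f x - g x| <= n.+1%:R^-1}.
  apply: cid; have := @trig_approx R d g n.+1%:R cg (ltr0Sn R n) M n.+1%:R^-1 gM.
  by rewrite invr_gt0 ltr0n => /(_ isT)[f [tf _ fg]]; exists f.
apply: (@measurable_fun_cvg _ _ _ _ (fun n w => sval (approx n) (X w))).
  by move=> n; apply: mtrig; case: (approx n) => f [].
move=> w _; apply/cvgrPdist_le => e e0; near=> n.
case: (approx n) => f [/= _ fg]; rewrite distrC; apply: le_trans (fg _ _) _.
  move=> i; apply: (@le_trans _ _ (\sum_i `|X w ord0 i|)).
    by rewrite (bigD1 i)//= lerDl sumr_ge0.
  apply: (@le_trans _ _ n%:R); last by rewrite ler_nat.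
  by near: n; exact: nbhs_infty_ger.
rewrite -[leRHS]invrK lef_pV2 ?posrE ?invr_gt0// ?ltr0n//.
apply: (@le_trans _ _ n%:R); last by rewrite ler_nat.
by near: n; exact: nbhs_infty_ger.
Unshelve. all: end_near. Qed.

(** * The history of the draws *)

Section history.
Context {R : realType} {dT : measure_display} {T : measurableType dT}
  {P : probability T R} {N d : nat} {X0 X1 : T -> 'rV[R]_d} {U : nat -> T -> 'I_N}.
Hypothesis N0 : (0 < N)%N.
Hypothesis sqX0 : sq_integrable_rv P X0.
Hypothesis sqX1 : sq_integrable_rv P X1.
Hypothesis noise : saga_noise P X0 X1 U.

Definition drawn (n : nat) (u : nat -> 'I_N) : set T :=
  [set w | forall k, (2 <= k <= n)%N -> U k w = u k].

(* The sigma-algebra generated by X0, X1, U_2, .., U_n, described through its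
   traces on the cylinders fixing the draws, which is the form in which the
   product rule of [saga_noise] applies. *)
Definition hist (n : nat) : set (set T) :=
  [set A | forall u, exists2 E, sigma_pair X0 X1 E & A `&` drawn n u = E `&` drawn n u].

Lemma sigma_algebra_hist n : sigma_algebra setT (hist n).
Proof.
split.
- move=> u; exists set0; first exact: sigma_algebra0.
  by [].
- move=> A HA u; have [E sE AE] := HA u; exists (~` E); first exact: sigma_algebraC.
  rewrite setTD; apply/seteqP; split => w [Aw Cw]; split => // Ew; apply: Aw.
  + by have [] : (A `&` drawn n u) w by rewrite AE.
  + by have [] : (E `&` drawn n u) w by rewrite -AE.
- move=> A HA u.
  have /choice[E HE] : forall k, exists E, sigma_pair X0 X1 E /\
      A k `&` drawn n u = E `&` drawn n u.
    by move=> k; have [E] := HA k u; exists E.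
  exists (\bigcup_k E k); first by apply: sigma_algebra_bigcup => k; have [] := HE k.
  by rewrite !setI_bigcupl; apply: eq_bigcupr => k _; have [_ ->] := HE k.
Qed.

Lemma hist_pair n E : sigma_pair X0 X1 E -> hist n E.
Proof. by move=> sE u; exists E. Qed.

Lemma hist_draw n k (v : 'I_N) : (2 <= k <= n)%N -> hist n (U k @^-1` [set v]).
Proof.
move=> kn u; have [uv|uv] := pselect (u k = v).
  exists setT; last first.
    by rewrite setTI; apply/seteqP; split => [w []//|w Cw]; split => //=; rewrite Cw.
  by rewrite -setC0; apply: sigma_algebraC; exact: sigma_algebra0.
exists set0; first exact: sigma_algebra0.
rewrite set0I; apply/seteqP; split => // w [/= Uv Cw]; apply: uv.
by rewrite -Uv Cw.
Qed.

Lemma sub_drawn m n u : (m <= n)%N -> drawn n u `<=` drawn m u.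
Proof.
move=> mn w Cw k /andP[k2 km]; apply: Cw; rewrite k2 (leq_trans km mn)//.
Qed.

Lemma sub_hist m n : (m <= n)%N -> hist m `<=` hist n.
Proof.
move=> mn A HA u; have [E sE AE] := HA u; exists E => //.
by rewrite -(setIidr (@sub_drawn _ _ u mn)) !setIA AE.
Qed.

Lemma measurable_sigma_pair E : sigma_pair X0 X1 E -> measurable E.
Proof.
apply: smallest_sub; first exact: sigma_algebra_measurable.
move=> A [i [B [mB [->|->]]]]; rewrite -[X in measurable X]setTI.
- by apply: (sqX0 i).1.
- by apply: (sqX1 i).1.
Qed.

Lemma measurable_draw n (v : 'I_N) : (2 <= n)%N -> measurable (U n @^-1` [set v]).
Proof. exact: noise.1. Qed.

Lemma measurable_drawn n u : measurable (drawn n u).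
Proof.
rewrite (_ : drawn n u = \bigcap_(k in [set k | (2 <= k <= n)%N]) (U k @^-1` [set u k])).
  by apply: bigcap_measurableType => k /andP[k2 _]; exact: measurable_draw.
by apply/seteqP; split => w Hw k; exact: Hw.
Qed.

Let upd (u : nat -> 'I_N) m v k := if k == m then v else u k.

Let drawnS m u v : (1 <= m)%N ->
  drawn m u `&` (U m.+1 @^-1` [set v]) = drawn m.+1 (upd u m.+1 v).
Proof.
move=> m1; apply/seteqP; split => [w [Cw /= Uv] k /andP[k2]|w Cw].
  rewrite leq_eqVlt /upd => /predU1P[->|km]; first by rewrite eqxx.
  by rewrite (ltn_eqF km) Cw// k2.
split => [k /andP[k2 km]|/=]; last by rewrite Cw /upd ?eqxx// ltnS m1/=.
by rewrite Cw ?k2 ?leqW// /upd ltn_eqF.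
Qed.

Let partition_draw m (A : set T) : A = \bigcup_(v in [set: 'I_N]) (A `&` (U m @^-1` [set v])).
Proof. by apply/seteqP; split => [w Aw|w [v _ []]//]; exists (U m w). Qed.

(** Descending induction: at j = 0 all draws are fixed, and each step frees one more as a union over
    its N values, until [drawn 1] imposes nothing. *)
Let measurable_hist_drawn n A : hist n A -> forall j u, (j < n)%N ->
  measurable (A `&` drawn (n - j) u).
Proof.
move=> HA; elim=> [|j IH] u jn.
  rewrite subn0; have [E /measurable_sigma_pair mE ->] := HA u.
  by apply: measurableI => //; exact: measurable_drawn.
have nj : (n - j = (n - j.+1).+1)%N by rewrite subnSK// ltnW.
rewrite (partition_draw (n - j) (_ `&` _)); apply: fin_bigcup_measurable.
  exact: finite_finset.
move=> v _; rewrite -setIA nj drawnS ?subn_gt0// -nj; apply: IH; exact: ltnW.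
Qed.

Lemma drawn1 u : drawn 1 u = setT.
Proof. by apply/seteqP; split => // w _ [|[|]]. Qed.

Lemma measurable_hist n A : (0 < n)%N -> hist n A -> measurable A.
Proof.
move=> n0 HA; pose u (_ : nat) := Ordinal N0.
have := @measurable_hist_drawn n A HA n.-1 u; rewrite ltn_predL n0 => /(_ isT).
by rewrite -subn1 subKn// drawn1 setIT.
Qed.

Lemma Ex_partition m (A : set T) : (2 <= m)%N -> measurable A ->
  \sum_v Ex P (\1_(A `&` (U m @^-1` [set v]))) = Ex P (\1_A).
Proof.
move=> m2 mA; rewrite -Ex_sum; last first.
  by move=> v; apply/bmeas_indic/measurableI => //; exact: measurable_draw.
apply: eq_Rintegral => w _; rewrite (bigD1 (U m w))//= big1 ?addr0.
  by rewrite !indicE in_setI [X in _ && X]mem_set ?andbT.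
move=> v vU; rewrite indicE in_setI [X in _ && X]memNset ?andbF// => /= Uv.
by rewrite -Uv eqxx in vU.
Qed.

(** The product rule of the noise applies when U_2, .., U_n are all fixed; summing over the values
    of the last fixed draw frees them one at a time. *)
Lemma Ex_hist_drawn n A v : hist n A -> forall j u, (j < n)%N ->
  Ex P (\1_(A `&` drawn (n - j) u `&` (U n.+1 @^-1` [set v]))) =
  N%:R^-1 * Ex P (\1_(A `&` drawn (n - j) u)).
Proof.
move=> HA; elim=> [|j IH] u jn.
  rewrite subn0; have [E sE ->] := HA u; have mE := measurable_sigma_pair sE.
  rewrite -setIA drawnS// !Ex_indic; last 2 first.
    by apply: measurableI => //; exact: measurable_drawn.
    by apply: measurableI => //; exact: measurable_drawn.
  (* Draws start at index 2, so fixing them up to n + 1 gives the factor N^-n, against N^-(n-1) up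
     to n. *)
  rewrite !(noise.2 _ sE)/=.
  have -> : (N%:R^-1 : R) ^+ n = N%:R^-1 * N%:R^-1 ^+ n.-1 by rewrite -exprS prednK.
  have fE : P E \is a fin_num by exact: fin_num_measure.
  by rewrite -(fineK fE) -!EFinM/=; ring.
have nj : (n - j = (n - j.+1).+1)%N by rewrite subnSK// ltnW.
have nj2 : (2 <= n - j)%N by rewrite nj ltnS subn_gt0.
have mA := measurable_hist_drawn HA u jn.
rewrite -(Ex_partition nj2 mA) -(Ex_partition nj2); last first.
  by apply: measurableI => //; apply: measurable_draw; rewrite ltnS (leq_trans _ jn).
rewrite mulr_sumr; apply: eq_bigr => v' _.
have E1 : A `&` drawn (n - j.+1) u `&` U (n - j)%N @^-1` [set v'] =
    A `&` drawn (n - j) (upd u (n - j)%N v').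
  by rewrite -setIA nj drawnS ?subn_gt0.
by rewrite setIAC E1 IH// ltnW.
Qed.

Lemma Ex_hist n A v : (0 < n)%N -> hist n A ->
  Ex P (\1_(A `&` (U n.+1 @^-1` [set v]))) = N%:R^-1 * Ex P (\1_A).
Proof.
move=> n0 HA; pose u (_ : nat) := Ordinal N0.
have := @Ex_hist_drawn n A v HA n.-1 u; rewrite ltn_predL n0 => /(_ isT).
by rewrite -subn1 subKn// drawn1 setIT.
Qed.

(** The sample space with the history as its sigma-algebra, so that adaptedness becomes plain
    measurability. *)
Definition histT (n : nat) := g_sigma_algebraType (hist n).

Lemma histT_preimage n (Y : histT n -> R) (B : set R) :
  measurable_fun setT Y -> measurable B -> hist n (Y @^-1` B).
Proof.
move=> mY mB; have := mY measurableT B mB; rewrite setTI.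
by rewrite /measurable/= sigma_algebra_id//; exact: sigma_algebra_hist.
Qed.

Lemma histT_measurable n (A : set T) : hist n A -> measurable (A : set (histT n)).
Proof. by move=> HA; rewrite /measurable/= sigma_algebra_id//; exact: sigma_algebra_hist. Qed.

Lemma histT_measurable_fun n (Y : T -> R) : (0 < n)%N ->
  measurable_fun setT (Y : histT n -> R) -> measurable_fun setT Y.
Proof.
by move=> n0 mY _ B mB; rewrite setTI; apply: (measurable_hist n0); exact: histT_preimage mY mB.
Qed.

Lemma histT_bmeas n (Y : T -> R) : (0 < n)%N -> bmeas (Y : histT n -> R) -> bmeas Y.
Proof. by move=> n0 [mY bY]; split => //; exact: histT_measurable_fun mY. Qed.

Lemma histT_measurable_funW m n (Y : T -> R) : (m <= n)%N ->
  measurable_fun setT (Y : histT m -> R) -> measurable_fun setT (Y : histT n -> R).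
Proof.
move=> mn mY _ B mB; rewrite setTI; apply: histT_measurable; apply: (sub_hist mn).
exact: histT_preimage mY mB.
Qed.

(** [Ex_hist] passes from sets to functions by approximating Y from below with floor ((m + 1) Y) /
    (m + 1), which has finitely many levels and is uniformly within 1 / (m + 1). *)
Let Ex_draw_ge0 n v (Y : T -> R) : (0 < n)%N -> bmeas (Y : histT n -> R) ->
  (forall w, 0 <= Y w) ->
  Ex P (fun w => Y w * \1_(U n.+1 @^-1` [set v]) w) = N%:R^-1 * Ex P Y.
Proof.
move=> n0 bY Y0; have bYT := histT_bmeas n0 bY; have [mY [M YM]] := bY.
have mU : measurable (U n.+1 @^-1` [set v]) by exact: measurable_draw.
have N1 : 0 < N%:R :> R by rewrite ltr0n.
have Ni : N%:R^-1 <= 1 :> R by rewrite invf_le1// ler1n.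
pose tm m w := Num.truncn (m.+1%:R * Y w).
pose lev m j : set T := [set w | tm m w = j].
have Hlev m j : hist n (lev m j).
  rewrite (_ : lev m j = (fun w => m.+1%:R * Y w) @^-1` `[j%:R, j.+1%:R[%classic).
    apply: (histT_preimage (Y := fun w : histT n => m.+1%:R * Y w)) => //.
    exact: measurable_funM.
  apply/seteqP; split => w; rewrite /lev /tm /= in_itv/=.
    by move=> <-; apply: truncn_itv; rewrite mulr_ge0.
  exact: truncn_def.
pose L m := (Num.truncn (m.+1%:R * M)).+1.
pose Ym m w : R := \sum_(j < L m) (j%:R / m.+1%:R) * \1_(lev m j) w.
have YmE m w : Ym m w = (tm m w)%:R / m.+1%:R.
  have tL : (tm m w < L m)%N.
    rewrite ltnS; apply: le_truncn; rewrite ler_wpM2l//.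
    exact: le_trans (ler_norm _) (YM w).
  rewrite /Ym (bigD1 (Ordinal tL))//= big1 ?addr0 => [|j /eqP jt].
    by rewrite indicE mem_set// mulr1.
  rewrite indicE memNset ?mulr0//= => tj; apply: jt; exact/val_inj.
have YYm m w : 0 <= Y w - Ym m w <= m.+1%:R^-1.
  have mp : 0 < m.+1%:R :> R by rewrite ltr0n.
  rewrite YmE; have /andP[t1 t2] := truncn_itv (mulr_ge0 (ltW mp) (Y0 w)).
  apply/andP; split; first by rewrite subr_ge0 ler_pdivrMr// mulrC.
  rewrite lerBlDr -[X in X + _]mul1r -mulrDl ler_pdivlMr// mulrC (le_trans (ltW t2))//.
  by rewrite -natr1 addrC.
have bYm m : bmeas (Ym m).
  apply: bmeas_sum => j; apply: bmeasZ; apply: bmeas_indic.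
  exact: measurable_hist (Hlev m j).
have EYm m : Ex P (fun w => Ym m w * \1_(U n.+1 @^-1` [set v]) w) = N%:R^-1 * Ex P (Ym m).
  rewrite Ex_sum; last by move=> j; apply/bmeasZ/bmeas_indic/(measurable_hist n0).
  rewrite mulr_sumr; under eq_Rintegral do rewrite mulr_suml.
  rewrite Ex_sum; last first.
    by move=> j; apply: bmeasM; [apply/bmeasZ/bmeas_indic/(measurable_hist n0)|exact: bmeas_indic].
  apply: eq_bigr => j _; rewrite ExZ; last exact/bmeas_indic/(measurable_hist n0).
  rewrite mulrCA -(Ex_hist v n0 (Hlev m j)) -ExZ; last first.
    by apply/bmeas_indic/measurableI => //; exact: (measurable_hist n0 (Hlev m j)).
  by apply: eq_Rintegral => w _; rewrite -[LHS]mulrA; congr (_ * _); rewrite indicI.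
have b1 : bmeas (\1_(U n.+1 @^-1` [set v]) : T -> R) by exact: bmeas_indic.
have m1 w : 0 <= (\1_(U n.+1 @^-1` [set v]) w : R) <= 1.
  by rewrite indicE; case: (_ \in _); rewrite ?ler01 ?lexx.
set a := Ex P (fun w => Y w * _); set b := _ * Ex P Y.
have key m : `|a - b| <= m.+1%:R^-1.
  have d1 : 0 <= a - Ex P (fun w => Ym m w * \1_(U n.+1 @^-1` [set v]) w) <= m.+1%:R^-1.
    rewrite -ExB; [|exact: bmeasM..]; apply/andP; split.
      apply: Ex_ge0 => w; rewrite -mulrBl mulr_ge0//; by have /andP[] := YYm m w.
    rewrite -(Ex_cst P m.+1%:R^-1); apply: Ex_le => [||w].
    - by apply: bmeasB; exact: bmeasM.
    - exact: bmeas_cst.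
    - have /andP[y0 y1] := YYm m w; have /andP[i0 i1] := m1 w.
      by rewrite -mulrBl (le_trans _ y1)// ler_piMr.
  have d2 : 0 <= b - N%:R^-1 * Ex P (Ym m) <= m.+1%:R^-1.
    rewrite -mulrBr -ExB//; have h0 : 0 <= Ex P (fun w => Y w - Ym m w).
      by apply: Ex_ge0 => w; have /andP[] := YYm m w.
    rewrite mulr_ge0 ?invr_ge0//=; apply: le_trans (ler_piMl h0 Ni) _.
    rewrite -(Ex_cst P m.+1%:R^-1); apply: Ex_le => [||w].
    - exact: bmeasB.
    - exact: bmeas_cst.
    - by have /andP[] := YYm m w.
  move: d1 d2; rewrite EYm ler_norml => /andP[c1 c2] /andP[c3 c4].
  move: (N%:R^-1 * Ex P (Ym m)) (m.+1%:R^-1 : R) c1 c2 c3 c4 => z y c1 c2 c3 c4.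
  clearbody a b.
  by apply/andP; split; lra.
apply/eqP; rewrite -subr_eq0 -normr_eq0 eq_le normr_ge0 andbT leNgt; apply/negP => d0.
have := key (Num.truncn (`|a - b|^-1)); rewrite leNgt => /negP; apply.
by rewrite -[ltRHS]invrK ltf_pV2 ?posrE ?invr_gt0 ?ltr0n// truncnS_gt.
Qed.

Lemma Ex_draw n v (Y : T -> R) : (0 < n)%N -> bmeas (Y : histT n -> R) ->
  Ex P (fun w => Y w * \1_(U n.+1 @^-1` [set v]) w) = N%:R^-1 * Ex P Y.
Proof.
move=> n0 bY; have [_ [M YM]] := bY.
have bYT := histT_bmeas n0 bY; have b1 : bmeas (\1_(U n.+1 @^-1` [set v]) : T -> R).
  by apply: bmeas_indic; exact: measurable_draw.
have H1 : Ex P (fun w => (Y w + M) * \1_(U n.+1 @^-1` [set v]) w) =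
    N%:R^-1 * Ex P (fun w => Y w + M).
  apply: Ex_draw_ge0 => //; first by apply: bmeasD => //; exact: bmeas_cst.
  by move=> w; have := YM w; rewrite ler_norml -lerBlDr sub0r => /andP[].
have H2 : Ex P (fun w => M * \1_(U n.+1 @^-1` [set v]) w) = N%:R^-1 * M.
  rewrite -[in RHS](Ex_cst P M); apply: (@Ex_draw_ge0 n v (fun=> M)) => //.
    exact: bmeas_cst.
  by move=> w; exact: le_trans (YM w).
rewrite (_ : (fun w => (Y w + M) * _) =
   fun w => Y w * \1_(U n.+1 @^-1` [set v]) w + M * \1_(U n.+1 @^-1` [set v]) w) in H1; last first.
  by apply/funext => w; rewrite mulrDl.
move: H1; rewrite (ExD P (bmeasM bYT b1) (bmeasZ M b1)) H2 (ExD P bYT (bmeas_cst T M)).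
by rewrite Ex_cst mulrDr; exact: addIr.
Qed.

Lemma draw_split n (Y : 'I_N -> T -> R) w :
  Y (U n w) w = \sum_v Y v w * \1_(U n @^-1` [set v]) w.
Proof.
rewrite (bigD1 (U n w))//= big1 ?addr0; first by rewrite indicE mem_set// mulr1.
move=> v vU; rewrite indicE memNset ?mulr0//= => Uv.
by rewrite -Uv eqxx in vU.
Qed.

Lemma measurable_hist_next n (Y : 'I_N -> T -> R) : (0 < n)%N ->
  (forall v, measurable_fun setT (Y v : histT n -> R)) ->
  measurable_fun setT ((fun w => Y (U n.+1 w) w) : histT n.+1 -> R).
Proof.
move=> n0 mY; under eq_fun do rewrite (draw_split n.+1 Y).
apply: measurable_sum => v; apply: measurable_funM.
  exact: histT_measurable_funW (mY v).
apply: measurable_indic; apply: histT_measurable; apply: hist_draw.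
by rewrite leqnn andbT ltnS.
Qed.

Lemma bmeas_hist_next n (Y : 'I_N -> T -> R) : (0 < n)%N ->
  (forall v, bmeas (Y v : histT n -> R)) ->
  bmeas ((fun w => Y (U n.+1 w) w) : histT n.+1 -> R).
Proof.
move=> n0 bY; split; first by apply: measurable_hist_next => // v; exact: (bY v).1.
have /choice[M HM] : forall v, exists M : R, forall w, `|Y v w| <= M by move=> v; exact: (bY v).2.
exists (\sum_v `|M v|) => w; apply: le_trans (HM _ _) _.
by rewrite (bigD1 (U n.+1 w))//= (le_trans (ler_norm _))// lerDl sumr_ge0.
Qed.

Lemma Ex_next n (Y : 'I_N -> T -> R) : (0 < n)%N ->
  (forall v, bmeas (Y v : histT n -> R)) ->
  Ex P (fun w => Y (U n.+1 w) w) = N%:R^-1 * \sum_v Ex P (Y v).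
Proof.
move=> n0 bY; under eq_Rintegral do rewrite (draw_split n.+1 Y).
rewrite Ex_sum; last first.
  move=> v; apply: bmeasM; first exact: histT_bmeas (bY v).
  by apply: bmeas_indic; exact: measurable_draw.
by rewrite mulr_sumr; apply: eq_bigr => v _; exact: Ex_draw.
Qed.

End history.

Lemma continuous_row_coord (R : realType) m d (f : 'rV[R]_m -> 'rV[R]_d) i :
  continuous f -> continuous (fun x => f x ord0 i).
Proof.
by move=> cf x; apply: (cvg_comp f (fun v : 'rV[R]_d => v ord0 i) (cf x)); exact: coord_continuous.
Qed.

(** * Adaptedness of the iterates and recurrence of every index *)

Section saga_adapted.
Context {R : realType} {dT : measure_display} {T : measurableType dT}
  {P : probability T R} {N d : nat} {F : 'I_N -> 'rV[R]_d -> R} {lam : R}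
  {gamma : nat -> R} {X0 X1 : T -> 'rV[R]_d} {U : nat -> T -> 'I_N}.
Hypothesis N0 : (0 < N)%N.
Hypothesis sqX0 : sq_integrable_rv P X0.
Hypothesis sqX1 : sq_integrable_rv P X1.
Hypothesis noise : saga_noise P X0 X1 U.
Hypothesis cF : forall k, continuous (grad (F k)).

Let St := saga_state F lam gamma X0 X1 U.
Local Notation HT := (histT (X0 := X0) (X1 := X1) (U := U)).

Let measurable_X0 i : measurable_fun setT ((fun w => X0 w ord0 i) : HT 1%N -> R).
Proof.
move=> _ B mB; rewrite setTI; apply: histT_measurable; apply: hist_pair.
by apply: sub_sigma_algebra; exists i, B; split => //; left.
Qed.

Let measurable_X1 i : measurable_fun setT ((fun w => X1 w ord0 i) : HT 1%N -> R).
Proof.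
move=> _ B mB; rewrite setTI; apply: histT_measurable; apply: hist_pair.
by apply: sub_sigma_algebra; exists i, B; split => //; right.
Qed.

(** State m holds X_{m+1} and the gradients stored at that time, which depend on the draws up to
    U_{m+1}; hence the history at m + 1. *)
Lemma saga_state_adapted m :
  (forall i, measurable_fun setT ((fun w => (St m w).1 ord0 i) : HT m.+1 -> R)) /\
  (forall k i, measurable_fun setT ((fun w => (St m w).2 k ord0 i) : HT m.+1 -> R)).
Proof.
elim: m => [|m [IH1 IH2]].
  split => // k i; rewrite /St/=.
  apply: (@measurable_rV_comp _ _ (HT 1%N) _ X0 (fun x => grad (F k) x ord0 i)) => //.
  exact: continuous_row_coord.
have mgrad k i : measurable_fun setT ((fun w => grad (F k) (St m w).1 ord0 i) : HT m.+1 -> R).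
  apply: (@measurable_rV_comp _ _ (HT m.+1) _ (fun w => (St m w).1) (fun x => grad (F k) x ord0 i)) => //.
  exact: continuous_row_coord.
split => [i|k i].
  apply: (@measurable_hist_next _ _ _ _ _ X0 X1 U m.+1 (fun v w =>
    ((St m w).1 - gamma m.+1 *: (grad (F v) (St m w).1
      - lam *: ((St m w).2 v - N%:R^-1 *: \sum_(k < N) (St m w).2 k))) ord0 i)) => // v.
  have := mgrad v i; under eq_fun do rewrite mxE; move=> mgv.
  under eq_fun do rewrite !mxE summxE.
  apply: measurable_funB => //; apply: measurable_funM => //.
  apply: measurable_funB => //; apply: measurable_funM => //.
  apply: measurable_funB => //; apply: measurable_funM => //.
  exact: measurable_sum.
apply: (@measurable_hist_next _ _ _ _ _ X0 X1 U m.+1 (fun v w =>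
  (if v == k then grad (F k) (St m w).1 else (St m w).2 k) ord0 i)) => // v.
by case: (v == k).
Qed.

Let avoid (k : 'I_N) (m l : nat) : set T := [set w | forall j, (m <= j < m + l)%N -> U j w <> k].

Let avoidS k m l : avoid k m l.+1 = avoid k m l `\` (avoid k m l `&` U (m + l)%N @^-1` [set k]).
Proof.
apply/seteqP; split => w.
  move=> A; split.
    by move=> j /andP[mj jl]; apply: A; rewrite mj addnS ltnS ltnW.
  by move=> [_ /= Uk]; apply: (A (m + l)%N) => //; rewrite leq_addr addnS ltnS leqnn.
move=> [A B] j /andP[mj]; rewrite addnS ltnS leq_eqVlt => /predU1P[->|jl].
  by move=> Uk; apply: B.
by apply: A; rewrite mj.
Qed.

(** The event inspects U_m, .., U_{m+l-1}, whence the time (m + l) - 1. *)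
Let hist_avoid k m l : (2 <= m)%N -> hist (X0 := X0) (X1 := X1) (U := U) (m + l).-1 (avoid k m l).
Proof.
move=> m2; have sa n := @sigma_algebra_hist R dT T N d X0 X1 U n.
elim: l => [|l IH].
  rewrite (_ : avoid _ _ _ = setT) ?addn0.
    by have [h0 hC _] := sa m.-1; have := hC set0 h0; rewrite setD0.
  by apply/seteqP; split => // w _ j; rewrite addn0 ltnNge => /andP[->].
have A1 : hist (X0 := X0) (X1 := X1) (U := U) (m + l) (avoid k m l).
  by apply: sub_hist IH; exact: leq_pred.
have A2 : hist (X0 := X0) (X1 := X1) (U := U) (m + l) (U (m + l)%N @^-1` [set k]).
  by apply: hist_draw; rewrite leqnn (leq_trans m2)// leq_addr.
rewrite avoidS addnS/= setDIr setDv set0U.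
have -> : avoid k m l `\` U (m + l)%N @^-1` [set k] =
   ~` (~` avoid k m l `|` U (m + l)%N @^-1` [set k]) by rewrite setCU setCK setDE.
have hc A : hist (X0 := X0) (X1 := X1) (U := U) (m + l) A -> hist (X0 := X0) (X1 := X1) (U := U) (m + l) (~` A).
  by have [_ hC _] := sa (m + l)%N => hA; have := hC A hA; rewrite setTD.
apply: (hc); rewrite -bigcup2E; have [h0 _ hU] := sa (m + l)%N; apply: hU => -[|[|]]//=; exact: hc.
Qed.

Let Ex_avoid k m l : (2 <= m)%N -> Ex P (\1_(avoid k m l)) = (1 - N%:R^-1) ^+ l.
Proof.
move=> m2; elim: l => [|l IH].
  rewrite expr0 (_ : avoid _ _ _ = setT).
    by rewrite Ex_indic//; exact: (congr1 fine (probability_setT P)).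
  by apply/seteqP; split => // w _ j; rewrite addn0 ltnNge => /andP[->].
have ml : (0 < (m + l).-1)%N by case: m m2 {IH} => [|[|m]].
have mA := measurable_hist N0 sqX0 sqX1 noise ml (hist_avoid k l m2).
have mS : ((m + l).-1.+1 = m + l)%N by rewrite prednK// ltn_addr// ltnW.
have mI : measurable (avoid k m l `&` U (m + l)%N @^-1` [set k]).
  apply: measurableI => //; apply: (measurable_draw noise).
  by rewrite (leq_trans m2)// leq_addr.
have := Ex_hist N0 sqX0 sqX1 noise k ml (hist_avoid k l m2); rewrite mS IH => E.
transitivity (Ex P (fun w => \1_(avoid k m l) w - \1_(avoid k m l `&` U (m + l)%N @^-1` [set k]) w)).
  apply: eq_Rintegral => w _; rewrite avoidS !indicE in_setD in_setI.
  by case: (w \in avoid k m l); case: (w \in _); rewrite /= ?subrr ?subr0.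
by rewrite ExB ?E ?IH ?exprS; [ring|exact: bmeas_indic..].
Qed.

(** Avoiding k during l successive draws has probability (1 - 1/N)^l, which tends to 0. *)
Lemma drawn_infinitely_often :
  {ae P, forall w, forall (k : 'I_N) m, exists2 n, (m <= n)%N & U n w = k}.
Proof.
have never (k : 'I_N) m : P.-negligible [set w | forall n, (m <= n)%N -> U n w <> k].
  (* The start is shifted by 2 because the draws are specified from index 2 on. *)
  pose A := \bigcap_l avoid k m.+2 l.
  have mavoid l : measurable (avoid k m.+2 l).
    by apply: (measurable_hist N0 sqX0 sqX1 noise _ (hist_avoid k l _)).
  have mA : measurable A by apply: bigcap_measurableType.
  exists A; split => //.
    apply/eqP; rewrite eq_le measure_ge0 andbT.
    have fA : P A \is a fin_num by exact: fin_num_measure.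
    rewrite -(fineK fA) lee_fin leNgt; apply/negP => A0.
    have q1 : `|1 - N%:R^-1| < 1 :> R.
      have N1 : 0 < N%:R^-1 :> R by rewrite invr_gt0 ltr0n.
      have N2 : N%:R^-1 <= 1 :> R by rewrite invf_le1 ?ltr0n// ler1n.
      by rewrite ltr_norml; apply/andP; split; lra.
    have /cvgrPdist_lt/(_ _ A0)[l _ /(_ l (leqnn l))] := cvg_expr q1.
    rewrite /= sub0r normrN -(Ex_avoid k l (isT : (2 <= m.+2)%N)) Ex_indic// ger0_norm ?fine_ge0//.
    rewrite ltNge => /negP; apply; apply: fine_le; rewrite ?fin_num_measure//.
    by apply: le_measure; rewrite ?inE// => w; apply.
  by move=> w H l _ j /andP[mj _]; apply: H; apply: leq_trans mj; rewrite -addn2 leq_addr.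
rewrite /prop_near1 /nbhs/= /almost_everywhere.
(* The index k is re-expressed as a natural number to use a countable union; values k >= N
   contribute the empty set. *)
apply: (@negligibleS _ _ _ P (\bigcup_k \bigcup_m [set w | exists2 k' : 'I_N, nat_of_ord k' = k & forall n, (m <= n)%N -> U n w <> k'])).
  move=> w /existsNP[k /existsNP[m H]]; exists (nat_of_ord k) => //; exists m => //.
  by exists k => // n mn Uk; apply: H; exists n.
apply: negligible_bigcup => k; apply: negligible_bigcup => m.
have [kN|Nk] := ltnP k N.
  apply: negligibleS (never (Ordinal kN) m) => w [k' kk' H] n mn.
  by rewrite (_ : Ordinal kN = k'); [exact: H|exact/val_inj].
by apply: negligibleS (negligible_set0 P) => w [k' kk']; have := ltn_ord k'; rewrite kk' ltnNge Nk.
Qed.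

End saga_adapted.

(** * Deterministic recursions *)

Lemma harmonic_sum_unbounded (R : realType) (m : nat) (A : R) :
  \forall n \near \oo, A <= \sum_(m <= k < n) k.+1%:R^-1.
Proof.
have nd : nondecreasing_seq (series (@harmonic R)).
  by apply: nondecreasing_series => k _ _; rewrite invr_ge0.
have h1 := nondecreasing_dvgn_lt nd (@dvg_harmonic R).
have /cvgryPge/(_ (A + \sum_(0 <= k < m) k.+1%:R^-1)) h2 := h1.
near=> n; have mn : (m <= n)%N by near: n; exact: nbhs_infty_ge.
have : A + \sum_(0 <= k < m) k.+1%:R^-1 <= series harmonic n :> R by near: n.
rewrite /series/= /harmonic (big_cat_nat (leq0n m) mn)/=.
by move: (\sum_(0 <= _ < _) _) (\sum_(m <= _ < _) _) => x y; lra.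
Unshelve. all: end_near. Qed.

(** The factors 1 - a / n multiply to at most exp (- a sum 1/k), which tends to 0 as the harmonic
    series diverges, so the excess over the fixed point b dies out. *)
Lemma recursion_le (R : realType) (v : nat -> R) (a b : R) : 0 < a ->
  (\forall n \near \oo, v n.+1 <= (1 - a / n%:R) * v n + a * b / n%:R) ->
  forall e, 0 < e -> \forall n \near \oo, v n <= b + e.
Proof.
move=> a0 [n1 _ Hn1] e e0.
(* From m on the factors 1 - a / k are nonnegative and may multiply inequalities. *)
pose m := maxn n1.+1 (Num.truncn a).+1.
have m0 : (0 < m)%N by rewrite leq_max.
have am k : (m <= k)%N -> 0 <= 1 - a / k%:R.
  move=> mk; have k0 : 0 < k%:R :> R by rewrite ltr0n (leq_trans m0).
  rewrite subr_ge0 ler_pdivrMr// mul1r (le_trans (ltW (truncnS_gt a)))// ler_nat.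
  by apply: leq_trans mk; rewrite leq_max leqnn orbT.
pose W := Num.max (v m - b) 0.
have W0 : 0 <= W by rewrite le_max lexx orbT.
have step j : v (m + j)%N - b <= W * expR (- a * \sum_(m.-1 <= k < (m + j).-1) k.+1%:R^-1).
  elim: j => [|j IH].
    by rewrite addn0 big_geq// mulr0 expR0 mulr1 le_max lexx.
  set k := (m + j)%N in IH *; have mk : (m <= k)%N by rewrite leq_addr.
  have k0 : 0 < k%:R :> R by rewrite ltr0n (leq_trans m0).
  have n1k : (n1 <= k)%N by rewrite (leq_trans _ mk)// leq_max leqnSn// ltnW// leq_max leqnn.
  have := Hn1 k n1k; rewrite addnS -/k /= => Hk.
  have : v k.+1 - b <= (1 - a / k%:R) * (v k - b).
    by rewrite lerBlDr (le_trans Hk)// mulrBr; lra.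
  move=> /le_trans; apply; apply: le_trans (ler_wpM2l (am k mk) IH) _.
  rewrite mulrCA ler_wpM2l//.
  have kE : k = k.-1.+1 by rewrite prednK// (leq_trans m0).
  rewrite [in X in _ <= expR (_ * \sum_(_ <= i < X) _)]kE big_nat_recr/=; last first.
    by rewrite -ltnS -kE prednK.
  rewrite -kE mulrDr expRD mulrC ler_wpM2l ?expR_ge0//.
  by apply: le_trans (expR_ge1Dx _); rewrite mulNr.
(* Gives W exp (- a A) = W e / (W + 1) <= e; the added 1 keeps the logarithm meaningful when W =
   0. *)
pose A := ln ((W + 1) / e) / a.
have [n2 _ Hn2] := harmonic_sum_unbounded m.-1 A.
exists (m + n2.+1)%N => //= n nn.
have mn : (m <= n)%N by apply: leq_trans nn; exact: leq_addr.
have := step (n - m)%N; rewrite subnKC// => H.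
rewrite -lerBlDl; apply: (le_trans H).
have {}Hn2 : A <= \sum_(m.-1 <= k < n.-1) k.+1%:R^-1.
  apply: Hn2; rewrite /= -ltnS prednK ?(leq_trans m0)//.
  by apply: leq_trans nn; rewrite leq_addl.
have We : 0 < (W + 1) / e by rewrite divr_gt0// ltr_pwDr.
apply: (@le_trans _ _ (W * expR (- (a * A)))).
  by rewrite ler_wpM2l// ler_expR mulNr lerN2 ler_pM2l.
have -> : a * A = ln ((W + 1) / e) by rewrite /A; field; rewrite gt_eqF.
rewrite expRN lnK ?posrE// invf_div mulrA ler_pdivrMr ?ltr_pwDr//.
by rewrite mulrC ler_pM2l// lerDl.
Qed.

Lemma recursion_cvg0 (R : realType) (v c : nat -> R) (a : R) : 0 < a ->
  (forall n, 0 <= v n) ->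
  (\forall n \near \oo, v n.+1 <= (1 - a / n%:R) * v n + c n / n%:R) ->
  c n @[n --> \oo] --> 0 -> v n @[n --> \oo] --> 0.
Proof.
move=> a0 v0 Hv c0; apply/cvgr0Pnorm_le => e e0.
have e2 : 0 < e / 2 by rewrite divr_gt0.
have H : \forall n \near \oo, v n.+1 <= (1 - a / n%:R) * v n + a * (e / 2) / n%:R.
  have /cvgr0Pnorm_le/(_ (a * (e / 2))) cn := c0.
  near=> n; have : v n.+1 <= (1 - a / n%:R) * v n + c n / n%:R by near: n.
  move=> /le_trans; apply; rewrite lerD2l ler_wpM2r ?invr_ge0//.
  by rewrite (le_trans (ler_norm _))//; near: n; apply: cn; rewrite mulr_gt0.
have := recursion_le a0 H e2; apply: filterS => n.
by rewrite -splitr ger0_norm.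
Unshelve. all: end_near. Qed.

(** * Central limit theorem for the linear process *)

Section elementary_bounds.
Context {R : realType}.
Implicit Types x y a : R.

Let mvt0 (f f' : R -> R) x : (forall y, is_derive y 1 f (f' y)) ->
  exists2 y, `|y| <= `|x| & f x - f 0 = x * f' y.
Proof.
move=> df; have cf : continuous f.
  by move=> y; apply/differentiable_continuous/derivable1_diffP; have [] := df y.
have [x0|x0|<-] := ltgtP 0 x; last by exists 0; rewrite ?subrr ?mul0r.
- have [] := @MVT R f f' 0 x x0 (fun y _ => df y) (continuous_subspaceT cf).
  move=> y; rewrite in_itv/= => /andP[y0 yx] ->; exists y; last by rewrite subr0 mulrC.
  by rewrite !gtr0_norm// ltW.
- have [] := @MVT R f f' x 0 x0 (fun y _ => df y) (continuous_subspaceT cf).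
  move=> y; rewrite in_itv/= => /andP[xy y0] E; exists y.
    by rewrite !ltr0_norm// lerN2 ltW.
  by rewrite -opprB E sub0r mulrN opprK mulrC.
Qed.

Lemma normr_sin_le x : `|sin x| <= `|x|.
Proof.
have [y _] := mvt0 x (fun y => is_derive_sin y).
rewrite sin0 subr0 => ->; rewrite normrM ler_piMr// ler_norml cos_geN1 cos_le1//.
Qed.

Lemma norm_1Bcos_le x : `|cos x - 1| <= `|x|.
Proof.
have [y _] := mvt0 x (fun y => is_derive_cos y).
rewrite cos0 => ->; rewrite normrM normrN ler_piMr// ler_norml sin_geN1 sin_le1//.
Qed.

Lemma norm_1Bcos_le2 x : `|cos x - 1| <= `|x| ^+ 2.
Proof.
have [y yx] := mvt0 x (fun y => is_derive_cos y).
rewrite cos0 => ->; rewrite normrM normrN expr2 ler_wpM2l//.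
exact: le_trans (normr_sin_le _) yx.
Qed.

Lemma norm_sinB_le2 x : `|sin x - x| <= `|x| ^+ 2.
Proof.
have df (y : R) : is_derive y 1 (fun y => sin y - y) (cos y - 1) by exact: is_deriveB.
have [y yx] := mvt0 x df.
rewrite sin0 subr0 subr0 => ->; rewrite normrM expr2 ler_wpM2l//.
exact: le_trans (norm_1Bcos_le _) yx.
Qed.

Lemma norm_sinB_le3 x : `|sin x - x| <= `|x| ^+ 3.
Proof.
have df (y : R) : is_derive y 1 (fun y => sin y - y) (cos y - 1) by exact: is_deriveB.
have [y yx] := mvt0 x df.
rewrite sin0 subr0 subr0 => ->; rewrite normrM exprS ler_wpM2l//.
apply: le_trans (norm_1Bcos_le2 _) _; by rewrite ler_pXn2r ?nnegrE.
Qed.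

Lemma norm_cos_taylor2 x : `|cos x - 1 + x ^+ 2 / 2| <= `|x| ^+ 3.
Proof.
have df (y : R) : is_derive y 1 (fun y => cos y + y ^+ 2 / 2) (- (sin y - y)).
  by apply: is_derive_eq; rewrite /GRing.scale/=; field.
have [y yx] := mvt0 x df.
rewrite cos0 expr0n/= mul0r addr0 addrAC => ->.
rewrite normrM normrN exprS ler_wpM2l//.
by apply: le_trans (norm_sinB_le2 _) _; rewrite ler_pXn2r ?nnegrE.
Qed.

Lemma cos_shift_taylor a x :
  `|cos (a - x) - (cos a * (1 - x ^+ 2 / 2) + sin a * x)| <= 2 * `|x| ^+ 3.
Proof.
have -> : cos (a - x) - (cos a * (1 - x ^+ 2 / 2) + sin a * x) =
    cos a * (cos x - 1 + x ^+ 2 / 2) + sin a * (sin x - x).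
  by rewrite cosB; ring.
rewrite (le_trans (ler_normD _ _))// mulr_natl mulr2n lerD//.
  rewrite normrM -[leRHS]mul1r ler_pM//; first by rewrite ler_norml cos_geN1 cos_le1.
  exact: norm_cos_taylor2.
rewrite normrM -[leRHS]mul1r ler_pM//; first by rewrite ler_norml sin_geN1 sin_le1.
exact: norm_sinB_le3.
Qed.

Lemma expRN_le_taylor2 y : 0 <= y -> expR (- y) <= 1 - y + y ^+ 2.
Proof.
move=> y0; have y1 : 0 < 1 + y by rewrite ltr_pwDl.
apply: (@le_trans _ _ (1 + y)^-1).
  by rewrite expRN lef_pV2 ?posrE ?expR_gt0// expR_ge1Dx.
rewrite -[leLHS]mul1r ler_pdivrMr//.
have -> : (1 - y + y ^+ 2) * (1 + y) = 1 + y ^+ 3 by ring.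
by rewrite lerDl exprn_ge0.
Qed.

Lemma expRN_taylor1 y : 0 <= y -> `|1 - y - expR (- y)| <= y ^+ 2.
Proof.
move=> y0; have h1 := expRN_le_taylor2 y0; have h2 := expR_ge1Dx (- y).
by rewrite ler_norml; apply/andP; split; nra.
Qed.

(** Turns a product bounded by exp (- y) into a linear rate: half of y is kept, the other half
    absorbs all second-order terms. *)
Lemma expRN_le_half y : 0 <= y <= 2^-1 -> expR (- y) <= 1 - y / 2.
Proof. by move=> /andP[y0 y1]; have := expRN_le_taylor2 y0; nra. Qed.

(** The linear Taylor terms cancel because the x_u sum to 0, the quadratic ones match the
    first-order expansion of exp (- q / 2), and every remainder is O(X^3). *)
Lemma avg_cos_le (N : nat) (x : 'I_N -> R) (X a : R) : (0 < N)%N ->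
  \sum_u x u = 0 -> (forall u, `|x u| <= X) ->
  `|N%:R^-1 * (\sum_u cos (a - x u)) -
    cos a * expR (- (N%:R^-1 * \sum_u x u ^+ 2) / 2)| <= 3 * X ^+ 3.
Proof.
move=> N0 sx0 xX; have N1 : 0 < N%:R :> R by rewrite ltr0n.
have X0 : 0 <= X by exact: le_trans (normr_ge0 _) (xX (Ordinal N0)).
have avg_le (f : 'I_N -> R) c : (forall u, `|f u| <= c) -> `|N%:R^-1 * \sum_u f u| <= c.
  move=> fc; rewrite normrM gtr0_norm ?invr_gt0// mulrC ler_pdivrMr//.
  rewrite (le_trans (ler_norm_sum _ _ _))// mulr_natr -[X in _ <= _ *+ X](card_ord N).
  by rewrite -sumr_const ler_sum.
set q := N%:R^-1 * \sum_u x u ^+ 2.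
have q0 : 0 <= q by rewrite mulr_ge0 ?invr_ge0 ?sumr_ge0// => u _; exact: sqr_ge0.
(* For X >= 1 the trivial bound 2 is below 3 X^3; for X <= 1 the exponential error is at most X^4 <=
   X^3. *)
have [X1|/ltW X1] := leP X 1; last first.
  apply: (@le_trans _ _ 2).
    rewrite (le_trans (ler_normB _ _))// (_ : 2 = 1 + 1 :> R)// lerD//.
      by apply: avg_le => u; rewrite ler_norml cos_geN1 cos_le1.
    rewrite normrM -[leRHS]mul1r ler_pM//; first by rewrite ler_norml cos_geN1 cos_le1.
    by rewrite ger0_norm ?expR_ge0// -(expR0 R) ler_expR mulNr oppr_le0 divr_ge0.
  have : 1 <= X ^+ 3 by rewrite exprn_ege1.
  by move: (X ^+ 3) => y; lra.
have qX : q <= X ^+ 2.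
  rewrite -(ger0_norm q0); apply: avg_le => u; rewrite normrX.
  by rewrite ler_pXn2r ?nnegrE.
have -> : N%:R^-1 * (\sum_u cos (a - x u)) - cos a * expR (- q / 2) =
   N%:R^-1 * (\sum_u (cos (a - x u) - (cos a * (1 - x u ^+ 2 / 2) + sin a * x u)))
   + cos a * (1 - q / 2 - expR (- (q / 2))).
  rewrite sumrB big_split/= -!mulr_sumr sx0 mulr0 addr0 sumrB sumr_const card_ord.
  rewrite -mulr_suml mulNr /q.
  move: (\sum_(_ < N) cos _) (\sum_(_ < N) _ ^+ 2) (expR _) => A B C.
  by field; rewrite gt_eqF.
rewrite (le_trans (ler_normD _ _))// (_ : 3 = 2 + 1 :> R); last by ring.
rewrite mulrDl mul1r lerD//.
  apply: avg_le => u; apply: le_trans (cos_shift_taylor _ _) _.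
  by rewrite ler_wpM2l// ler_pXn2r ?nnegrE.
rewrite normrM -[leRHS]mul1r ler_pM//; first by rewrite ler_norml cos_geN1 cos_le1.
apply: le_trans (expRN_taylor1 _) _; first by rewrite divr_ge0.
have X3 : X ^+ 2 * X ^+ 2 <= X ^+ 3.
  by rewrite -exprD (_ : 2 + 2 = 3.+1)%N// exprSr ler_piMr// exprn_ge0.
have q2 : q * q <= X ^+ 2 * X ^+ 2 by rewrite ler_pM.
rewrite expr_div_n; move: (X ^+ 3) X3 => Y; move: (X ^+ 2) q2 => W; nra.
Qed.

End elementary_bounds.

Lemma cvg_cst_div (R : realType) (K : R) : K / n%:R @[n --> \oo] --> 0.
Proof.
rewrite -[X in _ --> X](mulr0 K) -(cvg_shiftS (fun n => K / n%:R)).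
by apply: cvgM; [exact: cvg_cst | exact: cvg_harmonic].
Qed.

Lemma near_le_div (R : realType) (K e : R) : 0 < e -> \forall n \near \oo, K / n%:R <= e.
Proof.
move=> e0; have /cvgr0Pnorm_le/(_ e e0) := cvg_cst_div K.
by apply: filterS => n; exact: le_trans (ler_norm _).
Qed.

Section covariance_recursion.
Context {R : realType} (al be c : R) (s : nat -> R).
Hypothesis ab : 1 < al + be.
Hypothesis s_rec : forall n : nat, (0 < n)%N ->
  s n.+1 = (1 - al / n%:R) * (1 - be / n%:R) * s n + c / n%:R ^+ 2.

(** Passing from n to n + 1 gives back one unit of the decay al + be, so n s_n contracts at rate al
    + be - 1 > 0 towards the fixed point l. *)
Lemma covariance_recursion_cvg : n%:R * s n @[n --> \oo] --> c / (al + be - 1).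
Proof.
set l := c / _; have ab0 : 0 < al + be - 1 by rewrite subr_gt0.
apply/subr_cvg0/norm_cvg0P => /=.
pose a := (al + be - 1) / 2; have a0 : 0 < a by rewrite divr_gt0.
pose K := `|l| * (`|al * be| * 2 + `|al| + `|be|) + `|c|.
apply: (@recursion_cvg0 R _ (fun n => K / n%:R) a a0); last exact: cvg_cst_div.
  by move=> n; exact: normr_ge0.
near=> n.
have n0 : (0 < n)%N by near: n; exists 1%N.
have np : 0 < n%:R :> R by rewrite ltr0n.
have [x1 xal xbe xs] : [/\ 1 / n%:R <= 1 :> R, al / n%:R <= 1, be / n%:R <= 1 &
    (al + be - 1) / n%:R <= 2^-1].
  by split; near: n; apply: near_le_div; rewrite // invr_gt0.
rewrite /= s_rec//; set x := n%:R^-1 in x1 xal xbe xs *.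
have x0 : 0 < x by rewrite invr_gt0.
have nE : n%:R = x^-1 by rewrite invrK.
rewrite -natr1 nE.
(* The choice of l cancels the terms of order x, so the remainder is O(x^2). *)
have -> : (x^-1 + 1) * ((1 - al * x) * (1 - be * x) * s n + c / x^-1 ^+ 2) - l =
   (1 + x) * (1 - al * x) * (1 - be * x) * (x^-1 * s n - l) +
   x ^+ 2 * (l * (al * be - al - be + al * be * x) + c).
  rewrite (_ : c = l * (al + be - 1)); last by rewrite /l divfK// gt_eqF.
  by field; rewrite gt_eqF.
apply: le_trans (ler_normD _ _) _; apply: lerD.
  rewrite normrM ler_wpM2r// ger0_norm; last first.
    by rewrite !mulr_ge0// ?subr_ge0// addr_ge0// ltW.
  apply: (@le_trans _ _ (expR (- ((al + be - 1) * x)))).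
    have -> : - ((al + be - 1) * x) = x + - (al * x) + - (be * x) by ring.
    rewrite !expRD; apply: ler_pM; rewrite ?subr_ge0//.
    - by rewrite mulr_ge0// ?subr_ge0// addr_ge0// ltW.
    - apply: ler_pM; rewrite ?subr_ge0// ?expR_ge1Dx//.
      by rewrite addr_ge0// ltW.
    - exact: expR_ge1Dx.
  rewrite (_ : a * x = (al + be - 1) * x / 2); last by rewrite /a; field.
  by apply: expRN_le_half; rewrite xs andbT mulr_ge0// ltW.
rewrite normrM (ger0_norm (sqr_ge0 _)) -[leRHS]mulrA -expr2 mulrC ler_wpM2r ?sqr_ge0//.
rewrite (le_trans (ler_normD _ _))// /K lerD2r normrM ler_wpM2l//.
rewrite (le_trans (ler_normD _ _))// [leRHS]addrC.
have : `|al * be * x| <= `|al * be|.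
  by rewrite normrM ler_piMr// gtr0_norm// -[x]mul1r.
have : `|al * be - al - be| <= `|al * be| + `|al| + `|be|.
  by rewrite (le_trans (ler_normB _ _))// lerD2r ler_normB.
by move=> h1 h2; lra.
Unshelve. all: end_near. Qed.

End covariance_recursion.

Definition dotv {R : realType} {d : nat} (t y : 'rV[R]_d) : R :=
  \sum_i t ord0 i * y ord0 i.

Definition norm1 {R : realType} {d : nat} (t : 'rV[R]_d) : R := \sum_i `|t ord0 i|.

Ltac solve_bmeas := repeat first
  [ assumption | apply: bmeas_cst | apply: bmeasD | apply: bmeasB | apply: bmeasZ
  | apply: bmeasM ].

Lemma Ex_nextE (R : realType) (dT : measure_display) (T : measurableType dT)
    (P : probability T R) (N d : nat) (X0 X1 : T -> 'rV[R]_d) (U : nat -> T -> 'I_N) :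
  (0 < N)%N -> sq_integrable_rv P X0 -> sq_integrable_rv P X1 -> saga_noise P X0 X1 U ->
  forall (n : nat) (f : T -> R) (Y : 'I_N -> T -> R), (0 < n)%N ->
  (forall w, f w = Y (U n.+1 w) w) ->
  (forall v, bmeas (Y v : histT (X0 := X0) (X1 := X1) (U := U) n -> R)) ->
  Ex P f = N%:R^-1 * \sum_v Ex P (Y v).
Proof.
move=> N0 sX0 sX1 noise n f Y n0 fY bY; rewrite -(Ex_next N0 sX0 sX1 noise n0 bY).
by apply: eq_Rintegral => w _.
Qed.

Lemma Ex_affine (R : realType) (dT : measure_display) (T : measurableType dT)
    (P : probability T R) (c1 c2 c3 c : R) (f1 f2 f3 : T -> R) :
  bmeas f1 -> bmeas f2 -> bmeas f3 ->
  Ex P (fun w => c1 * f1 w + c2 * f2 w + c3 * f3 w + c) =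
  c1 * Ex P f1 + c2 * Ex P f2 + c3 * Ex P f3 + c.
Proof.
move=> /[dup] b1' /(bmeasZ c1) b1 /[dup] b2' /(bmeasZ c2) b2 /[dup] b3' /(bmeasZ c3) b3.
rewrite (ExD P (bmeasD (bmeasD b1 b2) b3) (bmeas_cst T c)) Ex_cst.
by rewrite (ExD P (bmeasD b1 b2) b3) (ExD P b1 b2) !ExZ.
Qed.

Section linear_process.
Context {R : realType} {dT : measure_display} {T : measurableType dT}
  {P : probability T R} {N d : nat} {X0 X1 : T -> 'rV[R]_d} {U : nat -> T -> 'I_N}.
Variables (z : 'I_N -> 'rV[R]_d) (h : 'I_d -> R).
Hypothesis N0 : (0 < N)%N.
Hypothesis d0 : (0 < d)%N.
Hypothesis sqX0 : sq_integrable_rv P X0.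
Hypothesis sqX1 : sq_integrable_rv P X1.
Hypothesis noise : saga_noise P X0 X1 U.
Hypothesis z_sum0 : forall i, \sum_u z u ord0 i = 0.
Variables rho hmax : R.
Hypothesis rho_gt : 2^-1 < rho.
Hypothesis h_bnd : forall i, rho <= h i <= hmax.
Local Notation HT := (histT (X0 := X0) (X1 := X1) (U := U)).

(* Junk value: the step at n = 0 divides by 0, so that [linproc 1 = 0]. *)
Fixpoint linproc (n : nat) (w : T) : 'rV[R]_d :=
  match n with
  | 0 => 0
  | n'.+1 => \row_i ((1 - h i / n'%:R) * linproc n' w ord0 i
                     - z (U n'.+1 w) ord0 i / n'%:R)
  end.
Local Notation L := linproc.

Lemma linprocS n w i : L n.+1 w ord0 i =
  (1 - h i / n%:R) * L n w ord0 i - z (U n.+1 w) ord0 i / n%:R.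
Proof. by rewrite mxE. Qed.

Lemma linproc1 w : L 1 w = 0.
Proof. by apply/rowP => i; rewrite linprocS !mxE mulr0 invr0 mulr0 subr0. Qed.

Lemma linproc_bmeas n i : (0 < n)%N -> bmeas ((fun w => L n w ord0 i) : HT n -> R).
Proof.
elim: n => // -[|n] IH _.
  by under eq_fun do rewrite linproc1 mxE; exact: bmeas_cst.
under eq_fun do rewrite linprocS.
apply: (@bmeas_hist_next _ _ _ _ _ X0 X1 U n.+1 (fun v w =>
  (1 - h i / n.+1%:R) * L n.+1 w ord0 i - z v ord0 i / n.+1%:R)) => // v.
by apply: bmeasB; [apply: bmeasZ; exact: IH | exact: bmeas_cst].
Qed.

Let bL n i : (0 < n)%N -> bmeas (fun w => L n w ord0 i).
Proof. by move=> n0; exact: (histT_bmeas N0 sqX0 sqX1 noise n0 (linproc_bmeas i n0)). Qed.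

Definition noise_cov i j : R := N%:R^-1 * \sum_u z u ord0 i * z u ord0 j.

Lemma linproc_cov n i j : (0 < n)%N ->
  Ex P (fun w => L n.+1 w ord0 i * L n.+1 w ord0 j) =
  (1 - h i / n%:R) * (1 - h j / n%:R) * Ex P (fun w => L n w ord0 i * L n w ord0 j) +
  noise_cov i j / n%:R ^+ 2.
Proof.
move=> n0; have N1 : N%:R != 0 :> R by rewrite pnatr_eq0 -lt0n.
have n1 : n%:R != 0 :> R by rewrite pnatr_eq0 -lt0n.
set a := 1 - h i / n%:R; set b := 1 - h j / n%:R.
have bi := linproc_bmeas i n0; have bj := linproc_bmeas j n0.
rewrite (Ex_nextE N0 sqX0 sqX1 noise (Y := fun v w => (a * L n w ord0 i - z v ord0 i / n%:R) *
   (b * L n w ord0 j - z v ord0 j / n%:R)) n0); last 2 first.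
- by move=> w; rewrite !linprocS.
- by move=> v; solve_bmeas.
rewrite (eq_bigr (fun v => a * b * Ex P (fun w => L n w ord0 i * L n w ord0 j)
   - (a / n%:R * Ex P (fun w => L n w ord0 i)) * z v ord0 j
   - (b / n%:R * Ex P (fun w => L n w ord0 j)) * z v ord0 i
   + n%:R ^- 2 * (z v ord0 i * z v ord0 j))); last first.
  move=> v _; have bLi := bL i n0; have bLj := bL j n0.
  transitivity (Ex P (fun w => a * b * (L n w ord0 i * L n w ord0 j)
     + (- (a * z v ord0 j / n%:R)) * L n w ord0 i + (- (b * z v ord0 i / n%:R)) * L n w ord0 j
     + n%:R ^- 2 * (z v ord0 i * z v ord0 j))).
    by apply: eq_Rintegral => w _; clearbody a b; field.
  rewrite (Ex_affine P _ _ _ _ (bmeasM bLi bLj) bLi bLj).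
  by clearbody a b; ring.
rewrite big_split/= !sumrB -!mulr_sumr !z_sum0 !mulr0 !subr0 sumr_const card_ord.
by rewrite /noise_cov -mulr_natl; field; rewrite N1 n1.
Qed.

(** The adjoint of one linear step of L, acting on the test vector instead of the process. *)
Let contract (n : nat) (t : 'rV[R]_d) : 'rV[R]_d := \row_i (t ord0 i * (1 - h i / n%:R)).

Let dotv_linprocS n t w : dotv t (L n.+1 w) =
  dotv (contract n t) (L n w) - dotv t (z (U n.+1 w)) / n%:R.
Proof.
rewrite /dotv mulr_suml -sumrB; apply: eq_bigr => i _.
by rewrite linprocS !mxE; ring.
Qed.

Let bdot n t : (0 < n)%N -> bmeas ((fun w => dotv t (L n w)) : HT n -> R).
Proof. by move=> n0; apply: bmeas_sum => i; apply: bmeasZ; exact: linproc_bmeas. Qed.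

Let bdotT n t : (0 < n)%N -> bmeas (fun w => dotv t (L n w)).
Proof. by move=> n0; exact: (histT_bmeas N0 sqX0 sqX1 noise n0 (bdot t n0)). Qed.

Let Q n t := Ex P (fun w => dotv t (L n w) * dotv t (L n w)).

Let Q_ge0 n t : 0 <= Q n t.
Proof. by apply: Ex_ge0 => w; rewrite -expr2 sqr_ge0. Qed.

Let dotz_sum0 t : \sum_u dotv t (z u) = 0.
Proof.
rewrite /dotv exchange_big/= big1// => i _.
by rewrite -mulr_sumr z_sum0 mulr0.
Qed.

Let QS n t : (0 < n)%N ->
  Q n.+1 t = Q n (contract n t) + N%:R^-1 * \sum_u (dotv t (z u) / n%:R) ^+ 2.
Proof.
move=> n0; have N1 : N%:R != 0 :> R by rewrite pnatr_eq0 -lt0n.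
have b0 := bdot (contract n t) n0; have b1 := bdotT (contract n t) n0.
rewrite /Q (Ex_nextE N0 sqX0 sqX1 noise (Y := fun v w =>
  (dotv (contract n t) (L n w) - dotv t (z v) / n%:R) *
  (dotv (contract n t) (L n w) - dotv t (z v) / n%:R)) n0); last 2 first.
- by move=> w; rewrite !dotv_linprocS.
- by move=> v; solve_bmeas.
rewrite (eq_bigr (fun v => Q n (contract n t)
   - (2 * (Ex P (fun w => dotv (contract n t) (L n w))) / n%:R) * dotv t (z v)
   + (dotv t (z v) / n%:R) ^+ 2)); last first.
  move=> v _.
  transitivity (Ex P (fun w => 1 * (dotv (contract n t) (L n w) * dotv (contract n t) (L n w))
     + (- (2 * dotv t (z v) / n%:R)) * dotv (contract n t) (L n w)
     + 0 * dotv (contract n t) (L n w)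
     + (dotv t (z v) / n%:R) ^+ 2)).
    by apply: eq_Rintegral => w _; ring.
  rewrite (Ex_affine P _ _ _ _ (bmeasM b1 b1) b1 b1).
  by rewrite /Q; ring.
rewrite big_split/= sumrB -!mulr_sumr dotz_sum0 mulr0 subr0 sumr_const card_ord.
by rewrite mulrDr -[Q _ _ *+ N]mulr_natl mulKf.
Qed.

Let Z := \sum_u norm1 (z u).
(** Bounds all |1 - h_i / n| at once: the sharp value 1 - rho / n as soon as n >= hmax, a crude
    constant for the finitely many earlier n. *)
Let r (n : nat) : R := if hmax <= n%:R then 1 - rho / n%:R else 1 + hmax.

Let rP n i : (0 < n)%N -> `|1 - h i / n%:R| <= r n.
Proof.
move=> n0; have np : 0 < n%:R :> R by rewrite ltr0n.
have /andP[h1 h2] := h_bnd i; rewrite /r; case: ifPn => [hn|_].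
  have h3 : h i / n%:R <= 1 by rewrite ler_pdivrMr// mul1r (le_trans h2).
  by rewrite ger0_norm ?subr_ge0// lerD2l lerN2 ler_pM2r ?invr_gt0.
rewrite (le_trans (ler_normB _ _))// normr1 lerD2l.
have hi : 0 <= h i by rewrite (le_trans _ h1)// ltW// (lt_trans _ rho_gt)// invr_gt0.
rewrite ger0_norm ?divr_ge0// ler_pdivrMr//.
by rewrite (le_trans h2)// ler_peMr ?ler1n// (le_trans hi).
Qed.

Let norm1_contract n t : (0 < n)%N -> norm1 (contract n t) <= r n * norm1 t.
Proof.
move=> n0; rewrite /norm1 mulr_sumr; apply: ler_sum => i _.
by rewrite mxE normrM mulrC ler_wpM2r// rP.
Qed.

Let norm1_ge0 (t : 'rV[R]_d) : 0 <= norm1 t. Proof. exact: sumr_ge0. Qed.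

Let dotz_le t u : `|dotv t (z u)| <= Z * norm1 t.
Proof.
have Zu : norm1 (z u) <= Z.
  by rewrite /Z (bigD1 u)//= lerDl sumr_ge0.
rewrite (le_trans (ler_norm_sum _ _ _))// [X in Z * X]/norm1 mulr_sumr.
apply: ler_sum => i _; rewrite normrM mulrC ler_wpM2r//.
by apply: le_trans Zu; rewrite /norm1 (bigD1 i)//= lerDl sumr_ge0.
Qed.

(** Distance to the Gaussian value with the exact covariance of L_n. Uniformity in t and a lets the
    induction close, since a step changes t to [contract n t] and shifts a by x_u; the cube of the
    norm matches the third-order error of [avg_cos_le]. *)
Let cerr n (B : R) := forall t a,
  `|Ex P (fun w => cos (dotv t (L n w) + a)) - cos a * expR (- Q n t / 2)|
    <= B * norm1 t ^+ 3.

(* Averaging over the fresh index: the average of cos (a - x_u) is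
   cos a * exp (- q / 2) up to O(max |x_u|^3) because sum x_u = 0. *)
Let cerrS n (B : R) : (0 < n)%N -> 0 <= B -> cerr n B ->
  cerr n.+1 (r n ^+ 3 * B + 3 * Z ^+ 3 / n%:R ^+ 3).
Proof.
move=> n0 B0 HB t a; have np : 0 < n%:R :> R by rewrite ltr0n.
set t' := contract n t; pose x u := dotv t (z u) / n%:R.
rewrite (Ex_nextE N0 sqX0 sqX1 noise (Y := fun v w => cos (dotv t' (L n w) + (a - x v))) n0); last 2 first.
- by move=> w; rewrite dotv_linprocS addrAC -addrA.
- by move=> v; apply: bmeas_cos; apply: measurable_funD => //; exact: (bdot t' n0).1.
rewrite QS// -/t'; set q := N%:R^-1 * \sum_(u < N) (x u) ^+ 2.
have -> : - (Q n t' + q) / 2 = - Q n t' / 2 + - q / 2 by field.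
rewrite expRD; set E := expR (- Q n t' / 2).
have E0 : 0 <= E by exact: expR_ge0.
have E1 : E <= 1 by rewrite /E -(expR0 R) ler_expR mulNr oppr_le0 divr_ge0// Q_ge0.
have -> : N%:R^-1 * (\sum_v Ex P (fun w => cos (dotv t' (L n w) + (a - x v)))) - cos a * (E * expR (- q / 2))
  = N%:R^-1 * (\sum_v (Ex P (fun w => cos (dotv t' (L n w) + (a - x v))) - cos (a - x v) * E))
  + E * (N%:R^-1 * (\sum_v cos (a - x v)) - cos a * expR (- q / 2)).
  by rewrite sumrB -mulr_suml; ring.
rewrite (le_trans (ler_normD _ _))// mulrDl lerD//.
  rewrite normrM gtr0_norm ?invr_gt0 ?ltr0n// mulrC ler_pdivrMr ?ltr0n//.
  rewrite (le_trans (ler_norm_sum _ _ _))// mulr_natr -[X in _ <= _ *+ X](card_ord N).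
  rewrite -sumr_const; apply: ler_sum => v _; apply: le_trans (HB _ _) _.
  rewrite mulrAC [leRHS]mulrC ler_wpM2l// -exprMn.
  by rewrite ler_pXn2r ?nnegrE ?norm1_contract// (le_trans _ (norm1_contract _ _)).
rewrite normrM ger0_norm// -[leRHS]mul1r ler_pM//.
apply: (@le_trans _ _ (3 * (Z * norm1 t / n%:R) ^+ 3)).
  apply: avg_cos_le => //; first by rewrite /x -mulr_suml dotz_sum0 mul0r.
  by move=> u; rewrite /x normrM [`|_^-1|]ger0_norm ?invr_ge0// ler_wpM2r ?invr_ge0.
by rewrite le_eqVlt; apply/orP; left; apply/eqP; field; rewrite gt_eqF.
Qed.

Let r_ge0 n : (0 < n)%N -> 0 <= r n.
Proof. by move=> n0; exact: le_trans (normr_ge0 _) (rP (Ordinal d0) n0). Qed.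

Let Z_ge0 : 0 <= Z. Proof. by apply: sumr_ge0 => u _; exact: norm1_ge0. Qed.

Let cbound : nat -> R := fix cbound n :=
  if n is n'.+1 then r n' ^+ 3 * cbound n' + 3 * Z ^+ 3 / n'%:R ^+ 3 else 0.

Let cboundS n : cbound n.+1 = r n ^+ 3 * cbound n + 3 * Z ^+ 3 / n%:R ^+ 3.
Proof. by []. Qed.

Let cbound1 : cbound 1 = 0.
Proof. by rewrite cboundS mulr0 add0r expr0n/= invr0 mulr0. Qed.

Let cbound_ge0 n : 0 <= cbound n.
Proof.
elim: n => // -[_|n IH]; first by rewrite cbound1.
by rewrite cboundS addr_ge0// ?divr_ge0 ?mulr_ge0 ?exprn_ge0// r_ge0.
Qed.

Let dotv0 (t : 'rV[R]_d) : dotv t 0 = 0.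
Proof. by rewrite /dotv big1// => i _; rewrite mxE mulr0. Qed.

Let cerr_cbound n : (0 < n)%N -> cerr n (cbound n).
Proof.
elim: n => // -[_ _|n IH _]; last first.
  by rewrite cboundS; apply: cerrS => //; exact: IH.
move=> t a; rewrite cbound1 mul0r normr_le0 subr_eq0; apply/eqP.
under eq_Rintegral do rewrite linproc1 dotv0 add0r.
rewrite Ex_cst /Q; under eq_Rintegral do rewrite linproc1 dotv0 mulr0.
by rewrite Ex_cst oppr0 mul0r expR0 mulr1.
Qed.

Let sqrt_natS n : (0 < n)%N ->
  Num.sqrt n.+1%:R <= Num.sqrt n%:R * (1 + n%:R^-1 / 2) :> R.
Proof.
move=> n0; have np : 0 < n%:R :> R by rewrite ltr0n.
have x0 : 0 <= 1 + n%:R^-1 / 2 :> R by rewrite addr_ge0// divr_ge0// invr_ge0.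
rewrite -[X in _ * X]ger0_norm// -sqrtr_sqr -sqrtrM// ler_sqrt; last first.
  by rewrite mulr_ge0// sqr_ge0.
rewrite -natr1 -subr_ge0 (_ : _ - _ = n%:R^-1 / 4); first by rewrite divr_ge0// invr_ge0.
by field; rewrite gt_eqF.
Qed.

(* At t of size sqrt n the error is n^(3/2) * cbound n, and the contraction factor
   of cbound beats n^(3/2) exactly because rho > 1/2. *)
Let cbound_cvg : (n%:R * Num.sqrt n%:R) * cbound n @[n --> \oo] --> 0.
Proof.
(* The cubed contraction gives 3 rho, against the growth exponent 3/2 of the prefactor; the halving
   makes room for second-order terms. *)
pose a := (3 * rho - 3 / 2) / 2; have a0 : 0 < a by rewrite /a; have := rho_gt; lra.
(* The noise term 3 Z^3 times 4, which bounds (1 + x) (1 + x / 2) for x <= 1. *)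
pose K := 12 * Z ^+ 3; have K0 : 0 <= K by rewrite mulr_ge0// exprn_ge0.
have rhoh : rho <= hmax by have /andP[] := h_bnd (Ordinal d0); exact: le_trans.
apply: (@recursion_cvg0 R _ (fun n => K / Num.sqrt n%:R) a a0).
- by move=> n; rewrite !mulr_ge0// sqrtr_ge0.
- near=> n.
  have n0 : (0 < n)%N by near: n; exists 1%N.
  have np : 0 < n%:R :> R by rewrite ltr0n.
  have hn : hmax <= n%:R by near: n; exact: nbhs_infty_ger.
  have xs : (3 * rho - 3 / 2) / n%:R <= 2^-1.
    by near: n; apply: near_le_div; rewrite invr_gt0.
  have rx1 : rho / n%:R <= 1 by rewrite ler_pdivrMr// mul1r (le_trans rhoh).
  rewrite cboundS /r hn -natr1; set x := n%:R^-1 in xs rx1 *.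
  have x0 : 0 < x by rewrite invr_gt0.
  have x1 : x <= 1 by rewrite invf_le1// ler1n.
  set q : R := Num.sqrt n%:R; have q0 : 0 < q by rewrite sqrtr_gt0.
  have qq : n%:R = q * q by rewrite -expr2 sqr_sqrtr.
  have qx : q * q * x = 1 by rewrite -qq mulfV// gt_eqF.
  have C0 := cbound_ge0 n.
  have Y0 : 0 <= (1 - rho * x) ^+ 3 * cbound n + 3 * Z ^+ 3 * (n%:R ^+ 3)^-1.
    rewrite addr_ge0// ?mulr_ge0 ?exprn_ge0 ?subr_ge0//.
  rewrite natr1; apply: (@le_trans _ _ (n.+1%:R * (q * (1 + x / 2)) *
     ((1 - rho * x) ^+ 3 * cbound n + 3 * Z ^+ 3 * (n%:R ^+ 3)^-1))).
    by rewrite ler_wpM2r// ler_wpM2l// sqrt_natS.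
  have -> : n.+1%:R = n%:R * (1 + x) by rewrite mulrDr mulr1 mulfV ?natr1// gt_eqF.
  rewrite mulrDr; apply: lerD.
    have -> : n%:R * (1 + x) * (q * (1 + x / 2)) * ((1 - rho * x) ^+ 3 * cbound n) =
      (1 + x) * (1 + x / 2) * (1 - rho * x) ^+ 3 * (n%:R * q * cbound n) by ring.
    have V0 : 0 <= n%:R * q * cbound n by rewrite !mulr_ge0// ltW.
    rewrite ler_wpM2r//.
    have e1 := expR_ge1Dx x; have e2 := expR_ge1Dx (x / 2); have e3 := expR_ge1Dx (- (rho * x)).
    apply: (@le_trans _ _ (expR (- ((3 * rho - 3 / 2) * x)))).
      have -> : - ((3 * rho - 3 / 2) * x) = x + x / 2 + (- (rho * x) + (- (rho * x) + - (rho * x))) by field.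
      rewrite !expRD; apply: ler_pM; rewrite ?exprn_ge0 ?subr_ge0//.
      + by rewrite mulr_ge0// addr_ge0// ?divr_ge0// ltW.
      + by apply: ler_pM => //; rewrite addr_ge0// ?divr_ge0// ltW.
      + rewrite !exprS expr0 mulr1.
        by apply: ler_pM => //; rewrite ?subr_ge0 ?mulr_ge0 ?subr_ge0//; apply: ler_pM; rewrite ?subr_ge0.
    rewrite (_ : a * x = (3 * rho - 3 / 2) * x / 2); last by rewrite /a; field.
    apply: expRN_le_half; rewrite xs andbT mulr_ge0//; last exact: ltW.
    by have := rho_gt; lra.
  have -> : n%:R * (1 + x) * (q * (1 + x / 2)) * (3 * Z ^+ 3 * (n%:R ^+ 3)^-1) =
    (1 + x) * (1 + x / 2) * (3 * Z ^+ 3 / q * x).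
    rewrite /x qq; field; rewrite gt_eqF//.
  have -> : K / q * x = 4 * (3 * Z ^+ 3 / q * x) by rewrite /K; ring.
  have W0 : 0 <= 3 * Z ^+ 3 / q * x by rewrite !mulr_ge0 ?invr_ge0 ?exprn_ge0// ltW.
  rewrite ler_wpM2r//.
  clearbody x; have xx : x * x <= 1 by rewrite mulr_ile1 // ltW.
  by rewrite (_ : _ * _ = 1 + x * 3 / 2 + x * x / 2); [lra|field].
- rewrite -[X in _ --> X](mulr0 K); apply: cvgM; first exact: cvg_cst.
  rewrite -[X in _ --> X](@sqrtr0 R).
  under eq_fun do rewrite -sqrtrV//.
  apply: continuous_cvg; first exact: sqrt_continuous.
  by have := cvg_cst_div (1 : R); under eq_fun do rewrite mul1r.
Unshelve. all: end_near. Qed.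

Let Q_bilin n t : (0 < n)%N -> Q n t =
  \sum_i \sum_j t ord0 i * t ord0 j * Ex P (fun w => L n w ord0 i * L n w ord0 j).
Proof.
move=> n0; rewrite /Q.
transitivity (Ex P (fun w => \sum_i \sum_j (t ord0 i * t ord0 j) * (L n w ord0 i * L n w ord0 j))).
  apply: eq_Rintegral => w _; rewrite /dotv mulr_suml; apply: eq_bigr => i _.
  by rewrite mulr_sumr; apply: eq_bigr => j _; ring.
have bb i j : bmeas (fun w => (t ord0 i * t ord0 j) * (L n w ord0 i * L n w ord0 j)).
  by apply: bmeasZ; apply: bmeasM; exact: bL.
rewrite Ex_sum; last by move=> i; apply: bmeas_sum => j; exact: bb.
apply: eq_bigr => i _; rewrite Ex_sum//.
by apply: eq_bigr => j _; rewrite ExZ//; apply: bmeasM; exact: bL.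
Qed.

Lemma linproc_cov_cvg i j :
  n%:R * Ex P (fun w => L n w ord0 i * L n w ord0 j) @[n --> \oo] -->
  noise_cov i j / (h i + h j - 1).
Proof.
apply: covariance_recursion_cvg => [|n n0]; last exact: linproc_cov.
by have /andP[hi _] := h_bnd i; have /andP[hj _] := h_bnd j; have := rho_gt; lra.
Qed.

Lemma linproc_clt t (a : R) :
  Ex P (fun w => cos (Num.sqrt n%:R * dotv t (L n w) + a)) @[n --> \oo] -->
  cos a * expR (- (\sum_i \sum_j t ord0 i * t ord0 j *
                     (noise_cov i j / (h i + h j - 1))) / 2).
Proof.
have G : cos a * expR (- (\sum_i \sum_j t ord0 i * t ord0 j *
    (n%:R * Ex P (fun w => L n w ord0 i * L n w ord0 j))) / 2) @[n --> \oo] -->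
  cos a * expR (- (\sum_i \sum_j t ord0 i * t ord0 j *
                     (noise_cov i j / (h i + h j - 1))) / 2).
  apply: cvgM; first exact: cvg_cst.
  apply: continuous_cvg; first exact: continuous_expR.
  apply: cvgM; last exact: cvg_cst.
  apply: cvgN; apply: cvgr_sum => i; apply: cvgr_sum => j; apply: cvgM; first exact: cvg_cst.
  exact: linproc_cov_cvg.
(* G handles the Gaussian value with the covariance at time n; what remains is the distance to that
   value. *)
apply: cvg_sub0 G; rewrite /=.
apply/norm_cvg0P; apply: (@squeeze_cvgr _ _ _ _ (fun=> 0) (fun n =>
   n%:R * Num.sqrt n%:R * cbound n * norm1 t ^+ 3)); last 2 first.
- exact: cvg_cst.
- by rewrite -[X in _ --> X](mul0r (norm1 t ^+ 3)); apply: cvgM; [exact: cbound_cvg|exact: cvg_cst].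
near=> n; rewrite normr_ge0/=.
have n0 : (0 < n)%N by near: n; exists 1%N.
set q : R := Num.sqrt n%:R; have q0 : 0 <= q by exact: sqrtr_ge0.
have qq : n%:R = q * q by rewrite -expr2 sqr_sqrtr.
have dotZ w : dotv (q *: t) (L n w) = q * dotv t (L n w).
  by rewrite /dotv mulr_sumr; apply: eq_bigr => i _; rewrite mxE mulrA.
have := cerr_cbound n0 (q *: t) a.
under eq_Rintegral do rewrite dotZ.
have -> : norm1 (q *: t) = q * norm1 t.
  by rewrite /norm1 mulr_sumr; apply: eq_bigr => i _; rewrite mxE normrM ger0_norm.
have -> : Q n (q *: t) = \sum_i \sum_j t ord0 i * t ord0 j *
    (n%:R * Ex P (fun w => L n w ord0 i * L n w ord0 j)).
  rewrite Q_bilin//; apply: eq_bigr => i _; apply: eq_bigr => j _.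
  by rewrite !mxE qq; ring.
rewrite (_ : cbound n * _ = n%:R * q * cbound n * norm1 t ^+ 3)//.
by rewrite qq; ring.
Unshelve. all: end_near. Qed.

End linear_process.

(** * Perturbations of the linear process *)

Lemma Ex_cvg0 (R : realType) (dT : measure_display) (T : measurableType dT)
    (P : probability T R) (f : nat -> T -> R) (M : R) :
  (forall n, bmeas (f n)) -> (forall n w, `|f n w| <= M) ->
  {ae P, forall w, f n w @[n --> \oo] --> 0} ->
  Ex P (f n) @[n --> \oo] --> 0.
Proof.
move=> bf fM f0.
have [] := @dominated_convergence _ _ _ P setT measurableT (fun n w => (f n w)%:E) (cst 0%E)
  (cst M%:E).
- by move=> n; apply/measurable_EFinP; exact: (bf n).1.
- exact: measurable_cst.
- by apply: filterS f0 => w /= fw _; apply: cvg_EFin => //; near=> n.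
- exact: (bmeas_integrable P (bmeas_cst T M)).
- by apply: aeW => w n _ /=; rewrite lee_fin.
move=> _ _; rewrite integral0 => /fine_cvg; exact.
Unshelve. all: end_near. Qed.

(** If A_n holds eventually almost surely, the indicators of the tail unions of complements tend to
    0 almost surely, and they are bounded. *)
Lemma prob_tail_cvg0 (R : realType) (dT : measure_display) (T : measurableType dT)
    (P : probability T R) (A : nat -> set T) :
  (forall n, measurable (A n)) ->
  {ae P, forall w, \forall n \near \oo, A n w} ->
  fine (P (\bigcup_(n in [set n | (m <= n)%N]) ~` A n)) @[m --> \oo] --> 0.
Proof.
move=> mA Aoo; pose C m := \bigcup_(n in [set n | (m <= n)%N]) ~` A n.
have mC m : measurable (C m).
  by apply: bigcup_measurable => k _; exact: measurableC.
under eq_fun do rewrite -/(C _) -Ex_indic//.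
apply: (@Ex_cvg0 _ _ _ _ _ 1).
- by move=> n; exact: bmeas_indic.
- by move=> n w; rewrite indicE; case: (_ \in _); rewrite ?normr1 ?normr0.
apply: filterS Aoo => w [m _ Am]; apply: cvg_near_cst; exists m => // n /= mn.
by rewrite indicE memNset// => -[k /= nk]; apply; apply: Am; exact: leq_trans nk.
Qed.

Lemma measurable_exists_gt (R : realType) (dT : measure_display) (T : measurableType dT)
    (d : nat) (f : T -> 'I_d -> R) (K : R) :
  (forall i, measurable_fun setT (fun w => f w i)) ->
  measurable [set w | exists i, K < f w i].
Proof.
move=> mf; rewrite (_ : [set w | _] = \bigcup_(i in [set: 'I_d])
    ((fun w => f w i) @^-1` [set` `]K, +oo[])).
  apply: fin_bigcup_measurable => // i _; rewrite -[X in measurable X]setTI.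
  exact: mf.
by apply/seteqP; split => w; [move=> [i iw]; exists i => //=|move=> [i _ /= iw]; exists i];
  rewrite in_itv/= andbT in iw *.
Qed.

(** The difference of the two sides is x / k (k p + q)^2. The cross term thus costs a small part k x
    of the contraction and leaves q^2 a weight of order x. *)
Lemma young_sqr (R : realType) (k x p q : R) : 0 < k -> 0 <= x ->
  (p - x * q) ^+ 2 <= (1 + k * x) * p ^+ 2 + (x ^+ 2 + x / k) * q ^+ 2.
Proof.
move=> k0 x0; rewrite -subr_ge0.
rewrite (_ : _ - _ = x / k * (k * p + q) ^+ 2); last by field; rewrite gt_eqF.
by rewrite mulr_ge0 ?sqr_ge0// divr_ge0// ltW.
Qed.

(** Here x is the step size, p stands for y - L and l for L. Averaging over v removes the cross
    terms with the centred f, which then enters only at order x^2, while q is charged to p + l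
    through Young's inequality. *)
Lemma contraction_step (R : realType) (N d : nat) (h p q l : 'I_d -> R)
    (f : 'I_N -> 'I_d -> R) (x k rho delta : R) :
  (0 < N)%N -> 0 < k -> 0 <= x ->
  (forall i, (1 - h i * x) ^+ 2 <= (1 - rho * x) ^+ 2) ->
  (forall i, q i ^+ 2 <= delta * \sum_j (p j + l j) ^+ 2) ->
  (forall i, \sum_v f v i = 0) -> 0 <= delta ->
  N%:R^-1 * (\sum_v \sum_i ((1 - h i * x) * p i - x * (q i + f v i)) ^+ 2) <=
  ((1 + k * x) * (1 - rho * x) ^+ 2 + (x ^+ 2 + x / k) * (2 * d%:R * delta)) *
     (\sum_i p i ^+ 2)
  + (x ^+ 2 + x / k) * (2 * d%:R * delta) * (\sum_i l i ^+ 2)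
  + x ^+ 2 * (N%:R^-1 * \sum_v \sum_i f v i ^+ 2).
Proof.
move=> N0 k0 x0 hx qp f0 del0; have N1 : N%:R != 0 :> R by rewrite pnatr_eq0 -lt0n.
have c0 : 0 <= x ^+ 2 + x / k by rewrite addr_ge0 ?sqr_ge0// divr_ge0// ltW.
have -> : N%:R^-1 * (\sum_v \sum_i ((1 - h i * x) * p i - x * (q i + f v i)) ^+ 2) =
  \sum_i ((1 - h i * x) * p i - x * q i) ^+ 2 + x ^+ 2 * (N%:R^-1 * \sum_v \sum_i f v i ^+ 2).
  rewrite exchange_big/= [in RHS]exchange_big/= !mulr_sumr -big_split/=.
  apply: eq_bigr => i _; set a := (1 - _) * p i.
  rewrite (eq_bigr (fun v => (a - x * q i) ^+ 2 - 2 * x * (a - x * q i) * f v i +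
     x ^+ 2 * f v i ^+ 2)); last by move=> v _; ring.
  rewrite big_split/= sumrB -!mulr_sumr f0 mulr0 subr0 sumr_const card_ord.
  rewrite -mulr_natl; move: (\sum_(_ < N) _) => S; clearbody a.
  by field.
rewrite lerD2r.
have S i : ((1 - h i * x) * p i - x * q i) ^+ 2 <=
   (1 + k * x) * (1 - rho * x) ^+ 2 * p i ^+ 2 +
   (x ^+ 2 + x / k) * (delta * \sum_j (p j + l j) ^+ 2).
  apply: le_trans (young_sqr _ _ k0 x0) _; apply: lerD.
    rewrite exprMn mulrA ler_wpM2r ?sqr_ge0// ler_wpM2l//.
    by rewrite addr_ge0// mulr_ge0// ltW.
  by rewrite ler_wpM2l.
apply: le_trans (ler_sum _ (fun i _ => S i)) _.
rewrite big_split/= -mulr_sumr sumr_const card_ord.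
have T2 : \sum_j (p j + l j) ^+ 2 <= 2 * (\sum_i p i ^+ 2) + 2 * (\sum_i l i ^+ 2).
  rewrite !mulr_sumr -big_split/=; apply: ler_sum => i _.
  by have := sqr_ge0 (p i - l i); nra.
have T3 : (x ^+ 2 + x / k) * (d%:R * delta) * (\sum_j (p j + l j) ^+ 2) <=
   (x ^+ 2 + x / k) * (d%:R * delta) * (2 * (\sum_i p i ^+ 2) + 2 * (\sum_i l i ^+ 2)).
  by rewrite ler_wpM2l// !mulr_ge0.
rewrite -[_ *+ d]mulr_natl; move: T3.
move: (\sum_j _) (\sum_i p i ^+ 2) (\sum_i l i ^+ 2) => Y V W T3.
by move: ((1 + k * x) * _) (x ^+ 2 + x / k) T3 => A C; lra.
Qed.

Lemma cos_lipschitz (R : realType) (a b : R) : `|cos a - cos b| <= `|a - b|.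
Proof.
have -> : cos a - cos b = - 2 * sin ((a + b) / 2) * sin ((a - b) / 2).
  have -> : cos a = cos ((a + b) / 2 + (a - b) / 2) by congr cos; field.
  have -> : cos b = cos ((a + b) / 2 - (a - b) / 2) by congr cos; field.
  by rewrite cosD cosB; ring.
rewrite normrM normrM normrN (ger0_norm (ler0n _ _)).
have := normr_sin_le ((a - b) / 2); rewrite normrM [`|2^-1|]ger0_norm ?invr_ge0//.
have : `|sin ((a + b) / 2)| <= 1 by rewrite ler_norml sin_geN1 sin_le1.
have := normr_ge0 (sin ((a - b) / 2)); have := normr_ge0 (sin ((a + b) / 2)).
by move: (`|sin _|) (`|sin _|) => u v; nra.
Qed.

Section perturbed_linear_process.
Context {R : realType} {dT : measure_display} {T : measurableType dT}
  {P : probability T R} {N d : nat} {X0 X1 : T -> 'rV[R]_d} {U : nat -> T -> 'I_N}.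
Variables (z : 'I_N -> 'rV[R]_d) (h : 'I_d -> R).
Hypothesis N0 : (0 < N)%N.
Hypothesis d0 : (0 < d)%N.
Hypothesis sqX0 : sq_integrable_rv P X0.
Hypothesis sqX1 : sq_integrable_rv P X1.
Hypothesis noise : saga_noise P X0 X1 U.
Hypothesis z_sum0 : forall i, \sum_u z u ord0 i = 0.
Variables rho hmax : R.
Hypothesis rho_gt : 2^-1 < rho.
Hypothesis h_bnd : forall i, rho <= h i <= hmax.
Local Notation HT := (histT (X0 := X0) (X1 := X1) (U := U)).
Local Notation L := (linproc (U := U) z h).

Variables (y q : nat -> T -> 'rV[R]_d) (e : nat -> 'I_N -> T -> 'rV[R]_d).
Hypothesis my : forall n i, (0 < n)%N ->
  measurable_fun setT ((fun w => y n w ord0 i) : HT n -> R).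
Hypothesis mq : forall n i, (0 < n)%N ->
  measurable_fun setT ((fun w => q n w ord0 i) : HT n -> R).
Hypothesis me : forall n u i, (0 < n)%N ->
  measurable_fun setT ((fun w => e n u w ord0 i) : HT n -> R).
Hypothesis y_rec : forall n w i, (0 < n)%N -> y n.+1 w ord0 i =
  (1 - h i / n%:R) * y n w ord0 i
  - (q n w ord0 i + e n (U n.+1 w) w ord0 i + z (U n.+1 w) ord0 i) / n%:R.
Hypothesis e_sum0 : forall n w i, (0 < n)%N -> \sum_u e n u w ord0 i = 0.
Hypothesis q_small : forall delta : R, 0 < delta -> exists2 eps : R, 0 < eps &
  forall n w, (forall i, `|y n w ord0 i| <= eps) -> forall i,
    q n w ord0 i ^+ 2 <= delta * \sum_j y n w ord0 j ^+ 2.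
Hypothesis y_cvg0 : {ae P, forall w i, y n w ord0 i @[n --> \oo] --> 0}.
Hypothesis e_cvg0 : {ae P, forall w u i, e n u w ord0 i @[n --> \oo] --> 0}.

Let D n w i := y n w ord0 i - L n w ord0 i.

(** Both processes use the same draw, so the noise z cancels and only the small terms q and e drive
    the difference. *)
Let DS n w i : (0 < n)%N -> D n.+1 w i =
  (1 - h i / n%:R) * D n w i - n%:R^-1 * (q n w ord0 i + e n (U n.+1 w) w ord0 i).
Proof. by move=> n0; rewrite /D y_rec// linprocS; ring. Qed.

Let var n := Ex P (fun w => \sum_i L n w ord0 i ^+ 2).

Let var_bounded : exists2 M : R, 0 <= M & \forall n \near \oo, n%:R * var n <= M.
Proof.
pose l := \sum_i noise_cov z i i / (h i + h i - 1).
have C : n%:R * var n @[n --> \oo] --> l.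
  have H : \sum_i n%:R * Ex P (fun w => L n w ord0 i * L n w ord0 i) @[n --> \oo] --> l.
    apply: cvgr_sum => i; exact: (linproc_cov_cvg N0 sqX0 sqX1 noise z_sum0 rho_gt h_bnd).
  apply: cvg_trans H; apply: near_eq_cvg; near=> n.
  have n0 : (0 < n)%N by near: n; exists 1%N.
  rewrite -mulr_sumr; congr (_ * _).
  rewrite /var Ex_sum.
    by apply: eq_bigr => i _; apply: eq_Rintegral => w _; rewrite expr2.
  move=> i; under eq_fun do rewrite expr2.
  by apply: (histT_bmeas N0 sqX0 sqX1 noise n0); apply: bmeasM; exact: linproc_bmeas.
exists (`|l| + 1); first by rewrite addr_ge0.
have /cvgrPdist_le/(_ 1 ltr01) := C; apply: filterS => n; rewrite ler_norml => /andP[h1 _].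
by have := ler_norm l; lra.
Unshelve. all: end_near. Qed.

Definition far (eta : R) n : set T :=
  [set w | exists i, eta < Num.sqrt n%:R * `|y n w ord0 i - L n w ord0 i|].

Section localized.
Variables (eps delta : R) (m : nat).
Hypothesis eps_gt0 : 0 < eps.
Hypothesis delta_gt0 : 0 < delta.
Hypothesis m0 : (0 < m)%N.
Hypothesis q_le : forall n w, (forall i, `|y n w ord0 i| <= eps) -> forall i,
    q n w ord0 i ^+ 2 <= delta * \sum_j y n w ord0 j ^+ 2.

Definition near0 n : set T := [set w | (forall i, `|y n w ord0 i| <= eps) /\
  (forall u i, `|e n u w ord0 i| <= 1)].
Local Notation good := near0.

Lemma near0_hist n : (0 < n)%N -> measurable (good n : set (HT n)).
Proof.
move=> n0; rewrite (_ : good n =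
   (\bigcap_(i in [set: 'I_d]) ((fun w => y n w ord0 i : R) @^-1` [set` `[- eps, eps]]))
   `&` \bigcap_(u in [set: 'I_N]) \bigcap_(i in [set: 'I_d])
     ((fun w => e n u w ord0 i : R) @^-1` [set` `[-1, 1]])).
  apply: measurableI.
    apply: fin_bigcap_measurable => // i _; rewrite -[X in measurable X]setTI.
    exact: my.
  apply: fin_bigcap_measurable => // u _; apply: fin_bigcap_measurable => // i _.
  by rewrite -[X in measurable X]setTI; exact: me.
apply/seteqP; split => w.
  move=> [h1 h2]; split => [i _|u _ i _] /=; rewrite in_itv/= -ler_norml.
    exact: h1.
  exact: h2.
move=> [h1 h2]; split => [i|u i]; rewrite ler_norml.
  by have := h1 i I; rewrite /= in_itv.
by have := h2 u I i I; rewrite /= in_itv.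
Qed.

(* Localisation: on [stay n] the quadratic remainder is controlled and all
   quantities are bounded, while [~` stay n] has small probability for large m. *)
Definition stay n : set T := [set w | forall k, (m <= k <= n)%N -> near0 k w].
Local Notation B := stay.

Let stay_hist n : (0 < n)%N -> measurable (B n : set (HT n)).
Proof.
move=> n0; rewrite (_ : B n = \bigcap_(k in [set k | (m <= k <= n)%N]) good k); last first.
  by apply/seteqP; split => w Hw k; exact: Hw.
apply: bigcap_measurableType => k /andP[mk kn].
have k0 : (0 < k)%N by exact: leq_trans mk.
apply: (histT_measurable (sub_hist kn _)).
have := near0_hist k0; rewrite /measurable/= sigma_algebra_id//.
exact: sigma_algebra_hist.
Qed.

Let ind n w : R := \1_(B n) w.

Let bind n : (0 < n)%N -> bmeas (ind n : HT n -> R).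
Proof. by move=> n0; apply: bmeas_indic; exact: stay_hist. Qed.

Let indM (n : nat) (f : T -> R) (c : R) : (0 < n)%N -> 0 <= c ->
  measurable_fun setT (f : HT n -> R) ->
  (forall w, B n w -> `|f w| <= c) -> bmeas ((fun w => ind n w * f w) : HT n -> R).
Proof.
move=> n0 c0 mf fc; split; first by apply: measurable_funM => //; exact: (bind n0).1.
exists c => w; rewrite /ind indicE; have [wB|wB] := boolP (w \in B n).
  by rewrite mul1r fc//; rewrite inE in wB.
by rewrite mul0r normr0.
Qed.

Let good_stay n w : (m <= n)%N -> B n w -> good n w.
Proof. by move=> mn; apply; rewrite mn leqnn. Qed.

Let by_ n i : (m <= n)%N -> bmeas ((fun w => ind n w * y n w ord0 i) : HT n -> R).
Proof.
move=> mn; have n0 : (0 < n)%N by exact: leq_trans mn.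
apply: (@indM _ _ eps n0 (ltW eps_gt0)); first exact: my.
by move=> w /(good_stay mn)[h1 _]; exact: h1.
Qed.

Let bD n i : (m <= n)%N -> bmeas ((fun w => ind n w * D n w i) : HT n -> R).
Proof.
move=> mn; have n0 : (0 < n)%N by exact: leq_trans mn.
under eq_fun do rewrite mulrBr; apply: bmeasB; first exact: by_.
by apply: bmeasM; [exact: bind|exact: linproc_bmeas].
Qed.

Let be_ n u i : (m <= n)%N -> bmeas ((fun w => ind n w * e n u w ord0 i) : HT n -> R).
Proof.
move=> mn; have n0 : (0 < n)%N by exact: leq_trans mn.
apply: (@indM _ _ 1 n0); rewrite ?ler01//; first exact: me.
by move=> w /(good_stay mn)[_ h2]; exact: h2.
Qed.

Let bq n i : (m <= n)%N -> bmeas ((fun w => ind n w * q n w ord0 i) : HT n -> R).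
Proof.
move=> mn; have n0 : (0 < n)%N by exact: leq_trans mn.
pose c := delta * \sum_(j < d) eps ^+ 2.
have c0 : 0 <= c by rewrite mulr_ge0 ?(ltW delta_gt0)// sumr_ge0// => j _; exact: sqr_ge0.
apply: (@indM _ _ (1 + c) n0); [by rewrite addr_ge0|exact: mq|].
move=> w /(good_stay mn)[h1 _].
have h3 : `|q n w ord0 i| ^+ 2 <= c.
  rewrite real_normK ?num_real//; apply: le_trans (q_le h1 i) _.
  rewrite ler_wpM2l ?(ltW delta_gt0)//; apply: ler_sum => j _.
  rewrite -[X in X <= _](@real_normK _ _ (num_real _)).
  by rewrite ler_pXn2r ?nnegrE ?(ltW eps_gt0).
by have := sqr_ge0 (`|q n w ord0 i| - 1); nra.
Qed.

Let err n := Ex P (fun w => \sum_i (ind n w * D n w i) ^+ 2).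
Let err_e n := Ex P (fun w => N%:R^-1 * \sum_u \sum_i (ind n w * e n u w ord0 i) ^+ 2).
Let stayS n w : B n.+1 w -> B n w.
Proof. by move=> Bw k /andP[mk kn]; apply: Bw; rewrite mk (leq_trans kn)// leqnSn. Qed.

Let indS n w : ind n.+1 w <= ind n w.
Proof.
rewrite /ind !indicE; have [w1|] := boolP (w \in B n.+1); last by rewrite ler0n.
by rewrite mem_set//; apply: stayS; rewrite inE in w1.
Qed.

Let ind01 n w : ind n w = 0 \/ ind n w = 1.
Proof. by rewrite /ind indicE; case: (_ \in _); [right|left]. Qed.

Let bsq (f : T -> R) n : (0 < n)%N -> bmeas (f : HT n -> R) ->
  bmeas ((fun w => f w ^+ 2) : HT n -> R).
Proof. by move=> n0 bf; under eq_fun do rewrite expr2; exact: bmeasM. Qed.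

Lemma err_step n (k x : R) : (m <= n)%N -> 0 < k -> hmax <= n%:R -> x = n%:R^-1 ->
  err n.+1 <=
  ((1 + k * x) * (1 - rho * x) ^+ 2 + (x ^+ 2 + x / k) * (2 * d%:R * delta)) * err n
  + (x ^+ 2 + x / k) * (2 * d%:R * delta) * var n + x ^+ 2 * err_e n.
Proof.
move=> mn k0 hn xE; have n0 : (0 < n)%N by exact: leq_trans mn.
have np : 0 < n%:R :> R by rewrite ltr0n.
have x0 : 0 <= x by rewrite xE invr_ge0.
pose Y v w := \sum_i ((1 - h i * x) * (ind n w * D n w i) -
   x * (ind n w * q n w ord0 i + ind n w * e n v w ord0 i)) ^+ 2.
have bY v : bmeas (Y v : HT n -> R).
  apply: bmeas_sum => i; apply: bsq => //; apply: bmeasB.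
    by apply: bmeasZ; exact: bD.
  by apply: bmeasZ; apply: bmeasD; [exact: bq|exact: be_].
have bYT v := histT_bmeas N0 sqX0 sqX1 noise n0 (bY v).
have bS : bmeas (fun w => \sum_i (ind n.+1 w * D n.+1 w i) ^+ 2).
  apply: (@histT_bmeas _ _ _ _ _ _ X0 X1 U N0 sqX0 sqX1 noise n.+1) => //.
  by apply: bmeas_sum => i; apply: bsq => //; apply: bD; exact: leqW.
have bYn : bmeas (fun w => Y (U n.+1 w) w).
  apply: (@histT_bmeas _ _ _ _ _ _ X0 X1 U N0 sqX0 sqX1 noise n.+1) => //.
  exact: bmeas_hist_next.
(* The indicator at n + 1 would depend on U_{n+1} through the event itself; the larger one at n
   depends on the past alone, so the fresh index can be averaged out. *)
apply: (@le_trans _ _ (Ex P (fun w => Y (U n.+1 w) w))).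
  apply: Ex_le => // w; apply: ler_sum => i _.
  rewrite (_ : _ - _ = ind n w * D n.+1 w i); last by rewrite DS// -xE; ring.
  rewrite !exprMn ler_wpM2r ?sqr_ge0//.
  by have := indS n w; have [->|->] := ind01 n w; have [->|->] := ind01 n.+1 w; lra.
rewrite (Ex_next N0 sqX0 sqX1 noise n0 bY) -Ex_sum// -ExZ; last exact: bmeas_sum.
set al := (1 + k * x) * _ + _; set be := (_ + _) * (2 * _ * _).
have b1 : bmeas (fun w => \sum_i (ind n w * D n w i) ^+ 2).
  apply: (histT_bmeas N0 sqX0 sqX1 noise n0).
  by apply: bmeas_sum => i; apply: bsq => //; exact: bD.
have b2 : bmeas (fun w => \sum_i L n w ord0 i ^+ 2).
  apply: (histT_bmeas N0 sqX0 sqX1 noise n0).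
  by apply: bmeas_sum => i; apply: bsq => //; exact: linproc_bmeas.
have b3 : bmeas (fun w => N%:R^-1 * \sum_u \sum_i (ind n w * e n u w ord0 i) ^+ 2).
  apply: (histT_bmeas N0 sqX0 sqX1 noise n0).
  apply: bmeasZ; apply: bmeas_sum => u; apply: bmeas_sum => i; apply: bsq => //.
  exact: be_.
rewrite -[leRHS]addr0 -(Ex_affine P al be (x ^+ 2) 0 b1 b2 b3).
apply: Ex_le.
- by apply: bmeasZ; exact: bmeas_sum.
- by apply: bmeasD (bmeas_cst T 0); apply: bmeasD (bmeasZ _ b3); apply: bmeasD; exact: bmeasZ.
move=> w; rewrite addr0.
apply: le_trans (contraction_step (rho := rho) (delta := delta)
   (l := fun i => ind n w * L n w ord0 i) N0 k0 x0 _ _ _ (ltW delta_gt0)) _.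
- move=> i; have /andP[h1 h2] := h_bnd i.
  have h3 : h i * x <= 1 by rewrite xE ler_pdivrMr// mul1r (le_trans h2).
  have h4 : rho * x <= h i * x by rewrite ler_wpM2r.
  by rewrite ler_pXn2r ?nnegrE ?subr_ge0// ?lerD2l ?lerN2// (le_trans h4).
- move=> i; under eq_bigr do rewrite -mulrDr /D subrK.
  have [->|E1] := ind01 n w.
    rewrite mul0r expr0n/=; under eq_bigr do rewrite mul0r expr0n/=.
    by rewrite big1// mulr0.
  rewrite E1 mul1r; under eq_bigr do rewrite mul1r.
  apply: q_le; suff /(good_stay mn)[] : B n w by [].
  move: E1; rewrite /ind indicE; have [/set_mem//|_] := boolP (w \in _).
  by move=> /eqP; rewrite eq_sym oner_eq0.
- by move=> i; rewrite -mulr_sumr e_sum0// mulr0.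
rewrite lerD2r lerD2l ler_wpM2l//.
  by rewrite !mulr_ge0// ?(ltW delta_gt0)// addr_ge0 ?sqr_ge0// divr_ge0// ltW.
apply: ler_sum => i _; rewrite exprMn; have := sqr_ge0 (L n w ord0 i).
by have [->|->] := ind01 n w; nra.
Qed.

Let var_ge0 n : 0 <= var n.
Proof. by apply: Ex_ge0 => w; apply: sumr_ge0 => i _; exact: sqr_ge0. Qed.

Let err_ge0 n : 0 <= err n.
Proof. by apply: Ex_ge0 => w; apply: sumr_ge0 => i _; exact: sqr_ge0. Qed.

Let err_e_ge0 n : 0 <= err_e n.
Proof.
apply: Ex_ge0 => w; rewrite mulr_ge0 ?invr_ge0//; apply: sumr_ge0 => u _.
by apply: sumr_ge0 => i _; exact: sqr_ge0.
Qed.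

Let err_e_cvg0 : err_e n @[n --> \oo] --> 0.
Proof.
(* The bound |e| <= 1 on [stay] is available only from m on, hence the shift before dominated
   convergence. *)
rewrite -(cvg_shiftn m); apply: (@Ex_cvg0 _ _ _ _ _ (N%:R^-1 * \sum_(u < N) \sum_(i < d) 1)).
- move=> n; have mn : (m <= n + m)%N by exact: leq_addl.
  have n0 : (0 < n + m)%N by exact: leq_trans mn.
  apply: (histT_bmeas N0 sqX0 sqX1 noise n0).
  by apply: bmeasZ; apply: bmeas_sum => u; apply: bmeas_sum => i; apply: bsq => //; exact: be_.
- move=> n w; rewrite ger0_norm; last first.
    rewrite mulr_ge0 ?invr_ge0//; apply: sumr_ge0 => u _.
    by apply: sumr_ge0 => i _; exact: sqr_ge0.
  rewrite ler_wpM2l ?invr_ge0//; apply: ler_sum => u _; apply: ler_sum => i _.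
  rewrite -[leLHS](@real_normK _ _ (num_real _)) expr_le1// normrM /ind indicE.
  have [/set_mem wB|_] := boolP (w \in _); last by rewrite normr0 mul0r.
  rewrite normr1 mul1r; have [_ h2] := good_stay (leq_addl n m) wB; exact: h2.
apply: filterS e_cvg0 => w ew.
rewrite (cvg_shiftn m (fun n => N%:R^-1 *
   (\sum_(u < N) \sum_(i < d) (ind n w * e n u w ord0 i) ^+ 2))).
have zE : N%:R^-1 * (\sum_(u < N) \sum_(i < d) 0) = 0 :> R.
  by rewrite big1 ?mulr0// => u _; rewrite big1.
suff : N%:R^-1 * (\sum_(u < N) \sum_(i < d) (ind n w * e n u w ord0 i) ^+ 2) @[n --> \oo] -->
   (N%:R^-1 * (\sum_(u < N) \sum_(i < d) 0) : R) by rewrite zE.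
apply: cvgM; first exact: cvg_cst.
apply: cvgr_sum => u; apply: cvgr_sum => i.
apply: (@squeeze_cvgr _ _ _ _ (fun=> 0) (fun n => e n u w ord0 i * e n u w ord0 i)).
- near=> n; rewrite sqr_ge0/= exprMn -expr2; have := sqr_ge0 (e n u w ord0 i).
  by have [->|->] := ind01 n w; nra.
- exact: cvg_cst.
- by rewrite -[X in _ --> X](mulr0 0); apply: cvgM; exact: ew.
Unshelve. all: end_near. Qed.

(** The contraction of n err_n has rate 2 rho - 1 - k = 3 k. Linearising the exponential keeps 3 k /
    2 and q takes at most k / 2, which leaves k. The terms in [var] and [err_e] add at most k b / 2
    each, so b is the fixed point. *)
Lemma nerr_le (k M b : R) : 0 < k -> 2 * rho - 1 = 4 * k -> 0 < b -> 0 <= M ->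
  (\forall n \near \oo, n%:R * var n <= M) ->
  4 * d%:R * delta * (1 + k^-1) <= k / 2 ->
  4 * d%:R * delta * (1 + k^-1) * M <= k * b / 2 ->
  forall e', 0 < e' -> \forall n \near \oo, n%:R * err n <= b + e'.
Proof.
move=> k0 rk b0 M0 nvar c1 c2; have kb : 0 < k * b / 4 by rewrite !mulr_gt0// invr_gt0.
have err_e_le : \forall n \near \oo, err_e n <= k * b / 4.
  have /cvgr0Pnorm_le/(_ _ kb) := err_e_cvg0.
  by apply: filterS => n; exact: le_trans (ler_norm _).
apply: (recursion_le k0); near=> n.
have n0 : (0 < n)%N by near: n; exists 1%N.
have np : 0 < n%:R :> R by rewrite ltr0n.
have hn : hmax <= n%:R by near: n; exact: nbhs_infty_ger.
have mn : (m <= n)%N by near: n; exact: nbhs_infty_ge.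
have k3 : 3 * k / n%:R <= 2^-1 by near: n; apply: near_le_div; rewrite invr_gt0.
have rx1 : rho / n%:R <= 1 by near: n; exact: near_le_div.
have nv : n%:R * var n <= M by near: n.
have ee : err_e n <= k * b / 4 by near: n.
have [x xE] : {x : R | x = n%:R^-1} by exists n%:R^-1.
have x0 : 0 < x by rewrite xE invr_gt0.
have x1 : x <= 1 by rewrite xE invf_le1// ler1n.
have nx : n%:R * x = 1 by rewrite xE mulfV// gt_eqF.
have E := err_step mn k0 hn xE; rewrite -xE in k3 rx1 *.
have -> : n.+1%:R = n%:R * (1 + x) by rewrite mulrDr nx mulr1 natr1.
set c := 4 * d%:R * delta * (1 + k^-1) in c1 c2.
have c0 : 0 <= c by rewrite !mulr_ge0 ?(ltW delta_gt0)// addr_ge0// invr_ge0 ltW.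
(* Since x <= 1, both 1 + x <= 2 and x^2 <= x; this is the origin of the constant 4 d delta (1 +
   1/k). *)
have cx : (1 + x) * ((x ^+ 2 + x / k) * (2 * d%:R * delta)) <= c * x.
  have t0 : 0 <= 2 * d%:R * delta by rewrite !mulr_ge0 ?(ltW delta_gt0).
  have -> : c * x = 2 * (x + x / k) * (2 * d%:R * delta) by rewrite /c; ring.
  rewrite mulrA ler_wpM2r// ler_pM//.
  - by rewrite addr_ge0// ltW.
  - by rewrite addr_ge0 ?sqr_ge0// divr_ge0// ltW.
  - by rewrite (_ : 2 = 1 + 1 :> R)// lerD2l.
  - by rewrite lerD2r expr2 ler_piMr// ltW.
have ax : (1 + x) * ((1 + k * x) * (1 - rho * x) ^+ 2) <= 1 - 3 * k * x / 2.
  apply: (@le_trans _ _ (expR (- (3 * k * x)))); last first.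
    by apply: expRN_le_half; rewrite k3 andbT !mulr_ge0// ltW.
  have -> : - (3 * k * x) = x + (k * x + (- (rho * x) + - (rho * x))).
    by rewrite (_ : k = (2 * rho - 1) / 4); [field|rewrite rk; field].
  have kx : 0 <= k * x by rewrite mulr_ge0// ltW.
  have r0 : 0 <= 1 - rho * x by rewrite subr_ge0.
  rewrite !expRD expr2; apply: ler_pM; rewrite ?expR_ge1Dx//.
  - by rewrite addr_ge0// ltW.
  - by rewrite !mulr_ge0// addr_ge0.
  apply: ler_pM; rewrite ?expR_ge1Dx ?(addr_ge0 ler01 kx) ?(mulr_ge0 r0 r0)//.
  by apply: ler_pM; rewrite ?expR_ge1Dx.
set al := (1 + k * x) * _ in E ax; set be := _ * (2 * d%:R * delta) in E cx.
have be0 : 0 <= be.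
  by rewrite !mulr_ge0 ?(ltW delta_gt0)// addr_ge0 ?sqr_ge0// divr_ge0// ltW.
have x10 : 0 <= 1 + x by rewrite addr_ge0// ltW.
have V0 := err_ge0 n; have W0 := var_ge0 n; have F0 := err_e_ge0 n.
apply: (@le_trans _ _ (n%:R * (1 + x) * ((al + be) * err n + be * var n + x ^+ 2 * err_e n))).
  by rewrite ler_wpM2l// mulr_ge0// addr_ge0// ltW.
have -> : n%:R * (1 + x) * ((al + be) * err n + be * var n + x ^+ 2 * err_e n) =
  ((1 + x) * al + (1 + x) * be) * (n%:R * err n) + ((1 + x) * be) * (n%:R * var n) +
  (n%:R * x) * (1 + x) * (x * err_e n) by ring.
rewrite nx mul1r.
have VV : 0 <= n%:R * err n by rewrite mulr_ge0.
have t1 : ((1 + x) * al + (1 + x) * be) * (n%:R * err n) <= (1 - k * x) * (n%:R * err n).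
  rewrite ler_wpM2r//; have : c * x <= k / 2 * x by rewrite ler_wpM2r// ltW.
  by clearbody al be c; lra.
have t2 : ((1 + x) * be) * (n%:R * var n) <= (k * b / 2) * x.
  apply: (@le_trans _ _ (c * x * M)).
    apply: ler_pM => //; last by rewrite mulr_ge0.
    by rewrite mulr_ge0.
  by rewrite mulrAC ler_wpM2r// ltW.
have t3 : (1 + x) * (x * err_e n) <= (k * b / 2) * x.
  have : (1 + x) * (x * err_e n) <= 2 * (x * (k * b / 4)).
    apply: ler_pM; rewrite ?addr_ge0 ?mulr_ge0 ?(ltW x0)//.
      by rewrite (_ : 2 = 1 + 1 :> R)// lerD2l.
    by rewrite ler_wpM2l// ltW.
  by lra.
by lra.
Unshelve. all: end_near. Qed.

Lemma measurable_near0 n : (0 < n)%N -> measurable (near0 n).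
Proof.
move=> n0; apply: (measurable_hist N0 sqX0 sqX1 noise n0).
have := near0_hist n0; rewrite /measurable/= sigma_algebra_id//.
exact: sigma_algebra_hist.
Qed.

Lemma measurable_stay n : (0 < n)%N -> measurable (stay n).
Proof.
move=> n0; apply: (measurable_hist N0 sqX0 sqX1 noise n0).
have := stay_hist n0; rewrite /measurable/= sigma_algebra_id//.
exact: sigma_algebra_hist.
Qed.

Let bDT n i : (m <= n)%N -> bmeas (fun w => ind n w * D n w i).
Proof.
move=> mn; have n0 : (0 < n)%N by exact: leq_trans mn.
by apply: (histT_bmeas N0 sqX0 sqX1 noise n0); exact: bD.
Qed.

Lemma measurable_far eta n : (0 < n)%N -> measurable (far eta n).
Proof.
move=> n0; apply: measurable_exists_gt => i.
apply: measurable_funM => //; apply: measurableT_comp => //.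
apply: (histT_measurable_fun N0 sqX0 sqX1 noise n0).
by apply: measurable_funB; [exact: my|exact: (linproc_bmeas _ _ _ n0).1].
Qed.

(** Chebyshev's inequality on [stay], where the indicator equals 1. *)
Lemma prob_far_le (eta : R) n : 0 < eta -> (m <= n)%N ->
  fine (P (far eta n)) <= fine (P (~` stay n)) + n%:R * err n / eta ^+ 2.
Proof.
move=> eta0 mn; have n0 : (0 < n)%N by exact: leq_trans mn.
have mfar := measurable_far eta n0.
have mstay := measurable_stay n0.
have e2 : 0 < eta ^+ 2 by rewrite exprn_gt0.
rewrite -!Ex_indic//; last exact: measurableC.
have bS : bmeas (fun w => \sum_i (ind n w * D n w i) ^+ 2).
  by apply: bmeas_sum => i; under eq_fun do rewrite expr2; apply: bmeasM; exact: bDT.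
rewrite mulrAC -ExZ// -ExD; [|by apply: bmeas_indic; exact: measurableC|exact: bmeasZ].
apply: Ex_le; first exact: bmeas_indic.
  by apply: bmeasD; [apply: bmeas_indic; exact: measurableC|exact: bmeasZ].
move=> w; have S0 : 0 <= \sum_i (ind n w * D n w i) ^+ 2.
  by apply: sumr_ge0 => i _; exact: sqr_ge0.
have T0 : 0 <= n%:R / eta ^+ 2 * (\sum_i (ind n w * D n w i) ^+ 2).
  by rewrite !mulr_ge0// invr_ge0 ltW.
rewrite [\1_(far _ _) _]indicE; have [wf|wf] := boolP (w \in _); last first.
  by rewrite addr_ge0// indicE.
rewrite [\1_(~` _) _]indicE in_setC; have [ws|ws] := boolP (w \in stay n); last first.
  by rewrite /= lerDl.
rewrite /= add0r; move/set_mem : wf => [i].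
rewrite mulrAC ler_pdivlMr// mul1r => iw.
apply: (@le_trans _ _ (n%:R * (ind n w * D n w i) ^+ 2)); last first.
  rewrite ler_wpM2l// (bigD1 i)//= lerDl; apply: sumr_ge0 => j _; exact: sqr_ge0.
rewrite /ind indicE ws mul1r -(@sqr_sqrtr _ n%:R)// -exprMn.
rewrite -[leRHS](@real_normK _ _ (num_real _)) normrM (ger0_norm (sqrtr_ge0 _)).
rewrite ler_pXn2r ?nnegrE ?ltW//.
by apply: (lt_trans eta0).
Qed.

End localized.

Lemma prob_far_cvg0 (eta : R) : 0 < eta -> fine (P (far eta n)) @[n --> \oo] --> 0.
Proof.
move=> eta0; apply/cvgr0Pnorm_le => c c0.
have e2 : 0 < eta ^+ 2 by rewrite exprn_gt0.
have [M M0 nvar] := var_bounded.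
pose k := (2 * rho - 1) / 4; have k0 : 0 < k by rewrite /k; have := rho_gt; lra.
(* [nerr_le] will give n err_n <= 2 b, and 2 b / eta^2 is c / 2, half of the tolerance. *)
pose b := c * eta ^+ 2 / 4; have b0 : 0 < b by rewrite divr_gt0// mulr_gt0.
(* Serves both smallness conditions of [nerr_le]: c' <= k / 2 and c' M <= k b / 2. As M concerns L
   alone, delta, then eps, can be fixed before m. *)
pose c' := k / 2 * (b / (b + M + 1)).
have bM : 0 < b + M + 1 by lra.
have c'0 : 0 < c'.
  by apply: mulr_gt0 (divr_gt0 b0 bM); exact: (divr_gt0 k0).
have kk : 0 < 4 * d%:R * (1 + k^-1) by rewrite !mulr_gt0// ?ltr0n// addr_gt0// invr_gt0.
pose delta := c' / (4 * d%:R * (1 + k^-1)).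
have delta0 : 0 < delta by rewrite divr_gt0.
have cE : 4 * d%:R * delta * (1 + k^-1) = c'.
  by rewrite /delta -[RHS](divfK (lt0r_neq0 kk)); ring.
have [eps eps0 q_le] := q_small delta0.
(* Times are shifted by one because measurability of [near0] is established at positive times. *)
have mnear n : measurable (near0 eps n.+1) by exact: measurable_near0.
have near_oo : {ae P, forall w, \forall n \near \oo, near0 eps n.+1 w}.
  apply: filterS2 y_cvg0 e_cvg0 => w yw ew.
  have : \forall n \near \oo, near0 eps n w.
    near=> n; split.
      near: n; apply: filter_forall => i.
      by have /cvgr0Pnorm_le/(_ _ eps0) := yw i.
    near: n; apply: filter_forall => u; apply: filter_forall => i.
    by have /cvgr0Pnorm_le/(_ _ ltr01) := ew u i.
  by move=> [m _ Hm]; exists m => // n /= mn; apply: Hm; exact: leqW.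
have c2 : 0 < c / 2 by rewrite divr_gt0.
have /cvgr0Pnorm_le/(_ _ c2)[m _ Hm] := prob_tail_cvg0 mnear near_oo.
have := Hm m (leqnn m) => {}Hm; rewrite /= in Hm.
have k2 : 0 <= k / 2 by rewrite divr_ge0// ltW.
have rk : 2 * rho - 1 = 4 * k by rewrite /k; field.
have H1 : 4 * d%:R * delta * (1 + k^-1) <= k / 2.
  rewrite cE; apply: ler_piMr => //.
  by rewrite ler_pdivrMr// mul1r; lra.
have H2 : 4 * d%:R * delta * (1 + k^-1) * M <= k * b / 2.
  rewrite cE /c' (_ : k * b / 2 = k / 2 * b); last by field.
  rewrite -mulrA ler_wpM2l//.
  by rewrite mulrAC ler_pdivrMr// ler_wpM2l ?(ltW b0)//; lra.
have := nerr_le eps0 delta0 (ltn0Sn m) q_le k0 rk b0 M0 nvar H1 H2 b0.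
apply: filter_app; near=> n => H3.
have mn : (m.+1 <= n)%N by near: n; exact: nbhs_infty_ge.
rewrite ger0_norm ?fine_ge0//.
have PF := (prob_far_le eps0 (ltn0Sn m) eta0 mn).
apply: (le_trans PF).
have -> : c = c / 2 + c / 2 by field.
apply: lerD; last first.
  rewrite ler_pdivrMr//; apply: le_trans H3 _.
  by rewrite /b le_eqVlt; apply/orP; left; apply/eqP; field.
apply: le_trans Hm; apply: le_trans (ler_norm _).
have n0 : (0 < n)%N by exact: leq_trans mn.
have ms : measurable (~` stay eps m.+1 n) by apply: measurableC; exact: measurable_stay.
have mt : measurable (\bigcup_(n0 in [set n0 | (m <= n0)%N]) ~` near0 eps n0.+1).
  by apply: bigcup_measurable => j _; exact: measurableC.
apply: fine_le; rewrite ?fin_num_measure//.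
apply: le_measure; rewrite ?inE//.
move=> w /existsNP[[|j]]; first by move=> /not_implyP[].
by move=> /not_implyP[/andP[mj _]] jw; exists j.
Unshelve. all: end_near. Qed.
Let my_T n i : (0 < n)%N -> measurable_fun setT (fun w => y n w ord0 i).
Proof. by move=> n0; exact: (histT_measurable_fun N0 sqX0 sqX1 noise n0 (my i n0)). Qed.

Let mL_T n i : (0 < n)%N -> bmeas (fun w => L n w ord0 i).
Proof.
by move=> n0; exact: (histT_bmeas N0 sqX0 sqX1 noise n0 (linproc_bmeas z h i n0)).
Qed.

(** Comparison with [linproc_clt]: off [far] the two cosines differ by at most |t|_1 eta since cos
    is Lipschitz, and on it by at most 2. *)
Lemma perturbed_clt t (a : R) :
  Ex P (fun w => cos (Num.sqrt n%:R * dotv t (y n w) + a)) @[n --> \oo] -->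
  cos a * expR (- (\sum_i \sum_j t ord0 i * t ord0 j *
                     (noise_cov z i j / (h i + h j - 1))) / 2).
Proof.
have G := linproc_clt (t := t) (a := a) N0 d0 sqX0 sqX1 noise z_sum0 rho_gt h_bnd.
apply: cvg_sub0 G; rewrite /=; apply/cvgr0Pnorm_le => c c0.
pose eta := c / 2 / (norm1 t + 1).
have t0 : 0 <= norm1 t by apply: sumr_ge0.
have t1 : 0 < norm1 t + 1 by rewrite ltr_wpDl.
have eta0 : 0 < eta by rewrite !divr_gt0.
have c4 : 0 < c / 4 by rewrite divr_gt0.
have /cvgr0Pnorm_le/(_ _ c4) := prob_far_cvg0 eta0.
apply: filter_app; near=> n => Hfar.
have n0 : (0 < n)%N by near: n; exists 1%N.
have mfar := measurable_far eta n0.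
have bA : bmeas (fun w => cos (Num.sqrt n%:R * dotv t (y n w) + a)).
  apply: bmeas_cos; apply: measurable_funD => //; apply: measurable_funM => //.
  by apply: measurable_sum => i; apply: measurable_funM => //; exact: my_T.
have bB : bmeas (fun w => cos (Num.sqrt n%:R * dotv t (L n w) + a)).
  apply: bmeas_cos; apply: measurable_funD => //; apply: measurable_funM => //.
  by apply: measurable_sum => i; apply: measurable_funM => //; exact: (mL_T i n0).1.
have bi : bmeas (\1_(far eta n) : T -> R) by exact: bmeas_indic.
rewrite [X in `|X|](_ : _ = Ex P (fun w => cos (Num.sqrt n%:R * dotv t (y n w) + a) -
   cos (Num.sqrt n%:R * dotv t (L n w) + a))); last by rewrite ExB.
apply: le_trans (Ex_norm P (bmeasB bA bB)) _.
apply: (@le_trans _ _ (Ex P (fun w => norm1 t * eta + 2 * \1_(far eta n) w))); last first.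
  rewrite (ExD P (bmeas_cst T _) (bmeasZ 2 bi)) Ex_cst ExZ// Ex_indic//.
  have -> : c = c / 2 + c / 2 by field.
  apply: lerD.
    rewrite /eta mulrA ler_pdivrMr// mulrC ler_wpM2l ?lerDl//.
    by rewrite divr_ge0// ltW.
  rewrite (_ : c / 2 = 2 * (c / 4)); last by field.
  by rewrite ler_wpM2l// (le_trans (ler_norm _)).
apply: Ex_le.
- by apply: bmeas_norm; exact: bmeasB.
- exact: bmeasD (bmeas_cst T _) (bmeasZ 2 bi).
move=> w; rewrite indicE; have [wf|wf] := boolP (w \in _).
  rewrite mulr1 (le_trans (ler_normB _ _))// ler_wpDl//; first exact: mulr_ge0 t0 (ltW eta0).
  by rewrite (_ : 2 = 1 + 1 :> R)// lerD// ler_norml cos_geN1 cos_le1.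
rewrite mulr0 addr0; apply: le_trans (cos_lipschitz _ _) _.
rewrite [X in `|X|](_ : _ = \sum_i t ord0 i * (Num.sqrt n%:R * D n w i)); last first.
  rewrite /dotv opprD addrACA subrr addr0 -mulrBr -sumrB mulr_sumr.
  by apply: eq_bigr => i _; rewrite /D; ring.
apply: le_trans (ler_norm_sum _ _ _) _; rewrite /norm1 mulr_suml; apply: ler_sum => i _.
rewrite normrM ler_wpM2l// normrM (ger0_norm (sqrtr_ge0 _)) leNgt; apply/negP => H.
by move/negP: wf; apply; rewrite inE; exists i.
Unshelve. all: end_near. Qed.

Lemma perturbed_tight (c : R) : 0 < c -> exists K : R, \forall n \near \oo,
  fine (P [set w | exists i, K < Num.sqrt n%:R * `|y n w ord0 i|]) <= c.
Proof.
move=> c0; have [M M0 nvar] := var_bounded.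
have c2 : 0 < c / 2 by rewrite divr_gt0.
(* Ensures s >= 1 and M / s <= c / 2, hence M / s^2 <= c / 2. *)
pose s := 1 + 2 * M / c.
have s1 : 1 <= s by rewrite lerDl divr_ge0 ?mulr_ge0// ltW.
have sM : M / s ^+ 2 <= c / 2.
  rewrite ler_pdivrMr; last by rewrite exprn_gt0// (lt_le_trans ltr01).
  apply: (@le_trans _ _ (c / 2 * s)); last first.
    by rewrite ler_wpM2l// ?(ltW c2)// expr2 ler_peMr// (le_trans ler01).
  rewrite /s mulrDr mulr1 (_ : c / 2 * (2 * M / c) = M); last by field; rewrite gt_eqF.
  by rewrite lerDr ltW.
(* The extra 1 covers sqrt n |y - L| off [far 1]; there sqrt n |L| must reach s, and Chebyshev's
   inequality applies to L. *)
clearbody s; exists (s + 1); have /cvgr0Pnorm_le/(_ _ c2) := prob_far_cvg0 (@ltr01 R).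
move: nvar; apply: filter_app2; near=> n => nvar Hfar.
have n0 : (0 < n)%N by near: n; exists 1%N.
have mfar := measurable_far 1 n0.
have mE : measurable [set w | exists i, s + 1 < Num.sqrt n%:R * `|y n w ord0 i|].
  apply: measurable_exists_gt => i.
  by apply: measurable_funM => //; apply: measurableT_comp => //; exact: my_T.
have bi : bmeas (\1_(far 1 n) : T -> R) by exact: bmeas_indic.
have bS : bmeas (fun w => \sum_i L n w ord0 i ^+ 2).
  by apply: bmeas_sum => i; under eq_fun do rewrite expr2; apply: bmeasM; exact: mL_T.
rewrite -Ex_indic//.
apply: (@le_trans _ _ (Ex P (fun w => \1_(far 1 n) w + n%:R / s ^+ 2 * \sum_i L n w ord0 i ^+ 2))).
  apply: Ex_le; [exact: bmeas_indic|by apply: bmeasD => //; exact: bmeasZ|move=> w].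
  have S0 : 0 <= \sum_i L n w ord0 i ^+ 2 by apply: sumr_ge0 => i _; exact: sqr_ge0.
  have T0 : 0 <= n%:R / s ^+ 2 * (\sum_i L n w ord0 i ^+ 2).
    by rewrite !mulr_ge0// invr_ge0 sqr_ge0.
  rewrite !indicE; have [we|we] := boolP (w \in _); last by rewrite addr_ge0.
  have [wf|wf] := boolP (w \in far 1 n); first by rewrite lerDl.
  rewrite /= add0r; move/set_mem : we => [i iw].
  have h1 : Num.sqrt n%:R * `|D n w i| <= 1.
    rewrite leNgt; apply/negP => H.
    by move/negP: wf; apply; rewrite inE; exists i.
  have h2 : s <= Num.sqrt n%:R * `|L n w ord0 i|.
    have : `|y n w ord0 i| <= `|D n w i| + `|L n w ord0 i|.
      by rewrite -[X in `|X| <= _](subrK (L n w ord0 i)) ler_normD.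
    move=> /(ler_wpM2l (sqrtr_ge0 n%:R)); rewrite mulrDr => h3.
    by have := lt_le_trans iw h3; lra.
  have s0 : 0 <= s by exact: le_trans s1.
  rewrite mulrAC ler_pdivlMr ?mul1r ?exprn_gt0 ?(lt_le_trans ltr01)//.
  apply: (@le_trans _ _ (n%:R * L n w ord0 i ^+ 2)).
    rewrite -(@sqr_sqrtr _ n%:R)// -exprMn.
    rewrite -[leRHS](@real_normK _ _ (num_real _)) normrM (ger0_norm (sqrtr_ge0 _)).
    by rewrite ler_pXn2r ?nnegrE// (le_trans s0).
  rewrite ler_wpM2l// (bigD1 i)//= lerDl; apply: sumr_ge0 => j _; exact: sqr_ge0.
rewrite (ExD P bi (bmeasZ _ bS)) Ex_indic// ExZ//.
have -> : c = c / 2 + c / 2 by field.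
apply: lerD; first exact: le_trans (ler_norm _) Hfar.
apply: le_trans sM; rewrite mulrAC ler_wpM2r ?invr_ge0 ?sqr_ge0//.
Unshelve. all: end_near. Qed.

End perturbed_linear_process.

(** * The Hessian and the limit covariance *)

Section spectral_theorem.
Import mxpoly mxred spectral sesquilinear complex.

(** The Hermitian spectral theorem diagonalises H over the complex numbers with real spectrum; real
    matrices that are similar over C are similar over R, which yields a real Q. *)
Lemma sym_diagonalizable (R : rcfType) (d : nat) (H : 'M[R]_d) : H^T = H ->
  exists Q : 'M[R]_d, exists2 h : 'rV[R]_d,
    Q \in unitmx & H = invmx Q *m diag_mx h *m Q.
Proof.
move=> Hsym; pose toC : {rmorphism R -> R[i]} := real_complex R.
pose Hc := map_mx toC H.
have real_toC m n (M : 'M[R]_(m, n)) : map_mx toC M \is a realmx.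
  apply/mxOverP => i j; rewrite mxE; apply/CrealP.
  by apply/eqP; rewrite eq_complex/= oppr0 !eqxx.
have ofC m n (M : 'M[R[i]]_(m, n)) : M \is a realmx -> map_mx toC (map_mx (@Re R) M) = M.
  move=> /mxOverP Mr; apply/matrixP => i j; rewrite !mxE.
  exact: RRe_real (Mr i j).
have Hherm : Hc \is hermsymmx.
  apply: (realsym_hermsym _ (real_toC _ _ H)); rewrite qualifE/=; apply/eqP.
  by rewrite expr0 scale1r map_mx_id// /Hc map_trmx Hsym.
have /hermitian_normalmx/orthomx_spectralP Heq := Hherm.
have Dreal := hermitian_spectral_diag_real Hherm.
have [P /andP[Preal Punit] /eqP PH] : exists2 P : 'M[R[i]]_d, P \in [predI realmx & unitmx] &
    conjmx P Hc == diag_mx (spectral_diag Hc).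
  apply: real_similar => //.
    exists (spectralmx Hc); first exact: spectral_unit.
    rewrite /similar_to/= conjumx ?spectral_unit// {2}Heq.
    by rewrite !mulmxA mulmxV ?spectral_unit// mul1mx mulmxK ?spectral_unit.
    exact: real_toC.
  by rewrite -[spectral_diag Hc]ofC// -map_diag_mx; exact: real_toC.
exists (map_mx (@Re R) P); exists (map_mx (@Re R) (spectral_diag Hc)).
  by rewrite -(map_unitmx toC) ofC.
apply: (map_mx_inj (f := toC)).
rewrite !map_mxM/= map_invmx map_diag_mx/= !ofC// -PH conjumx//.
by rewrite !mulmxA mulVmx// mul1mx mulmxKV.
Qed.

End spectral_theorem.

(** Row i of Q is a left eigenvector, the kind that [eigenvalue] refers to. *)
Lemma diag_eigenvalue (F : fieldType) (d : nat) (H Q : 'M[F]_d) (h : 'rV[F]_d) i :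
  Q \in unitmx -> H = invmx Q *m diag_mx h *m Q -> eigenvalue H (h ord0 i).
Proof.
move=> uQ HE; apply/eigenvalueP; exists (row i Q).
  rewrite -row_mul HE !mulmxA mulmxV// mul1mx; apply/rowP => j.
  by rewrite !mxE (bigD1 i)//= big1 ?addr0 => [|k ki]; rewrite !mxE ?eqxx//
    eq_sym (negPf ki) mulr0n mul0r.
apply/eqP => r0; have : (row i Q *m invmx Q) ord0 i = 1.
  by rewrite -row_mul mulmxV// !mxE eqxx.
by rewrite r0 mul0mx mxE => /eqP; rewrite eq_sym oner_eq0.
Qed.

Lemma expmx_diag (R : realType) (d : nat) (Q : 'M[R]_d) (c : 'rV[R]_d) i j :
  Q \in unitmx ->
  expmx (invmx Q *m diag_mx c *m Q) i j =
  \sum_k invmx Q i k * expR (c ord0 k) * Q k j.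
Proof.
move=> uQ; set M := invmx Q *m _ *m Q.
have MX n : M ^+ n = invmx Q *m diag_mx (\row_k (c ord0 k ^+ n)) *m Q.
  elim: n => [|n IH].
    rewrite expr0 (_ : diag_mx _ = 1%:M) ?mulmx1 ?mulVmx//.
    by apply/matrixP => a b; rewrite !mxE expr0.
  rewrite exprS IH /M; rewrite -[LHS]/(_ *m _) -!mulmxA [Q *m (invmx Q *m _)]mulmxA mulmxV// mul1mx.
  congr (_ *m _); rewrite !mulmxA; congr (_ *m _); apply/matrixP => a b.
  by rewrite mul_diag_mx !mxE exprS mulrnAr.
rewrite mxE; have -> : (fun n : nat => \sum_(k < n) (M ^+ k) i j / (k`!)%:R) =
  (fun n => \sum_k invmx Q i k * (series (exp_coeff (c ord0 k)) n) * Q k j) :> (nat -> R).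
  apply/funext => n; under eq_bigr => m _.
    rewrite MX mxE mulr_suml.
    under eq_bigr => k _ do rewrite mul_mx_diag !mxE.
    over.
  rewrite exchange_big/=; apply: eq_bigr => k _.
  rewrite /series/= big_mkord mulr_sumr mulr_suml; apply: eq_bigr => m _.
  by rewrite /exp_coeff/=; ring.
apply/cvg_lim => //; apply: cvgr_sum => k.
apply: cvgM; last exact: cvg_cst.
apply: cvgM; first exact: cvg_cst.
exact: is_cvg_series_exp_coeff.
Qed.

Lemma Rintegral_sum d (T : measurableType d) (R : realType)
    (mu : {measure set T -> \bar R}) (D : set T) (I : Type) (s : seq I) (f : I -> T -> R) :
  measurable D -> (forall i, mu.-integrable D (EFin \o f i)) ->
  mu.-integrable D (EFin \o (fun x => \sum_(i <- s) f i x)) /\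
  Rintegral mu D (fun x => \sum_(i <- s) f i x) = \sum_(i <- s) Rintegral mu D (f i).
Proof.
move=> mD fi; elim: s => [|i s [IH1 IH2]].
  under [X in EFin \o X]funext do rewrite big_nil.
  rewrite big_nil; under eq_Rintegral do rewrite big_nil.
  by rewrite /Rintegral integral0; split => //; exact: integrable0.
under [X in EFin \o X]funext do rewrite big_cons.
rewrite big_cons -IH2; under eq_Rintegral do rewrite big_cons.
split; last by rewrite RintegralD.
exact: (integrableD mD (fi i) IH1).
Qed.

Lemma expRN_integral (R : realType) (c : R) : 0 < c ->
  (@lebesgue_measure R).-integrable `[0, +oo[ (EFin \o (fun u : R => expR (- c * u))) /\
  Rintegral (@lebesgue_measure R) `[0, +oo[ (fun u => expR (- c * u)) = c^-1.
Proof.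
move=> c0; set D := `[0, +oo[%classic; set mu := @lebesgue_measure R.
have mD : measurable (D : set (measurableTypeR R)) by exact: measurable_itv.
have E u : D u -> expR (- c * u) = c^-1 * exponential_pdf c u.
  by rewrite /D/= in_itv/= andbT => u0; rewrite exponential_pdfE// mulKf// gt_eqF.
have I1 : mu.-integrable D (EFin \o exponential_pdf c).
  by apply: (@integrableS _ _ _ mu setT) => //; exact: integrable_exponential_pdf.
have I2 : mu.-integrable D (EFin \o (fun u : R => expR (- c * u))).
  apply: (@eq_integrable _ _ _ mu D mD (fun u => (c^-1)%:E * (exponential_pdf c u)%:E)%E).
    by move=> u /set_mem Du; rewrite /= E.
  exact: integrableZl.
split => //; transitivity (Rintegral mu D (fun u => c^-1 * exponential_pdf c u)).
  by apply: eq_Rintegral => u /set_mem Du; rewrite E.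
rewrite RintegralZl// (_ : Rintegral _ _ _ = 1) ?mulr1//.
rewrite /Rintegral integral_mkcond (_ : _ \_ D = EFin \o exponential_pdf c).
  by rewrite integral_exponential_pdf.
apply/funext => u; rewrite /restrict; case: ifPn => // uD.
rewrite /= lt0_exponential_pdf//; move: uD; rewrite notin_setE /D/= in_itv/= andbT.
by move=> /negP; rewrite -ltNge.
Qed.

(** In the coordinates of Q the integrand has entries W_kl exp (- (h_k + h_l - 1) u), the halves
    subtracted from h_k and h_l adding up to 1, and each exponential integrates to 1 / (h_k + h_l -
    1). *)
Lemma Sigma_mx_diag (R : realType) (d : nat) (lam : R) (H G Q : 'M[R]_d) (h : 'rV[R]_d) :
  Q \in unitmx -> H = invmx Q *m diag_mx h *m Q -> (forall i, 2^-1 < h ord0 i) ->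
  let W := (invmx Q)^T *m G *m invmx Q in
  Sigma_mx lam H G =
  Q^T *m (\matrix_(k, l) ((1 - lam) ^+ 2 * W k l / (h ord0 k + h ord0 l - 1))) *m Q.
Proof.
move=> uQ HE hgt W; rewrite /Sigma_mx; set D := `[0%R, +oo[%classic; set mu := @lebesgue_measure R.
have mD : measurable (D : set (measurableTypeR R)) by exact: measurable_itv.
pose e (u : R) := \row_k expR (- (u * (h ord0 k - 2^-1))).
have expE u : expmx (- (u *: (H - (2%:R^-1)%:M))) = invmx Q *m diag_mx (e u) *m Q.
  have -> : - (u *: (H - (2%:R^-1)%:M)) =
     invmx Q *m diag_mx (\row_k (- (u * (h ord0 k - 2^-1)))) *m Q.
    rewrite (_ : diag_mx _ = - (u *: (diag_mx h - (2%:R^-1)%:M))); last first.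
      apply/matrixP => a b; rewrite !mxE; case: (a == b); first by rewrite !mulr1n.
      by rewrite !mulr0n subrr mulr0 oppr0.
    rewrite mulmxN mulNmx -scalemxAr -scalemxAl mulmxBr mulmxBl -HE.
    by rewrite scalar_mxC -mulmxA mulVmx// mulmx1.
  apply/matrixP => i j; rewrite expmx_diag// mxE; apply: eq_bigr => k _.
  by rewrite mul_mx_diag !mxE.
have c0 k l : 0 < h ord0 k + h ord0 l - 1 by have := hgt k; have := hgt l; lra.
apply/matrixP => i j; rewrite mxE [in LHS]mxE.
have -> : (fun u : R => (((expmx (- (u *: (H - (2%:R^-1)%:M))))^T *m G
    *m expmx (- (u *: (H - (2%:R^-1)%:M)))) i j)) =
  (fun u => \sum_k \sum_l (Q k i * W k l * Q l j) * expR (- (h ord0 k + h ord0 l - 1) * u)).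
  apply/funext => u; rewrite expE.
  have -> : (invmx Q *m diag_mx (e u) *m Q)^T *m G *m (invmx Q *m diag_mx (e u) *m Q) =
     Q^T *m (diag_mx (e u) *m W *m diag_mx (e u)) *m Q.
    by rewrite !trmx_mul tr_diag_mx /W !mulmxA.
  rewrite mxE; under eq_bigr => l _ do rewrite mxE mulr_suml.
  rewrite exchange_big/=; apply: eq_bigr => k _; apply: eq_bigr => l _.
  rewrite mul_mx_diag mxE mul_diag_mx !mxE.
  rewrite (_ : - (_ + _ - 1) * u = - (u * (h ord0 k - 2^-1)) + - (u * (h ord0 l - 2^-1))).
    by rewrite expRD; ring.
  by field.
have Ikl k l : mu.-integrable D (EFin \o (fun u : R => (Q k i * W k l * Q l j) * expR (- (h ord0 k + h ord0 l - 1) * u))).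
  have [I1 _] := expRN_integral (c0 k l).
  apply: (@eq_integrable _ _ _ mu D mD (fun u => (Q k i * W k l * Q l j)%:E *
      (expR (- (h ord0 k + h ord0 l - 1) * u))%:E)%E) => //.
  exact: integrableZl.
have [_ ->] := Rintegral_sum (index_enum 'I_d) mD
  (fun k => (Rintegral_sum (index_enum 'I_d) mD (fun l => Ikl k l)).1).
rewrite mulr_sumr mxE.
under [in RHS]eq_bigr => l _ do rewrite mxE mulr_suml.
rewrite exchange_big/=; apply: eq_bigr => k _.
have [_ ->] := Rintegral_sum (index_enum 'I_d) mD (fun l => Ikl k l).
rewrite mulr_sumr; apply: eq_bigr => l _.
have [I1 I2] := expRN_integral (c0 k l).
by rewrite RintegralZl// I2 !mxE; ring.
Qed.

Lemma differentiable_bound (R : realType) (V : normedModType R) (g : V -> R) (a : V) (c : R) :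
  differentiable g a -> 0 < c ->
  exists2 r : R, 0 < r & forall h : V, `|h| < r ->
    `|g (a + h) - g a - 'd g a h| <= c * `|h|.
Proof.
move=> dg c0; have H := diff_locallyxC dg.
have B : forall x y z : R, x + y + z - x - y = z by move=> *; ring.
have lin : \forall h \near (0 : V), `|g (a + h) - g a - 'd g a h| <= c * `|h|.
  near=> h; rewrite H B; near: h; exact: littleoP.
have /nbhs_normP[r r0 Hr] := lin; exists r => // h hr; apply: Hr.
by rewrite /ball_/= sub0r normrN.
Unshelve. all: end_near. Qed.

(** * Symmetry of mixed derivatives under differentiability at one point *)

Section mixed_derivatives.
Context {R : realType} {V : normedModType R}.
Implicit Types (f : V -> R) (a u v : V).

Lemma is_derive_line f a u (t : R) : derivable f (a + t *: u) u ->
  is_derive t (1 : R) (fun t => f (a + t *: u)) ('D_u f (a + t *: u)).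
Proof.
move=> df.
have E : (fun h : R => h^-1 *: (f (a + (h *: (1 : R) + t) *: u) - f (a + t *: u))) =
         (fun h : R => h^-1 *: (f (h *: u + (a + t *: u)) - f (a + t *: u))).
  apply/funext => h; congr (_ *: (f _ - _)).
  by rewrite scalerDl addrCA (mulr1 h : h%:A = h).
by apply: DeriveDef; rewrite /derivable/derive /= /shift /= E.
Qed.

(* The second difference is symmetric in u and v, whereas each of its two
   limits is one of the mixed derivatives. *)
Lemma second_difference f a u v : (forall x, derivable f x u) ->
  differentiable ('D_u f) a ->
  forall e : R, 0 < e -> \forall s \near (0 : R)^'+,
  `|f (a + s *: u + s *: v) - f (a + s *: u) - f (a + s *: v) + f a
    - s ^+ 2 * 'D_v ('D_u f) a| <= e * s ^+ 2.
Proof.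
move=> df dg e e0; set g := 'D_u f.
pose c := e / (2 * (`|u| + `|v| + 1)).
have uv0 : 0 < `|u| + `|v| + 1 by rewrite ltr_wpDl// addr_ge0.
have c0 : 0 < c by rewrite divr_gt0// mulr_gt0.
have [r r0 Hr] := differentiable_bound dg c0.
near=> s; have s0 : 0 < s by near: s; exact: nbhs_right_gt.
have sr : s * (`|u| + `|v| + 1) < r.
  rewrite -ltr_pdivlMr//; near: s; apply: nbhs_right_lt; exact: divr_gt0.
(* The mean value theorem in t turns the second difference into a first difference of g, to which
   differentiability at a applies. *)
pose phi t := f (a + s *: v + t *: u) - f (a + t *: u).
have dphi (t : R) : is_derive t (1 : R) phi (g (a + s *: v + t *: u) - g (a + t *: u)).
  by apply: is_deriveB; exact: is_derive_line.
have cphi : {within `[0, s], continuous phi}.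
  apply: derivable_within_continuous => t _; by have [] := dphi t.
have [t] := MVT s0 (fun t _ => dphi t) cphi; rewrite in_itv/= => /andP[t0 ts].
rewrite subr0 /phi scale0r !addr0 => E.
have -> : f (a + s *: u + s *: v) - f (a + s *: u) - f (a + s *: v) + f a =
  (g (a + s *: v + t *: u) - g (a + t *: u)) * s.
  by rewrite -E [a + s *: v + _]addrAC; ring.
have h1 : `|s *: v + t *: u| <= s * (`|u| + `|v|).
  rewrite (le_trans (ler_normD _ _))// !normrZ !gtr0_norm// mulrDr addrC lerD2r.
  by rewrite ler_wpM2r// ltW.
have h2 : `|t *: u| <= s * (`|u| + `|v|).
  rewrite normrZ gtr0_norm// mulrDr ler_wpDr ?mulr_ge0 ?(ltW s0)//.
  by rewrite ler_wpM2r// ltW.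
have hs : s * (`|u| + `|v|) < r.
  by apply: le_lt_trans sr; rewrite ler_wpM2l ?(ltW s0)// lerDl.
have A1 := Hr _ (le_lt_trans h1 hs); have A2 := Hr _ (le_lt_trans h2 hs).
rewrite addrA in A1.
have dE : 'd g a (s *: v + t *: u) = s * 'D_v g a + 'd g a (t *: u).
  by rewrite linearD linearZ/= deriveE.
rewrite dE in A1.
(* Both increments of g are measured from a, so their linear parts along t u cancel. *)
have -> : (g (a + s *: v + t *: u) - g (a + t *: u)) * s - s ^+ 2 * 'D_v g a =
  s * ((g (a + s *: v + t *: u) - g a - (s * 'D_v g a + 'd g a (t *: u)))
   - (g (a + t *: u) - g a - 'd g a (t *: u))) by ring.
rewrite normrM gtr0_norm// expr2 mulrCA ler_wpM2l ?(ltW s0)//.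
apply: le_trans (ler_normB _ _) _.
apply: (@le_trans _ _ (c * (s * (`|u| + `|v|)) + c * (s * (`|u| + `|v|)))).
  by apply: lerD; [apply: le_trans A1 _|apply: le_trans A2 _]; rewrite ler_wpM2l// ltW.
have -> : e * s = c * (s * (`|u| + `|v| + 1)) + c * (s * (`|u| + `|v| + 1)).
  by rewrite /c; field; rewrite gt_eqF.
by apply: lerD; rewrite !ler_wpM2l ?(ltW c0) ?(ltW s0)// lerDl.
Unshelve. all: end_near. Qed.

(** Young's form of Schwarz's theorem: both mixed derivatives approximate the same second difference
    divided by s^2, and no continuity of second derivatives is assumed. *)
Lemma derive_mixedC f a u v : (forall x, derivable f x u) -> (forall x, derivable f x v) ->
  differentiable ('D_u f) a -> differentiable ('D_v f) a ->
  'D_v ('D_u f) a = 'D_u ('D_v f) a.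
Proof.
move=> fu fv du dv; apply/eqP; rewrite -subr_eq0 -normr_le0; apply/ler_addgt0Pr => e e0.
rewrite add0r; have e2 : 0 < e / 2 by rewrite divr_gt0.
have H1 := second_difference v fu du e2; have H2 := second_difference u fv dv e2.
have K (t x y z : R) : 0 < t -> `|z - t * y| <= e / 2 * t -> `|z - t * x| <= e / 2 * t ->
    `|y - x| <= e.
  move=> t0 h1 h2; rewrite -(ler_pM2l t0) -[X in X * `|_|](gtr0_norm t0) -normrM.
  have -> : t * (y - x) = (z - t * x) - (z - t * y) by ring.
  by apply: le_trans (ler_normB _ _) _; lra.
have : \forall s \near (0 : R)^'+, `|'D_v ('D_u f) a - 'D_u ('D_v f) a| <= e.
  move: H1 H2; apply: filter_app2; near=> s => H1 H2.
  have s0 : 0 < s by near: s; exact: nbhs_right_gt.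
  have s2 : 0 < s ^+ 2 by rewrite exprn_gt0.
  move: H1 H2; rewrite [a + s *: v + _]addrAC.
  move: (f _) (f (a + s *: v)) (f (a + s *: u)) (f a) => A B C D.
  move: ('D_u ('D_v f) a) ('D_v ('D_u f) a) => x y.
  have BC : A - B - C + D = A - C - B + D by ring.
  rewrite BC => h1 h2; exact: (K _ _ _ _ s2 h1 h2).
by move=> /filter_ex[].
Unshelve. all: end_near. Qed.

End mixed_derivatives.

Lemma hessian_sym (R : realType) (d : nat) (f : 'rV[R]_d -> R) x :
  (forall y, differentiable f y) -> differentiable (grad f) x ->
  (hessian f x)^T = hessian f x.
Proof.
move=> df dg; apply/matrixP => i j; rewrite !mxE.
have E k : (fun y => grad f y ord0 k) = 'D_(delta_mx 0 k) f.
  by apply/funext => y; rewrite mxE.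
have dE k : differentiable ('D_(delta_mx 0 k) f) x.
  rewrite -E; apply: (differentiable_comp (g := fun M : 'rV[R]_d => M ord0 k) dg).
  exact: differentiable_coord.
by rewrite !E; apply: derive_mixedC => // y; exact: diff_derivable.
Qed.

(** * The SAGA iterates *)

Lemma grad_favg (R : realType) (N d : nat) (F : 'I_N -> 'rV[R]_d -> R) x :
  (forall k x, differentiable (F k) x) ->
  grad (favg F) x = N%:R^-1 *: \sum_k grad (F k) x.
Proof.
move=> dF; apply/rowP => i; rewrite !mxE summxE.
have dFi k : derivable (F k) x (delta_mx 0 i) by exact: diff_derivable.
have -> : favg F = N%:R^-1 \*: (\sum_(k < N) F k).
  by apply/funext => y; rewrite /favg /= fct_sumE.
rewrite deriveZ; last by apply: derivable_sum.
by rewrite derive_sum//; congr (_ * _); apply: eq_bigr => k _; rewrite mxE.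
Qed.

Lemma mulmx_coord_le (R : realType) (m n : nat) (v : 'rV[R]_m) (B : 'M[R]_(m, n)) (M : R) k :
  (forall j, `|v ord0 j| <= M) -> `|(v *m B) ord0 k| <= M * \sum_j `|B j k|.
Proof.
move=> vM; rewrite mxE (le_trans (ler_norm_sum _ _ _))// mulr_sumr.
by apply: ler_sum => j _; rewrite normrM ler_wpM2r.
Qed.

Lemma mx_norm_rV_le (R : realType) (d : nat) (v : 'rV[R]_d) (M : R) :
  0 <= M -> (forall j, `|v ord0 j| <= M) -> `|v| <= M.
Proof.
move=> M0 vM; rewrite [leLHS]mx_normrE; apply: bigmax_le => // -[i j] _ /=.
by rewrite (ord1 i) vM.
Qed.

(** Row i of the Hessian differentiates the i-th partial derivative, so a row vector v is multiplied
    by its transpose. *)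
Lemma grad_linearization (R : realType) (d : nat) (f : 'rV[R]_d -> R) (xs : 'rV[R]_d) (c : R) :
  differentiable (grad f) xs -> grad f xs = 0 -> 0 < c ->
  exists2 r : R, 0 < r & forall v, `|v| < r -> forall i,
    `|(grad f (xs + v) - v *m (hessian f xs)^T) ord0 i| <= c * `|v|.
Proof.
move=> dg g0 c0.
have dgi i : differentiable (fun x => grad f x ord0 i : R) xs.
  apply: (differentiable_comp (g := fun M : 'rV[R]_d => M ord0 i : R) dg).
  exact: differentiable_coord.
have /choice[r Hr] : forall i, exists r : R, 0 < r /\ forall v, `|v| < r ->
    `|grad f (xs + v) ord0 i - grad f xs ord0 i - 'd (fun x => grad f x ord0 i : R) xs v| <= c * `|v|.
  by move=> i; have [r r0 H] := differentiable_bound (dgi i) c0; exists r.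
pose r0 := \big[Num.min/1]_i r i.
have r00 : 0 < r0 by apply: lt_bigmin => // i _; exact: (Hr i).1.
exists r0 => // v vr i.
have := (Hr i).2 v (lt_le_trans vr (bigmin_le_cond _ _ _)).
have g0i : grad f xs ord0 i = 0 by rewrite g0 mxE.
have cB (A B : 'rV[R]_d) : (A - B) ord0 i = A ord0 i - B ord0 i by rewrite !mxE.
rewrite g0i subr0 cB [(v *m _) ord0 i]mxE => /(_ isT).
rewrite (_ : 'd _ _ _ = \sum_j v ord0 j * (hessian f xs)^T j i)//.
rewrite {1}(row_sum_delta v) linear_sum; apply: eq_bigr => j _.
by rewrite linearZ/= !mxE -deriveE.
Qed.

Lemma ord_fun_bounds (R : realType) (d : nat) (h : 'I_d -> R) (c : R) : (0 < d)%N ->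
  (forall i, c < h i) -> exists rho hmax, c < rho /\ forall i, rho <= h i <= hmax.
Proof.
move=> d0 ch; exists (\big[Num.min/h (Ordinal d0)]_i h i), (\big[Num.max/h (Ordinal d0)]_i h i).
split; first by apply: lt_bigmin.
by move=> i; rewrite bigmin_le_cond//= le_bigmax_cond.
Qed.

Section saga_clt.
Context {R : realType} {dT : measure_display} {T : measurableType dT}
  {P : probability T R} {N d : nat} {F : 'I_N -> 'rV[R]_d -> R} {lam : R}
  {X0 X1 : T -> 'rV[R]_d} {U : nat -> T -> 'I_N} {xs : 'rV[R]_d}.
Hypothesis N0 : (0 < N)%N.
Hypothesis d0 : (0 < d)%N.
Hypothesis dF : forall k x, differentiable (F k) x.
Hypothesis sqX0 : sq_integrable_rv P X0.
Hypothesis sqX1 : sq_integrable_rv P X1.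
Hypothesis noise : saga_noise P X0 X1 U.
Hypothesis cF : forall k, continuous (grad (F k)).
Hypothesis dgf : differentiable (grad (favg F)) xs.
Hypothesis gxs : grad (favg F) xs = 0.
Variables (Q : 'M[R]_d) (h : 'rV[R]_d) (rho hmax : R).
Hypothesis uQ : Q \in unitmx.
Hypothesis hessE : hessian (favg F) xs = invmx Q *m diag_mx h *m Q.
Hypothesis hess_sym : (hessian (favg F) xs)^T = hessian (favg F) xs.
Hypothesis rho_gt : 2^-1 < rho.
Hypothesis h_bnd : forall i, rho <= h ord0 i <= hmax.

Local Notation HT := (histT (X0 := X0) (X1 := X1) (U := U)).
Local Notation gamma := (fun n : nat => n%:R^-1 : R).
Local Notation St := (saga_state F lam gamma X0 X1 U).
Local Notation X := (saga_X F lam gamma X0 X1 U).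
Local Notation A := (invmx Q).

Hypothesis X_cvg : {ae P, forall w, X n w @[n --> \oo] --> xs}.

(** State m belongs to time m + 1, hence the predecessor. *)
Let g n k w : 'rV[R]_d := (St n.-1 w).2 k.
Let gbar n w : 'rV[R]_d := N%:R^-1 *: \sum_(k < N) g n k w.
Let innov n u w : 'rV[R]_d := grad (F u) (X n w) - lam *: (g n u w - gbar n w).
Let gf n w : 'rV[R]_d := grad (favg F) (X n w).

Let y n w : 'rV[R]_d := (X n w - xs) *m A.
Let z u : 'rV[R]_d := ((1 - lam) *: grad (F u) xs) *m A.
Let q n w : 'rV[R]_d := gf n w *m A - y n w *m diag_mx h.
(** The centred noise of the gradient estimate minus its limit z_u, in the eigencoordinates. *)
Let e n u w : 'rV[R]_d := (innov n u w - gf n w) *m A - z u.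

Let N1 : N%:R != 0 :> R. Proof. by rewrite pnatr_eq0 -lt0n. Qed.

Let sum_grad x : \sum_u grad (F u) x = N%:R *: grad (favg F) x.
Proof. by rewrite grad_favg// scalerA divff// scale1r. Qed.

Let z_sum0 i : \sum_u z u ord0 i = 0.
Proof.
rewrite -summxE /z -mulmx_suml -scaler_sumr sum_grad gxs scaler0 scaler0 mul0mx.
by rewrite mxE.
Qed.

Let XS n w : (0 < n)%N -> X n.+1 w = X n w - n%:R^-1 *: innov n (U n.+1 w) w.
Proof. by case: n. Qed.

Let y_rec n w i : (0 < n)%N -> y n.+1 w ord0 i =
  (1 - h ord0 i / n%:R) * y n w ord0 i
  - (q n w ord0 i + e n (U n.+1 w) w ord0 i + z (U n.+1 w) ord0 i) / n%:R.
Proof.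
move=> n0; set u := U n.+1 w.
have -> : y n.+1 w = y n w - n%:R^-1 *: (innov n u w *m A).
  by rewrite /y XS// addrAC mulmxBl scalemxAl.
have -> : innov n u w *m A = q n w + e n u w + z u + y n w *m diag_mx h.
  rewrite /q /e [(innov n u w - gf n w) *m A]mulmxBl.
  move: (innov n u w *m A) (gf n w *m A) (z u) (y n w *m _) => a b c k.
  by apply/rowP => j; rewrite !mxE; ring.
rewrite mul_mx_diag; move: (q n w) (e n u w) (z u) (y n w) => a b c k.
by rewrite !mxE; ring.
Qed.

(** Unbiasedness of the estimator: stored gradients minus their mean sum to 0 over the index, and
    the gradients of the [F u] average to that of [favg F]. *)
Let e_sum0 n w i : (0 < n)%N -> \sum_u e n u w ord0 i = 0.
Proof.
move=> _; rewrite -summxE /e sumrB -mulmx_suml.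
have -> : \sum_u z u = 0 by apply/rowP => j; rewrite summxE z_sum0 mxE.
rewrite sumrB sumr_const card_ord /innov sumrB sum_grad -scaler_sumr sumrB sumr_const card_ord.
have -> : gbar n w *+ N = \sum_u g n u w.
  by rewrite -scaler_nat /gbar scalerA divff// scale1r.
rewrite subrr scaler0 !subr0.
rewrite /gf -[grad (favg F) _ *+ N]scaler_nat.
by rewrite subrr mul0mx mxE.
Qed.

Let mX n : (0 < n)%N ->
  forall i, measurable_fun setT ((fun w => X n w ord0 i) : HT n -> R).
Proof.
case: n => // n _ i; have := (saga_state_adapted (lam := lam) (gamma := gamma) cF n).1 i; exact.
Qed.

Let mg n k : (0 < n)%N ->
  forall i, measurable_fun setT ((fun w => g n k w ord0 i) : HT n -> R).
Proof.
case: n => // n _ i; have := (saga_state_adapted (lam := lam) (gamma := gamma) cF n).2 k i; exact.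
Qed.

Let m_gradF n u : (0 < n)%N ->
  forall i, measurable_fun setT ((fun w => grad (F u) (X n w) ord0 i) : HT n -> R).
Proof.
move=> n0 i; apply: (@measurable_rV_comp _ _ (HT n) _ (X n) (fun x => grad (F u) x ord0 i)).
  exact: mX.
exact: continuous_row_coord.
Qed.

Let m_gf n : (0 < n)%N ->
  forall i, measurable_fun setT ((fun w => gf n w ord0 i) : HT n -> R).
Proof.
move=> n0 i; have E w : gf n w ord0 i = N%:R^-1 * \sum_u grad (F u) (X n w) ord0 i.
  by rewrite /gf grad_favg// mxE summxE.
under eq_fun do rewrite E.
by apply: measurable_funM => //; apply: measurable_sum => u; exact: m_gradF.
Qed.

Let my n i : (0 < n)%N -> measurable_fun setT ((fun w => y n w ord0 i) : HT n -> R).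
Proof.
move=> n0; apply: (@measurable_mulmx_coord _ _ (HT n) _ _ (fun w => X n w - xs) A) => j.
have E w : (X n w - xs) ord0 j = X n w ord0 j - xs ord0 j by rewrite !mxE.
by under eq_fun do rewrite E; apply: measurable_funB => //; exact: mX.
Qed.

Let mq n i : (0 < n)%N -> measurable_fun setT ((fun w => q n w ord0 i) : HT n -> R).
Proof.
move=> n0; have E w : q n w ord0 i = (gf n w *m A) ord0 i - (y n w *m diag_mx h) ord0 i.
  by rewrite /q; move: (gf n w *m A) (y n w *m _) => a b; rewrite !mxE.
under eq_fun do rewrite E; apply: measurable_funB.
  by apply: (@measurable_mulmx_coord _ _ (HT n) _ _ (gf n) A) => j; exact: m_gf.
by apply: (@measurable_mulmx_coord _ _ (HT n) _ _ (y n) _) => j; exact: my.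
Qed.

Let me n u i : (0 < n)%N -> measurable_fun setT ((fun w => e n u w ord0 i) : HT n -> R).
Proof.
move=> n0; have E w : e n u w ord0 i = ((innov n u w - gf n w) *m A) ord0 i - z u ord0 i.
  by rewrite /e; move: (_ *m A) (z u) => a b; rewrite !mxE.
under eq_fun do rewrite E; apply: measurable_funB => //.
apply: (@measurable_mulmx_coord _ _ (HT n) _ _ (fun w => innov n u w - gf n w) A) => j.
have E2 w : (innov n u w - gf n w) ord0 j = grad (F u) (X n w) ord0 j
    - lam * (g n u w ord0 j - N%:R^-1 * \sum_k g n k w ord0 j) - gf n w ord0 j.
  rewrite /innov /gbar -summxE; move: (grad _ _) (g n u w) (\sum_k _) (gf n w) => a b c k.
  by rewrite !mxE.
under eq_fun do rewrite E2; apply: measurable_funB; last exact: m_gf.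
apply: measurable_funB; first exact: m_gradF.
apply: measurable_funM => //; apply: measurable_funB; first exact: mg.
by apply: measurable_funM => //; apply: measurable_sum => k; exact: mg.
Qed.

Let XyQ n w : X n w - xs = y n w *m Q.
Proof. by rewrite /y mulmxKV. Qed.

Let q_small (delta : R) : 0 < delta -> exists2 eps : R, 0 < eps &
  forall n w, (forall i, `|y n w ord0 i| <= eps) -> forall i,
    q n w ord0 i ^+ 2 <= delta * \sum_j y n w ord0 j ^+ 2.
Proof.
move=> delta0.
(* a and b bound multiplication by A and Q in the supremum norm, for passing between X - xs and
   y. *)
pose a := \sum_(i < d) \sum_j `|A j i|; pose b := \sum_(i < d) \sum_j `|Q j i|.
have a0 : 0 <= a by apply: sumr_ge0 => i _; exact: sumr_ge0.
have b0 : 0 <= b by apply: sumr_ge0 => i _; exact: sumr_ge0.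
have le_a i : \sum_j `|A j i| <= a.
  by rewrite /a [leRHS](bigD1 i)//= lerDl; apply: sumr_ge0 => k _; exact: sumr_ge0.
have le_b i : \sum_j `|Q j i| <= b.
  by rewrite /b [leRHS](bigD1 i)//= lerDl; apply: sumr_ge0 => k _; exact: sumr_ge0.
have ab0 : 0 < a * b + 1 by rewrite ltr_wpDl// mulr_ge0.
(* Chosen so that c a b <= sqrt delta. *)
pose c := Num.sqrt delta / (a * b + 1).
have c0 : 0 < c by rewrite divr_gt0// sqrtr_gt0.
have [r r0 Hr] := grad_linearization dgf gxs c0.
have b1 : 0 < b + 1 by rewrite ltr_wpDl.
pose eps := r / 2 / (b + 1); have eps0 : 0 < eps by rewrite !divr_gt0.
exists eps => // n w yeps i.
have v_le M : 0 <= M -> (forall j, `|y n w ord0 j| <= M) -> `|X n w - xs| <= M * b.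
  move=> M0 yM; apply: mx_norm_rV_le => [|j]; first exact: mulr_ge0.
  by rewrite XyQ; apply: le_trans (mulmx_coord_le _ _ yM) _; rewrite ler_wpM2l.
have vr : `|X n w - xs| < r.
  apply: le_lt_trans (v_le _ (ltW eps0) yeps) _.
  apply: (@le_lt_trans _ _ (eps * (b + 1))); first by rewrite ler_wpM2l ?(ltW eps0)// lerDl.
  by rewrite /eps divfK ?gt_eqF// ltr_pdivrMr// ltr_pMr// ltr1n.
have qE : q n w = (grad (favg F) (xs + (X n w - xs)) - (X n w - xs) *m (hessian (favg F) xs)^T) *m A.
  rewrite /q [xs + _]addrC subrK [RHS]mulmxBl; congr (_ - _).
  by rewrite hess_sym hessE /y -!mulmxA mulmxV// mulmx1.
pose M := Num.sqrt (\sum_j y n w ord0 j ^+ 2).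
have S0 : 0 <= \sum_j y n w ord0 j ^+ 2 by apply: sumr_ge0 => j _; exact: sqr_ge0.
have M0 : 0 <= M by exact: sqrtr_ge0.
have yM j : `|y n w ord0 j| <= M.
  rewrite -sqrtr_sqr ler_sqrt// (bigD1 j)//= lerDl.
  by apply: sumr_ge0 => k _; exact: sqr_ge0.
have q_le : `|q n w ord0 i| <= Num.sqrt delta * M.
  rewrite qE; apply: le_trans (mulmx_coord_le _ _ (Hr _ vr)) _.
  apply: (@le_trans _ _ (c * (M * b) * a)).
    apply: ler_pM => //.
    - by rewrite mulr_ge0// ltW.
    - exact: sumr_ge0.
    - by rewrite ler_wpM2l ?(ltW c0)// v_le.
  rewrite (_ : _ * a = c * (a * b) * M); last by ring.
  rewrite ler_wpM2r// /c mulrAC ler_pdivrMr// ler_wpM2l ?sqrtr_ge0// lerDl//.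
rewrite -[leLHS](@real_normK _ _ (num_real _)) -[leRHS](@sqr_sqrtr _ _) ?mulr_ge0 ?(ltW delta0)//.
by rewrite ler_pXn2r ?nnegrE ?sqrtr_ge0// sqrtrM// ltW.
Qed.

Let y_cvg0 : {ae P, forall w i, y n w ord0 i @[n --> \oo] --> 0}.
Proof.
apply: filterS X_cvg => w Xw i.
have H0 : ((0 : 'rV[R]_d) *m A) ord0 i = 0 :> R by rewrite mul0mx mxE.
rewrite -[X in _ --> X]H0; apply: cvg_mulmx_coord.
rewrite -[X in _ --> X](subrr xs); apply: cvgB => //; exact: cvg_cst.
Qed.

(** Once k has been drawn late enough, the gradient stored for k is always one at some X_j with j >=
    m, hence lies in the given neighbourhood B. *)
Let g_cvg : {ae P, forall w k, g n k w @[n --> \oo] --> grad (F k) xs}.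
Proof.
have := drawn_infinitely_often N0 sqX0 sqX1 noise.
apply: filterS2 X_cvg => w Xw hit k B nB.
have [m _ Hm] : \forall n \near \oo, B (grad (F k) (X n w)).
  have gFw : grad (F k) (X n w) @[n --> \oo] --> grad (F k) xs.
    by apply: (cvg_comp (fun n => X n w) (grad (F k)) Xw); exact: cF.
  exact: gFw _ nB.
(* With n >= m + 2, n is the index of an actual draw, and the iterate X_{n-1} whose gradient it
   stores comes after time m. *)
have [n mn Un] := hit k m.+2.
have n2 : n = n.-2.+2 by case: n mn {Un} => [|[]].
exists n => // j /= nj.
suff H l : B ((St (n.-1 + l) w).2 k).
  have := H (j.-1 - n.-1)%N; rewrite /g subnKC//.
  by rewrite -!subn1 leq_sub2r.
have Xl l' : (m <= l'.+1)%N -> B (grad (F k) (St l' w).1) by move=> ml; exact: (Hm l'.+1 ml).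
elim: l => [|l IH].
  rewrite addn0 n2 /= -n2 Un eqxx; apply: Xl.
  by rewrite -ltnS -n2 ltnW.
rewrite addnS /=; case: (_ == k) => //; apply: Xl.
by rewrite (leq_trans (ltnW (ltnW mn)))// -ltnS; case: (n) n2 => //= n' _; rewrite !ltnS leq_addr.
Qed.

(** The stored gradients tend to those at xs, whose mean is 0, so the estimator tends to (1 - lam)
    grad f_u (xs); this is where the factor (1 - lam)^2 of Sigma comes from. *)
Let e_cvg0 : {ae P, forall w u i, e n u w ord0 i @[n --> \oo] --> 0}.
Proof.
apply: filterS2 X_cvg g_cvg => w Xw gw u i.
have gFw k : grad (F k) (X n w) @[n --> \oo] --> grad (F k) xs.
  by apply: (cvg_comp (fun n => X n w) (grad (F k)) Xw); exact: cF.
pose gF k := grad (F k) xs.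
have sumE : \sum_k gF k = 0 by rewrite sum_grad gxs scaler0.
have lim0 : gF u - lam *: (gF u - N%:R^-1 *: \sum_k gF k) - N%:R^-1 *: \sum_k gF k =
   (1 - lam) *: gF u.
  by rewrite sumE scaler0 !subr0 scalerBl scale1r.
have H : (innov n u w - gf n w) @[n --> \oo] --> (1 - lam) *: gF u.
  rewrite -lim0; apply: cvgB.
    apply: cvgB; first exact: gFw.
    apply: cvgZl_tmp; apply: cvgB; first exact: gw.
    apply: cvgZl_tmp; exact: cvgr_sum.
  rewrite /gf; under eq_fun do rewrite grad_favg//.
  apply: cvgZl_tmp; exact: cvgr_sum.
have E n : e n u w ord0 i = ((innov n u w - gf n w) *m A) ord0 i - z u ord0 i.
  by rewrite /e; move: (_ *m A) (z u) => a b; rewrite !mxE.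
under eq_fun do rewrite E.
suff : ((innov n u w - gf n w) *m A) ord0 i - z u ord0 i @[n --> \oo] -->
    z u ord0 i - z u ord0 i by rewrite subrr.
apply: cvgB; last exact: cvg_cst.
exact: cvg_mulmx_coord.
Qed.

Local Notation Sigma := (Sigma_mx lam (hessian (favg F) xs) (Gamma_mx F xs)).

Let K : 'M[R]_d := \matrix_(k, l) (noise_cov z k l / (h ord0 k + h ord0 l - 1)).

Let SigmaE : Sigma = Q^T *m K *m Q.
Proof.
rewrite (Sigma_mx_diag lam _ uQ hessE); last first.
  by move=> i; have /andP[h1 _] := h_bnd i; exact: lt_le_trans h1.
congr (_ *m _ *m _); apply/matrixP => k l; rewrite mxE [RHS]mxE; congr (_ / _).
rewrite /Gamma_mx /noise_cov -scalemxAr -scalemxAl mxE mulrCA; congr (_ * _).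
rewrite mulmx_sumr mulmx_suml summxE mulr_sumr; apply: eq_bigr => u _.
rewrite mulmxA -trmx_mul -mulmxA mxE big_ord1 /z -!scalemxAl.
move: (grad (F u) xs *m A) => v; rewrite !mxE; ring.
Qed.

Let quadE (t : 'rV[R]_d) : (t *m Sigma *m t^T) ord0 ord0 =
  \sum_i \sum_j (t *m Q^T) ord0 i * (t *m Q^T) ord0 j *
    (noise_cov z i j / (h ord0 i + h ord0 j - 1)).
Proof.
have -> : t *m Sigma *m t^T = (t *m Q^T) *m K *m (t *m Q^T)^T.
  by rewrite SigmaE trmx_mul trmxK !mulmxA.
move: (t *m Q^T) => v; rewrite mxE exchange_big/=; apply: eq_bigr => j _.
by rewrite mxE mulr_suml; apply: eq_bigr => i _; rewrite !mxE; ring.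
Qed.

Lemma saga_char_cvg (t : 'rV[R]_d) (a : R) :
  Ex P (fun w => cos (((Num.sqrt n%:R *: (X n w - xs)) *m t^T) ord0 ord0 + a)) @[n --> \oo] -->
  cos a * expR (- (t *m Sigma *m t^T) ord0 ord0 / 2).
Proof.
rewrite quadE.
have H := perturbed_clt (t := t *m Q^T) (a := a) N0 d0 sqX0 sqX1 noise z_sum0 rho_gt h_bnd
  my mq me y_rec e_sum0 q_small y_cvg0 e_cvg0.
suff E n w : ((Num.sqrt n%:R *: (X n w - xs)) *m t^T) ord0 ord0 =
    Num.sqrt n%:R * dotv (t *m Q^T) (y n w).
  by under eq_fun do under eq_Rintegral do rewrite E.
rewrite -scalemxAl mxE XyQ -mulmxA -[Q]trmxK -trmx_mul mxE trmxK; congr (_ * _).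
by apply: eq_bigr => i _; rewrite [_^T i _]mxE mulrC.
Qed.

Let mV n : (0 < n)%N -> forall i,
  measurable_fun setT (fun w => (Num.sqrt n%:R *: (X n w - xs)) ord0 i).
Proof.
move=> n0 i; under eq_fun do rewrite mxE mxE [(- xs) _ _]mxE.
apply: measurable_funM => //; apply: measurable_funB => //.
exact: (histT_measurable_fun N0 sqX0 sqX1 noise n0 (mX n0 i)).
Qed.

(** The limit exp (- t Sigma t^T / 2) of expectations of cosines is at most 1, which is
    nonnegativity of the form. *)
Lemma Sigma_psd : psdmx Sigma.
Proof.
split.
  rewrite SigmaE !trmx_mul trmxK mulmxA; congr (_ *m _ *m _).
  apply/matrixP => k l; rewrite !mxE [h ord0 l + _]addrC; congr (_ / _).
  by rewrite /noise_cov; congr (_ * _); apply: eq_bigr => u _; rewrite mulrC.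
move=> t; have H := @saga_char_cvg t 0.
have : cos (0 : R) * expR (- (t *m Sigma *m t^T) ord0 ord0 / 2) <= 1.
  rewrite -(cvg_lim _ H)//; apply: limr_le; first by apply/cvg_ex; eexists; exact: H.
  near=> n; have n0 : (0 < n)%N by near: n; exists 1%N.
  rewrite -[leRHS](Ex_cst P); apply: Ex_le.
  - apply: bmeas_cos; apply: measurable_funD => //.
    by apply: measurable_mulmx_coord; exact: mV.
  - exact: bmeas_cst.
  - by move=> w; rewrite cos_le1.
rewrite cos0 mul1r -[leRHS](expR0 R) ler_expR mulNr oppr_le0.
by rewrite pmulr_lge0// invr_gt0.
Unshelve. all: end_near. Qed.

Lemma saga_tight (c : R) : 0 < c -> exists M : R, \forall n \near \oo,
  fine (P ((fun w => Num.sqrt n%:R *: (X n w - xs)) @^-1`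
    [set v | exists i, M < `|v ord0 i|])) <= c.
Proof.
move=> c0.
have [M HM] := perturbed_tight N0 d0 sqX0 sqX1 noise z_sum0 rho_gt h_bnd
  my mq me y_rec e_sum0 q_small y_cvg0 e_cvg0 c0.
pose b := \sum_(i < d) \sum_j `|Q j i|.
have le_b i : \sum_j `|Q j i| <= b.
  by rewrite /b [leRHS](bigD1 i)//= lerDl; apply: sumr_ge0 => k _; exact: sumr_ge0.
exists (M * b); move: HM; apply: filter_app; near=> n; apply: le_trans.
have n0 : (0 < n)%N by near: n; exists 1%N.
have m1 : measurable ((fun w => Num.sqrt n%:R *: (X n w - xs)) @^-1`
    [set v | exists i, M * b < `|v ord0 i|]).
  apply: (@measurable_exists_gt _ _ _ _
    (fun w i => `|(Num.sqrt n%:R *: (X n w - xs)) ord0 i|)) => i.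
  by apply: measurableT_comp => //; exact: mV.
have m2 : measurable [set w | exists i, M < Num.sqrt n%:R * `|y n w ord0 i|].
  apply: (@measurable_exists_gt _ _ _ _ (fun w i => Num.sqrt n%:R * `|y n w ord0 i|)) => i.
  apply: measurable_funM => //; apply: measurableT_comp => //.
  exact: (histT_measurable_fun N0 sqX0 sqX1 noise n0 (my i n0)).
apply: fine_le; rewrite ?fin_num_measure//; apply: le_measure; rewrite ?inE//.
move=> w /= [i]; apply: contraPP => /forallNP H; apply/negP; rewrite -leNgt.
have yM j : `|(Num.sqrt n%:R *: y n w) ord0 j| <= M.
  by rewrite mxE normrM (ger0_norm (sqrtr_ge0 _)) leNgt; apply/negP; exact: H.
(* The sign of M is inferred from the existence of a coordinate. *)
have M0 : 0 <= M by exact: le_trans (normr_ge0 _) (yM (Ordinal d0)).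
rewrite XyQ scalemxAl; apply: le_trans (mulmx_coord_le _ _ yM) _.
by rewrite ler_wpM2l.
Unshelve. all: end_near. Qed.

End saga_clt.

Theorem theorem2 (R : realType) (dT : measure_display) (T : measurableType dT)
  (P : probability T R) (N d : nat) (F : 'I_N -> 'rV[R]_d -> R)
  (lam : R) (X0 X1 : T -> 'rV[R]_d) (U : nat -> T -> 'I_N) (xs : 'rV[R]_d) :
  (0 < N)%N -> (0 < d)%N ->
  (forall k x, differentiable (F k) x) ->
  0 <= lam <= 1 ->
  sq_integrable_rv P X0 -> sq_integrable_rv P X1 ->
  saga_noise P X0 X1 U ->
  (forall k, continuous (grad (F k))) ->
  (forall x, differentiable (favg F) x /\ differentiable (grad (favg F)) x) ->
  grad (favg F) xs = 0 ->
  (forall x, grad (favg F) x = 0 -> x = xs) ->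
  (forall rho, eigenvalue (hessian (favg F) xs) rho -> 2%:R^-1 < rho) ->
  {ae P, forall w,
     (fun n => saga_X F lam (fun n => n%:R^-1) X0 X1 U n w) @ \oo --> xs} ->
  exists (dZ : measure_display) (TZ : measurableType dZ)
         (Q : probability TZ R) (Z : TZ -> 'rV[R]_d),
    gaussian_vec Q Z
      (Sigma_mx lam (hessian (favg F) xs) (Gamma_mx F xs)) /\
    cvg_law P
      (fun n w => Num.sqrt (n%:R) *:
                    (saga_X F lam (fun n => n%:R^-1) X0 X1 U n w - xs))
      Q Z.
Proof.
move=> N0 d0 dF _ sqX0 sqX1 noise cF df gxs _ eig X_cvg.
have dgf := (df xs).2.
have hsym := hessian_sym (fun y => (df y).1) dgf.
have [Q [h uQ hE]] := sym_diagonalizable hsym.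
have [rho [hmax [rho_gt h_bnd]]] : exists rho hmax : R, 2^-1 < rho /\
    forall i, rho <= h ord0 i <= hmax.
  apply: (ord_fun_bounds (h := fun i => h ord0 i) d0) => i.
  exact: eig (diag_eigenvalue i uQ hE).
have psd := Sigma_psd N0 d0 dF sqX0 sqX1 noise cF dgf gxs uQ hE hsym rho_gt h_bnd X_cvg.
have [dZ [TZ [Q' [Z gZ]]]] := gauss_cos_exists psd.
exists dZ, TZ, Q', Z; split; first exact: gauss_cos_gaussian_vec.
apply: levy_continuity.
- move=> n g cg; apply: measurable_rV_comp => // i.
  under eq_fun do rewrite mxE mxE [(- xs) _ _]mxE.
  apply: measurable_funM => //; apply: measurable_funB => //.
  (* The iterate at n = 0 is X0, which precedes the first history, at time 1. *)
  case: n => [|n]; first exact: (sqX0 i).1.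
  have := (saga_state_adapted (lam := lam) (gamma := fun n => n%:R^-1)
    (U := U) (X0 := X0) (X1 := X1) cF n).1 i.
  exact: (histT_measurable_fun N0 sqX0 sqX1 noise).
- by move=> g cg; apply: measurable_rV_comp => //; exact: gZ.1.
- move=> t a; rewrite gZ.2.
  exact: (saga_char_cvg N0 d0 dF sqX0 sqX1 noise cF dgf gxs uQ hE hsym rho_gt h_bnd X_cvg).
- move=> c c0.
  exact: (saga_tight N0 d0 dF sqX0 sqX1 noise cF dgf gxs uQ hE hsym rho_gt h_bnd X_cvg).
Qed.
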